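(* Let $d\ge3$, $V\ge0$, $V\in L_{p,loc}(\mathbf{R}^d)$ with some $p>d/2$, and let $Y(x,t)=\sqrt{V(x)}\,|x-t|^{-(d-2)}\sqrt{V(t)}$ for $x,t\in\mathbf{R}^d$. Let $m>1$ be an integer and $\theta\in(0,1)$. Suppose that for each $\vec l\in\mathbf{Z}^d$ a sequence $\{D_j(\vec l)\}_{j=1}^\infty$ of subsets of $Q_1(\vec l)$ forms a $(\log_m,\theta)$-dense system in $Q_1(\vec l)$, and that $\Xi_n(\vec l,j)\neq\emptyset$ for all $\vec l\in\mathbf{Z}^d$, $n\in\mathbf{N}$, $j\in\{1,\dots,n\}$. Let $\gamma:(0,r_0)\to(0,1)$, $r_0>1/m$, be a nondecreasing function with $\limsup_{r\downarrow0}r^{-2}\gamma(r)=\infty$, and put $\psi(m,n)=\gamma(m^{-n})\,\mathrm{mes}_d(Q(\vec0,n))$. If for every natural $n\ge1$ $$\lim_{|\vec l|\to\infty}\ \min_{\substack{\vec\xi,\vec\eta\in\bigcup_{j=1}^n\Xi_n(\vec l,j)\\ |\vec\xi-\vec\eta|\le\frac{\sqrt d}{\theta}m^{-(n-2)}}}(Y^\star)^\star\big(\psi(m,n);\,Q(\vec\xi,n),\,Q(\vec\eta,n)\big)=\infty,$$ then the spectrum of the operator $H=-\Delta+V(x)$ in $L_2(\mathbf{R}^d)$ is discrete.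
   Context: $H=-\Delta+V$ is the nonnegative self-adjoint operator in $L_2(\mathbf{R}^d)$ associated with the closed form $\int(|\nabla u|^2+V|u|^2)\,dx$; its spectrum is discrete if it consists only of isolated eigenvalues of finite multiplicity. $\mathrm{mes}_d$ is Lebesgue measure on $\mathbf{R}^d$; $Q=[0,1]^d$, $Q_r(y)=rQ+y$; $[x]$ is the integer part of $x$. A regular parallelepiped is a set of the form $\prod_{k=1}^d[a_k,b_k]$. A sequence $\{D_n\}_{n=1}^\infty$ of subsets of a cube $Q_1(y)$ is a $(\log_m,\theta)$-dense system in $Q_1(y)$ if (a) each $D_n$ is a finite union of regular parallelepipeds; (b) for any cube $Q_r(z)\subseteq Q_1(y)$ with $0<r<\min\{1,\frac1{\theta m^2}\}$ there is $j\in\{1,2,\dots,[\log_m(\frac1{\theta r})]\}$ such that for some regular parallelepiped $\Pi\subseteq D_j$ there is a cube $Q_{\theta r}(s)$ contained in $\Pi\cap Q_r(z)$. For $\vec\xi\in m^{-n}\mathbf{Z}^d$: $Q(\vec\xi,n)=Q_{m^{-n}}(\vec\xi)$; and $\Xi_n(\vec l,j)=\{\vec\xi\in m^{-n}\mathbf{Z}^d:\ Q(\vec\xi,n)\subseteq D_j(\vec l)\}$. Non-increasing rearrangement on a measurable set $E\subset\mathbf{R}^d$: $W^\star(u;E)=\sup\{\tau>0:\mathrm{mes}_d(\{x\in E:W(x)\ge\tau\})\ge u\}$ ($\sup\emptyset=0$) for nonnegative measurable $W$, $u>0$. Repeated non-increasing rearrangement of a nonnegative function $F(x,t)$ integrable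 on $E_1\times E_2$ (sets of finite measure): for a.e. $t\in E_2$ let $F^\star(\cdot,t)(u;E_1)$ be the rearrangement, at $u$, of $x\mapsto F(x,t)$ on $E_1$; then $(F^\star)^\star(u;E_1,E_2)$ is the rearrangement, at $u$, of $t\mapsto F^\star(\cdot,t)(u;E_1)$ on $E_2$. (Values of $Y$ on the null set $x=t$ are irrelevant.) *)

(* Defs.v *)
From HB Require Import structures.
From mathcomp Require Import all_boot all_order all_algebra.
From mathcomp Require Import all_classical all_reals all_analysis.
From mathcomp.real_closed Require Import complex.
Set Implicit Arguments.
Unset Strict Implicit.
Unset Printing Implicit Defensive.
Import Order.TTheory GRing.Theory Num.Theory.
Import numFieldNormedType.Exports.
Local Open Scope classical_set_scope.
Local Open Scope ring_scope.

(* R^d is 'rV[R]_d with the sigma-algebra generated by the coordinates (the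
   Borel sets); d-dimensional Lebesgue measure is the iterated product of
   one-dimensional Lebesgue measures, see mes_box below. *)
Definition measure_row_display : measure_display -> measure_display.
Proof. exact. Qed.

Section measurable_row.
Context {d} {T : measurableType d} (n : nat).

Let coors (i : 'I_n) (x : 'rV[T]_n) : T := x ord0 i.

Let row_set0 : g_sigma_preimage coors set0.
Proof. exact: sigma_algebra0. Qed.

Let row_setC A : g_sigma_preimage coors A -> g_sigma_preimage coors (~` A).
Proof. exact: sigma_algebraC. Qed.

Let row_bigcup (F : _^nat) : (forall i, g_sigma_preimage coors (F i)) ->
  g_sigma_preimage coors (\bigcup_i (F i)).
Proof. exact: sigma_algebra_bigcup. Qed.

HB.instance Definition _ := @isMeasurable.Build (measure_row_display d)
  'rV[T]_n (g_sigma_preimage coors) row_set0 row_setC row_bigcup.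

Lemma measurable_coord (i : 'I_n) :
  measurable_fun setT (fun x : 'rV[T]_n => x ord0 i).
Proof.
move=> _ Y mY; rewrite setTI; apply: sub_sigma_algebra => /=.
rewrite -bigcup_seq/=; exists i => /=; first by rewrite mem_index_enum.
by exists Y => //; rewrite setTI.
Qed.

Lemma measurable_fun_row d1 (T1 : measurableType d1) (f : T1 -> 'rV[T]_n) :
  (forall i, measurable_fun setT (fun t => f t ord0 i)) -> measurable_fun setT f.
Proof.
move=> mf _ Y mY; rewrite setTI.
have : measurable `<=` [set Y : set 'rV[T]_n | measurable (f @^-1` Y)].
  apply: smallest_sub.
  - split; first by rewrite /= preimage_set0.
    + by move=> A mA; rewrite /= setTD preimage_setC; exact: measurableC.
    + by move=> F mF; rewrite /= preimage_bigcup; exact: bigcupT_measurable.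
  - move=> A; rewrite -bigcup_seq/= => -[i _ [B mB <-]].
    rewrite setTI/= -[X in measurable X]setTI; exact: (mf i).
exact.
Qed.
End measurable_row.

Section cons_row.
Context d (T : measurableType d) (n : nat).

Definition cons_row (p : T * 'rV[T]_n) : 'rV[T]_n.+1 :=
  \row_i oapp (p.2 ord0) p.1 (unlift ord0 i).

Lemma measurable_cons_row : measurable_fun setT cons_row.
Proof.
apply: measurable_fun_row => i.
case: (unliftP ord0 i) => [j|] ->.
- rewrite (_ : (fun _ => _) = (fun x : 'rV[T]_n => x ord0 j) \o snd).
    by apply: measurableT_comp => //; exact: measurable_coord.
  by apply/funext => p /=; rewrite mxE liftK.
- rewrite (_ : (fun _ => _) = fst) //.
  by apply/funext => p /=; rewrite mxE unlift_none.
Qed.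
End cons_row.

Section cons_measure.
Context {R : realType} (n : nat).
Variable nu : {sigma_finite_measure set 'rV[R]_n -> \bar R}.
Local Open Scope ereal_scope.

Definition cons_measure : set 'rV[R]_n.+1 -> \bar R :=
  pushforward (@lebesgue_measure R \x nu) (@cons_row _ R n).

Let mcons : measurable_fun setT (@cons_row _ (measurableTypeR R) n) :=
  @measurable_cons_row _ (measurableTypeR R) n.

Let cons_measure0 : cons_measure set0 = 0.
Proof. by rewrite /cons_measure /pushforward preimage_set0 measure0. Qed.

Let cons_measure_ge0 A : 0 <= cons_measure A.
Proof. exact: measure_ge0. Qed.

Let cons_measure_sigma_additive : semi_sigma_additive cons_measure.
Proof.
have := @measure_semi_sigma_additive _ _ _
  (measure_function_pushforward__canonical__measure_function_Measure
     (@lebesgue_measure R \x nu)%E mcons).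
exact.
Qed.

HB.instance Definition _ := isMeasure.Build _ _ _ cons_measure
  cons_measure0 cons_measure_ge0 cons_measure_sigma_additive.

Let uncons (x : 'rV[R]_n.+1) : measurableTypeR R * 'rV[R]_n :=
  (x ord0 ord0, \row_j x ord0 (lift ord0 j)).

Let consK : cancel (@cons_row _ R n) uncons.
Proof.
move=> [a v]; rewrite /uncons /cons_row mxE unlift_none; congr pair.
by apply/rowP => j; rewrite !mxE liftK.
Qed.

Let measurable_uncons : measurable_fun setT uncons.
Proof.
apply: measurable_fun_pair; first exact: measurable_coord.
apply: measurable_fun_row => i.
rewrite (_ : (fun _ => _) = (fun x : 'rV[R]_n.+1 => x ord0 (lift ord0 i))).
  exact: measurable_coord.
by apply/funext => x; rewrite mxE.
Qed.

Let cons_measure_sigma_finite : sigma_finite setT cons_measure.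
Proof.
have /sigma_finiteP[F [TF ndF mF]] := sigma_finiteT (@lebesgue_measure R).
have /sigma_finiteP[G [TG ndG mG]] := sigma_finiteT nu.
exists (fun k => uncons @^-1` (F k `*` G k)).
  apply/seteqP; split=> // x _.
  have [i _ Fi] : (\bigcup_i F i) (uncons x).1 by rewrite -TF.
  have [j _ Gj] : (\bigcup_i G i) (uncons x).2 by rewrite -TG.
  exists (maxn i j) => //; split.
    by move: (uncons x).1 Fi; exact/subsetPset/ndF/leq_maxl.
  by move: (uncons x).2 Gj; exact/subsetPset/ndG/leq_maxr.
move=> k; have [mFk oFk] := mF k; have [mGk oGk] := mG k; split.
  rewrite -[X in measurable X]setTI; apply: measurable_uncons => //.
  exact: measurableX.
rewrite /cons_measure /pushforward -comp_preimage.
rewrite (_ : uncons \o _ = id); last by apply/funext => p; exact: consK.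
by rewrite preimage_id product_measure1E// lte_mul_pinfty// ge0_fin_numE.
Qed.

HB.instance Definition _ := Measure_isSigmaFinite.Build _ _ _ cons_measure
  cons_measure_sigma_finite.

End cons_measure.

Fixpoint mes {R : realType} (d : nat) :
    {sigma_finite_measure set 'rV[R]_d -> \bar R} :=
  match d with
  | 0 => \d_ (0 : 'rV[R]_0)
  | n.+1 => cons_measure (mes n)
  end.

Section geometry.
Context {R : realType} {d : nat}.
Implicit Types (a b x y : 'rV[R]_d) (D P : set 'rV[R]_d).

(* The library norm on row vectors is the maximum norm. *)
Definition euclid_norm x : R := Num.sqrt (\sum_i x ord0 i ^+ 2).

Definition int_vec (l : 'rV[int]_d) : 'rV[R]_d := map_mx intr l.

Definition unit_cube : set 'rV[R]_d := [set x | forall i, 0 <= x ord0 i <= 1].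

Definition cube (r : R) y : set 'rV[R]_d := [set r *: x + y | x in unit_cube].

Definition box a b : set 'rV[R]_d :=
  [set x | forall i, a ord0 i <= x ord0 i <= b ord0 i].

Definition regular_parallelepiped P :=
  exists a b, (forall i, a ord0 i <= b ord0 i) /\ P = box a b.

Definition finite_union_of_parallelepipeds D :=
  exists (N : nat) (P : 'I_N -> set 'rV[R]_d),
    (forall k, regular_parallelepiped (P k)) /\ D = \bigcup_k P k.

(* Only the sets D j with j >= 1 matter.  Since theta * r < 1 here, the integer
   part of log_m (1 / (theta * r)) is its truncation to nat. *)
Definition log_dense_system (m : nat) (theta : R) y (D : nat -> set 'rV[R]_d) :=
  [/\ forall j, (1 <= j)%N -> D j `<=` cube 1 y,
      forall j, (1 <= j)%N -> finite_union_of_parallelepipeds (D j) &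
      forall (r : R) (z : 'rV[R]_d), cube r z `<=` cube 1 y ->
        0 < r < Num.min 1 (1 / (theta * m%:R ^+ 2)) ->
        exists j : nat,
          (1 <= j <= Num.truncn (ln (1 / (theta * r)) / ln m%:R))%N /\
          exists P, [/\ regular_parallelepiped P, P `<=` D j &
            exists s, cube (theta * r) s `<=` P `&` cube r z]].

(* Lower-left corners xi in m^-n Z^d of the grid cubes of edge m^-n inside D *)
Definition grid_corners (m n : nat) D : set 'rV[R]_d :=
  [set xi | (exists k : 'rV[int]_d, xi = m%:R ^- n *: int_vec k) /\
            cube (m%:R ^- n) xi `<=` D].

End geometry.

Lemma mes_box {R : realType} (d : nat) (a b : 'rV[R]_d) :
  (forall i, a ord0 i <= b ord0 i) ->
  mes d (box a b) = (\prod_i (b ord0 i - a ord0 i))%:E.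
Proof.
elim: d a b => [|d IH] a b ab.
  rewrite big_ord0 /= diracE mem_set//; by case.
pose tl (x : 'rV[R]_d.+1) : 'rV[R]_d := \row_j x ord0 (lift ord0 j).
have -> : mes d.+1 (box a b) = (@lebesgue_measure R \x mes d)%E
    (`[a ord0 ord0, b ord0 ord0] `*` box (tl a) (tl b)).
  rewrite /= /cons_measure /pushforward; congr (_ _).
  apply/seteqP; split => -[x y] /=.
    move=> H; split; first by have := H ord0; rewrite /cons_row mxE unlift_none/= in_itv.
    by move=> i; have := H (lift ord0 i); rewrite /cons_row /tl !mxE liftK.
  move=> [+ H] i; rewrite in_itv/= => xab; rewrite /cons_row mxE.
  case: (unliftP ord0 i) => [j ->|-> //] /=.
  by have := H j; rewrite /tl !mxE.
have mb : measurable (box (tl a) (tl b)).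
  rewrite (_ : box _ _ = \bigcap_(i in setT) (fun x : 'rV[R]_d => x ord0 i) @^-1` `[tl a ord0 i, tl b ord0 i]).
    apply: fin_bigcap_measurable => //i _; rewrite -[X in measurable X]setTI.
    exact: measurable_coord.
  apply/seteqP; split => x /= H; first by move=> i _; rewrite /= in_itv /= H.
  by move=> i; have := H i I; rewrite /= in_itv.
rewrite product_measure1E//.
rewrite [X in (X * _)%E]lebesgue_measure_itv IH; last by move=> i; rewrite !mxE.
rewrite big_ord_recl EFinM /= lte_fin; congr (_ * _)%E.
  case: ltP => // ba; have -> : b ord0 ord0 = a ord0 ord0 by apply/le_anti; rewrite ba ab.
  by rewrite subrr.
by congr _%:E; apply: eq_bigr => i _; rewrite !mxE.
Qed.

Section rearrangement.
Context {R : realType} {d : nat}.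
Local Open Scope ereal_scope.

(* maxe 0 implements the convention sup set0 = 0. *)
Definition rearrangement (W : 'rV[R]_d -> \bar R) (u : R) (E : set 'rV[R]_d) :
    \bar R :=
  maxe 0 (ereal_sup [set tau%:E | tau in [set tau : R |
    (0 < tau)%R /\ u%:E <= mes d (E `&` [set x | tau%:E <= W x])]]).

Definition repeated_rearrangement (F : 'rV[R]_d -> 'rV[R]_d -> \bar R) (u : R)
    (E1 E2 : set 'rV[R]_d) : \bar R :=
  rearrangement (fun t => rearrangement (fun x => F x t) u E1) u E2.

End rearrangement.

Section function_spaces.
Context {R : realType} {d : nat}.
Local Notation rV := 'rV[R]_d.
Local Notation mu := (mes d : {measure set 'rV[R]_d -> \bar R}).
Implicit Types (u v f g : rV -> R[i]) (phi : rV -> R).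

Definition Lp_loc (p : R) (V : rV -> R) :=
  measurable_fun setT V /\
  forall K : set rV, compact K ->
    (\int[mes d]_(x in K) (`|V x| `^ p)%:E < +oo)%E.

(* Elements of L_2 are represented by Borel measurable square-integrable
   functions; equality in L_2 is equality almost everywhere. *)
Definition L2 u :=
  (fun x => complex.Re (u x)) \in Lfun mu 2%:E /\
  (fun x => complex.Im (u x)) \in Lfun mu 2%:E.

Definition L2norm u : R := Num.sqrt (\int[mes d]_x Normc.normc (u x) ^+ 2).

Definition cintegral u : R[i] :=
  Complex (\int[mes d]_x complex.Re (u x)) (\int[mes d]_x complex.Im (u x)).

Definition L2inner f g : R[i] := cintegral (fun x => f x * (g x)^*).

Definition partial (i : 'I_d) phi : rV -> R := 'D_(delta_mx ord0 i) phi.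

Definition smooth phi :=
  forall s : seq 'I_d,
    continuous (foldr partial phi s) /\
    forall i x, derivable (foldr partial phi s) x (delta_mx ord0 i).

Definition test_function phi :=
  smooth phi /\ compact (closure [set x | phi x != 0]).

Definition weak_partial (i : 'I_d) u g :=
  forall phi, test_function phi ->
    cintegral (fun x => u x * (partial i phi x)%:C%C) =
    - cintegral (fun x => g x * (phi x)%:C%C).

Definition weak_gradient u (gu : 'I_d -> rV -> R[i]) :=
  forall i, L2 (gu i) /\ weak_partial i u (gu i).

End function_spaces.

Section schrodinger.
Context {R : realType} {d : nat}.
Local Notation rV := 'rV[R]_d.
Variable V : rV -> R.
Implicit Types (u v f : rV -> R[i]).

(* The largest domain on which the form is finite: W^1_2 with V|u|^2
   integrable; the form is closed there when V >= 0 is locally integrable. *)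
Definition form_domain u :=
  [/\ L2 u, exists gu, weak_gradient u gu &
      L2 (fun x => (Num.sqrt (V x))%:C%C * u x)].

Definition form u (gu : 'I_d -> rV -> R[i]) v (gv : 'I_d -> rV -> R[i]) : R[i] :=
  cintegral (fun x =>
    \sum_i gu i x * (gv i x)^* + (V x)%:C%C * u x * (v x)^*).

(* The graph of H = - Delta + V, the operator given by the first representation
   theorem: u is in the domain and H u = f iff form u v = <f, v> for every v in
   the form domain. Weak gradients are unique almost everywhere. *)
Definition schrodinger u f :=
  [/\ form_domain u, L2 f &
    exists2 gu, weak_gradient u gu &
    forall v gv, form_domain v -> weak_gradient v gv ->
      form u gu v gv = L2inner f v].

End schrodinger.

Section spectrum.
Context {R : realType} {d : nat}.
Local Notation rV := 'rV[R]_d.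
(* The graph of a linear operator in L_2 *)
Variable A : (rV -> R[i]) -> (rV -> R[i]) -> Prop.
Implicit Types (u f : rV -> R[i]) (z : R[i]).

(* A - z is a bijection from the domain of A onto L_2 with bounded inverse. *)
Definition resolvent_set : set R[i] := [set z |
  [/\ forall f, L2 f -> exists u, A u (fun x => z * u x + f x),
      forall u, A u (fun x => z * u x) -> \forall x \ae mes d, u x = 0 &
      exists c : R, forall u f, L2 f -> A u (fun x => z * u x + f x) ->
        L2norm u <= c * L2norm f]].

Definition spectrum : set R[i] := ~` resolvent_set.

Definition isolated_in (S : set R[i]) z :=
  S z /\ exists2 e : R, 0 < e & forall w, S w -> Normc.normc (w - z) < e -> w = z.

Definition eigenvector z u := A u (fun x => z * u x).

Definition eigenvalue z :=
  exists2 u, eigenvector z u & ~ (\forall x \ae mes d, u x = 0).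

Definition finite_multiplicity z :=
  exists (n : nat) (w : 'I_n -> rV -> R[i]),
    (forall k, eigenvector z (w k)) /\
    forall u, eigenvector z u ->
      exists c : 'I_n -> R[i], \forall x \ae mes d, u x = \sum_k c k * w k x.

Definition discrete_spectrum :=
  forall z, spectrum z ->
    [/\ isolated_in spectrum z, eigenvalue z & finite_multiplicity z].

End spectrum.

Definition kernelY {R : realType} {d : nat} (V : 'rV[R]_d -> R)
    (x t : 'rV[R]_d) : R :=
  Num.sqrt (V x) * euclid_norm (x - t) ^- (d - 2) * Num.sqrt (V t).

Definition psi {R : realType} (d : nat) (gamma : R -> R) (m n : nat) : R :=
  gamma (m%:R ^- n) * fine (mes d (cube (m%:R ^- n) 0)).

(* Main.v *)
Require Import Defs.
From HB Require Import structures.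
From mathcomp Require Import all_boot all_order all_algebra.
From mathcomp Require Import all_classical all_reals all_analysis.
From mathcomp.real_closed Require Import complex.
From mathcomp Require Import measurable_realfun ring lra.
Set Implicit Arguments.
Unset Strict Implicit.
Unset Printing Implicit Defensive.
Import Order.TTheory GRing.Theory Num.Theory.
Import numFieldNormedType.Exports.
Local Open Scope classical_set_scope.
Local Open Scope ring_scope.

(* The form a of H + 1 controls the L_2 norm up to finitely many functionals: for
   every eps > 0, ||u||^2 <= eps a(u, u) + sum_k l_k(u)^2.  By Lax-Milgram and a
   finite-rank perturbation argument every z is then either in the resolvent set
   or an eigenvalue, which is real by symmetry; the eigenspaces are finite
   dimensional and the eigenvalues isolated because the l_k separate orthogonal
   eigenvectors.
   On bounded sets the inequality is Poincare's on small cubes, the l_k being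
   averages; it comes from ||u(. + h) - u|| <= C |h| ||grad u||.  Far away, the
   hypothesis with xi = eta makes V >= sigma, with sigma as large as we please, on
   a set of measure psi(m, n) / 2 in a grid cube of the system, and every cube of
   edge comparable to m^-n contains such a grid cube.  Comparing u(x) with u(y)
   for y in that set bounds the far part of ||u||^2 by
   C m^(-2n) / gamma(m^-n) ||grad u||^2 + C' / sigma int V |u|^2, and the first
   coefficient is small for suitable n by the limsup condition. *)

(** * Riesz representation and the Fredholm alternative *)

(** The analysis is carried out over the reals. A complex function together with its weak gradient
    is a family of real functions, multiplication by [i] rotates the two halves of this family, and
    a complex identity tested against all [v] is equivalent to its real part tested against all [v],
    because [i v] is again admissible. Functions equal almost everywhere stay distinct, so inner
    products are only semidefinite, and uniqueness and spanning hold up to null vectors. The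
    finitely many functionals play the part of a compact embedding: what remains of Fredholm theory
    is linear algebra with a square matrix of their number. Test functions are products of
    one-variable bumps. They converge to indicators of boxes, and a square-integrable function is
    determined almost everywhere by its integrals over boxes. The order of choices matters in the
    far estimate: given eps, the limsup condition fixes n, hence the tiles and the measure kappa;
    only then is sigma chosen, since the limit at infinity is available for each fixed n; the radius
    beyond which tiles count as far comes last. *)

Section real_scalars.
Context {R : realType}.

(** The case [A = 0] occurs for null vectors of a semidefinite form; the conclusion then says that
    [X] vanishes. *)
Lemma quadratic_disc (A X d : R) : 0 <= A ->
  (forall t, 0 <= t ^+ 2 * A + 2 * t * X + d) -> X ^+ 2 <= A * d.
Proof.
rewrite le_eqVlt => /predU1P[<-|A0] H.
  rewrite mul0r; have [->|X0] := eqVneq X 0; first by rewrite expr0n.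
  (* At this [t] the expression, affine because [A = 0], equals [-1]. *)
  have := H (- (d + 1) / (2 * X)).
  rewrite mulr0 add0r (_ : 2 * (- (d + 1) / (2 * X)) * X = - (d + 1)); last by field.
  by move=> ?; exfalso; lra.
have := H (- X / A).
have -> : (- X / A) ^+ 2 * A + 2 * (- X / A) * X + d = d - X ^+ 2 / A.
  by field; rewrite gt_eqF.
by rewrite subr_ge0 ler_pdivrMr// mulrC.
Qed.

Lemma small_nonneg_eq0 (x c : R) : 0 <= x ->
  (forall e, 0 < e -> x <= c * e) -> x = 0.
Proof.
move=> x0 H; apply/eqP; rewrite eq_le x0 andbT; apply/ler_addgt0Pr => e e0.
rewrite add0r; have c1 : 0 < `|c| + 1 by rewrite ltr_wpDl.
apply: le_trans (H (e / (`|c| + 1)) _) _; first by rewrite divr_gt0.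
rewrite mulrCA ger_pMr// ler_pdivrMr// mul1r.
by rewrite (le_trans (ler_norm _))// lerDl.
Qed.

End real_scalars.

Section semi_inner_product.
Context {R : realType} {E : lmodType R}.
Implicit Types (D : set E) (b : E -> E -> R) (f : E -> R).

Definition submodule D :=
  [/\ D 0, forall u v, D u -> D v -> D (u + v) &
      forall k u, D u -> D (k *: u)].

Definition linear_on D f :=
  (forall u v, D u -> D v -> f (u + v) = f u + f v) /\
  (forall k u, D u -> f (k *: u) = k * f u).

Definition bilinear_on D b :=
  (forall w, D w -> linear_on D (b ^~ w)) /\ (forall u, D u -> linear_on D (b u)).

(** Definiteness is left out on purpose: a function vanishing almost everywhere is a null vector
    without being [0]. *)
Definition semi_inner D b :=
  [/\ bilinear_on D b, forall u v, D u -> D v -> b u v = b v u &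
      forall u, D u -> 0 <= b u u].

Definition form_complete D b := forall u : nat -> E, (forall n, D (u n)) ->
  (forall e, 0 < e -> exists N, forall n k, (N <= n)%N -> (N <= k)%N ->
     b (u n - u k) (u n - u k) < e) ->
  exists2 v, D v & forall e, 0 < e -> exists N, forall n, (N <= n)%N ->
     b (u n - v) (u n - v) < e.

Lemma submoduleB D u v : submodule D -> D u -> D v -> D (u - v).
Proof. by case=> _ DD DZ Du Dv; apply: DD => //; rewrite -scaleN1r; exact: DZ. Qed.

Lemma submodule_sum D (I : Type) (r : seq I) (c : I -> R) (w : I -> E) :
  submodule D -> (forall i, D (w i)) -> D (\sum_(i <- r) c i *: w i).
Proof.
by case=> D0 DD DZ Dw; elim/big_ind : _ => // i _; exact: DZ.
Qed.

Lemma linear_on_sum D f (I : Type) (r : seq I) (c : I -> R) (w : I -> E) :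
  submodule D -> linear_on D f -> (forall i, D (w i)) ->
  f (\sum_(i <- r) c i *: w i) = \sum_(i <- r) c i * f (w i).
Proof.
move=> sD [fD fZ] Dw; have [D0 DD DZ] := sD.
elim: r => [|i r IH].
  by rewrite !big_nil -(scale0r (0 : E)) fZ// mul0r.
rewrite !big_cons fD ?fZ ?IH//; first exact: DZ.
exact: submodule_sum.
Qed.

Lemma linear_onB D f u v : submodule D -> linear_on D f -> D u -> D v ->
  f (u - v) = f u - f v.
Proof.
move=> [D0 DD DZ] [fD fZ] Du Dv; rewrite -scaleN1r fD ?fZ ?mulN1r//; exact: DZ.
Qed.

Lemma linear_onZD D f g (k : R) : linear_on D f -> linear_on D g ->
  linear_on D (fun u => f u + k * g u).
Proof.
move=> [fD fZ] [gD gZ]; split=> [u v Du Dv|c u Du].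
  by rewrite fD// gD//; ring.
by rewrite fZ// gZ//; ring.
Qed.

Lemma linear_on_big D (I : Type) (r : seq I) (k : I -> R) (f : I -> E -> R) :
  (forall i, linear_on D (f i)) ->
  linear_on D (fun u => \sum_(i <- r) k i * f i u).
Proof.
move=> fl; split=> [u v Du Dv|c u Du].
  rewrite -big_split; apply: eq_bigr => i _; case: (fl i) => -> // _.
  by rewrite mulrDr.
rewrite mulr_sumr; apply: eq_bigr => i _; case: (fl i) => _ ->//.
by rewrite mulrCA.
Qed.

Section theory.
Variables (D : set E) (b : E -> E -> R).
Hypotheses (sD : submodule D) (bP : semi_inner D b).

Lemma siDl u v w : D u -> D v -> D w -> b (u + v) w = b u w + b v w.
Proof. by case: bP => -[bl _] _ _ Du Dv Dw; case: (bl w Dw) => ->. Qed.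

Lemma siZl k u w : D u -> D w -> b (k *: u) w = k * b u w.
Proof. by case: bP => -[bl _] _ _ Du Dw; case: (bl w Dw) => _ ->. Qed.

Lemma siC u v : D u -> D v -> b u v = b v u.
Proof. by case: bP => _ + _; apply. Qed.

Lemma si_ge0 u : D u -> 0 <= b u u.
Proof. by case: bP => _ _; apply. Qed.

Lemma siDr u v w : D u -> D v -> D w -> b w (u + v) = b w u + b w v.
Proof. by case: bP => -[_ br] _ _ Du Dv Dw; case: (br w Dw) => ->. Qed.

Lemma siZr k u w : D u -> D w -> b w (k *: u) = k * b w u.
Proof. by case: bP => -[_ br] _ _ Du Dw; case: (br w Dw) => _ ->. Qed.

Lemma si_sqrD u v t : D u -> D v ->
  b (u + t *: v) (u + t *: v) = b u u + 2 * t * b u v + t ^+ 2 * b v v.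
Proof.
case: sD => D0 DD DZ Du Dv.
have Dtv : D (t *: v) by exact: DZ.
rewrite siDl ?siDr ?siZl ?siZr//; try exact: DD.
by rewrite (siC Dv Du); ring.
Qed.

Lemma cauchy_schwarz u v : D u -> D v -> b u v ^+ 2 <= b u u * b v v.
Proof.
move=> Du Dv; rewrite mulrC; apply: quadratic_disc; first exact: si_ge0.
move=> t; have := si_ge0 (_ : D (u + t *: v)); rewrite si_sqrD// => H.
have {}H : D (u + t *: v) -> 0 <= b u u + 2 * t * b u v + t ^+ 2 * b v v by [].
by case: sD => _ DD DZ; have := H (DD _ _ Du (DZ _ _ Dv)); lra.
Qed.

Lemma si_sqrB u v : D u -> D v -> b (u - v) (u - v) = b u u - 2 * b u v + b v v.
Proof. by move=> Du Dv; rewrite -scaleN1r si_sqrD//; ring. Qed.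

Lemma si_sqrD_le u v : D u -> D v ->
  b (u + v) (u + v) <= 2 * b u u + 2 * b v v.
Proof.
move=> Du Dv.
have := si_sqrD 1 Du Dv; rewrite scale1r => ->.
have := si_ge0 (submoduleB sD Du Dv); rewrite si_sqrB//.
by move=> H; lra.
Qed.

(* The representing vector minimises b h h - 2 f h; the parallelogram law makes
   every minimising sequence Cauchy. *)
Theorem riesz_representation f F : form_complete D b -> linear_on D f ->
  0 <= F -> (forall u, D u -> f u ^+ 2 <= F * b u u) ->
  exists2 g, D g & forall h, D h -> b g h = f h.
Proof.
move=> cb fl F0 fF; have [fD fZ] := fl; have [D0 DD DZ] := sD.
pose J h := b h h - 2 * f h.
have Jge h : D h -> - F <= J h.
  move=> Dh; have := fF h Dh; have := si_ge0 Dh; rewrite /J.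
  move: (b h h) (f h) => B x B0 H.
  (* [4 x^2 <= 4 F B <= (B + F)^2], so [J] is bounded below by [- F]. *)
  have : (2 * x) ^+ 2 <= (B + F) ^+ 2 by have := sqr_ge0 (B - F); nra.
  move=> H2; suff : 2 * x <= B + F by lra.
  by rewrite leNgt; apply/negP => H3; nra.
have hasinf : has_inf [set J h | h in D].
  split; first by exists (J 0), 0.
  by exists (- F) => _ [h Dh <-]; exact: Jge.
pose I := inf [set J h | h in D].
have Ile h : D h -> I <= J h.
  by move=> Dh; apply: ge_inf; [case: hasinf|exists h].
have /choice[h hP] n : exists h, D h /\ J h < I + n.+1%:R^-1.
  have n0 : 0 < n.+1%:R^-1 :> R by rewrite invr_gt0.
  by have [_ [h Dh <-] ?] := inf_adherent n0 hasinf; exists h.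
have Dh n : D (h n) := (hP n).1.
have hC : forall e, 0 < e -> exists N, forall n k, (N <= n)%N -> (N <= k)%N ->
     b (h n - h k) (h n - h k) < e.
  (* [b (h n - h k) (h n - h k)] equals [2 J (h n) + 2 J (h k) - 4 J q] with [q] the midpoint; since
     [J q >= I], an excess of [e / 4] over [I] in each of the first two terms suffices. *)
  move=> e e0; pose N := Num.truncn (4 / e); exists N.
  have small n : (N <= n)%N -> J (h n) < I + e / 4.
    move=> Nn; apply: lt_trans (hP n).2 _; rewrite ltrD2l invf_plt ?posrE ?divr_gt0//.
    rewrite invf_div; apply: lt_le_trans (truncnS_gt _) _.
    by rewrite ler_nat ltnS.
  move=> n k /small Hn /small Hk.
  have Dk1 : D (1 *: h k) by exact: DZ.
  have Dnk : D (h n + 1 *: h k) by exact: DD.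
  have Dnk2 : D (2^-1 *: (h n + 1 *: h k)) by exact: DZ.
  have := Ile _ Dnk2; rewrite /J siZl// siZr// fZ// si_sqrD// fD// fZ//.
  rewrite si_sqrB//; move: Hn Hk; rewrite /J; lra.
have [g Dg gP] := cb h Dh hC.
exists g => // v Dv; apply/eqP; rewrite -subr_eq0 -sqrf_eq0; apply/eqP.
apply: (small_nonneg_eq0 (c := 4 * (b v v))); first exact: sqr_ge0.
move=> e e0; have [N1 HN1] := gP e e0.
pose n := maxn N1 (Num.truncn e^-1).
have N1n : (N1 <= n)%N by rewrite leq_maxl.
have ne : n.+1%:R^-1 <= e.
  rewrite invf_ple ?posrE//; apply: ltW; apply: lt_le_trans (truncnS_gt _) _.
  by rewrite ler_nat ltnS leq_maxr.
(* For every [t], [J (h n + t v) >= I > J (h n) - e]: a quadratic polynomial in [t] is nonnegative,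
   and its discriminant gives an approximate Euler equation. *)
have H1 : (b (h n) v - f v) ^+ 2 <= b v v * e.
  apply: quadratic_disc; first exact: si_ge0.
  move=> t; have := Ile _ (DD _ _ (Dh n) (DZ t _ Dv)).
  have := (hP n).2; rewrite /J si_sqrD// fD ?fZ//; last exact: DZ.
  move: ne; move: n.+1%:R^-1 (b (h n) (h n)) (b (h n) v) (f (h n)) => q w x y.
  by nra.
have H2 := cauchy_schwarz (submoduleB sD Dg (Dh n)) Dv.
have {}H2 : (b g v - b (h n) v) ^+ 2 <= e * b v v.
  apply: le_trans (_ : b (g - h n) (g - h n) * b v v <= _).
    by apply: le_trans H2; rewrite -scaleN1r siDl ?siZl// ?mulN1r//; exact: DZ.
  rewrite ler_wpM2r ?si_ge0// -scaleN1r -[g]opprK -scaleN1r.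
  rewrite -scalerDr addrC siZl ?siZr; try by [apply: DZ; exact: submoduleB|exact: submoduleB].
  by rewrite mulrA mulrNN !mul1r ltW// HN1.
have := sqr_ge0 (b g v - b (h n) v - (b (h n) v - f v)).
move: H1 H2; move: (b v v) (b (h n) v) (b g v) (f v) => B x y z.
by move=> *; nra.
Qed.
End theory.

Lemma form_complete_equiv D a b (k M : R) : submodule D -> 0 < k ->
  (forall u, D u -> k * a u u <= b u u) ->
  (forall u, D u -> b u u <= M * a u u) ->
  (forall u, D u -> 0 <= a u u) ->
  form_complete D a -> form_complete D b.
Proof.
move=> sD k0 kb bM a0 ca u Du uC.
have [|v Dv uv] := ca u Du.
  move=> e e0; have [N HN] := uC (k * e) (mulr_gt0 k0 e0).
  exists N => n l Nn Nl; have := HN _ _ Nn Nl.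
  have := kb _ (submoduleB sD (Du n) (Du l)).
  by move=> H1 H2; have := le_lt_trans H1 H2; rewrite ltr_pM2l.
exists v => // e e0.
have M1 : 0 < `|M| + 1 by rewrite ltr_wpDl.
have [N HN] := uv (e / (`|M| + 1)) (divr_gt0 e0 M1); exists N => n Nn.
have Dx := submoduleB sD (Du n) Dv.
apply: le_lt_trans (bM _ Dx) _; have := HN _ Nn; rewrite ltr_pdivlMr//.
apply: le_lt_trans; rewrite mulrC ler_wpM2l ?a0//.
by rewrite (le_trans (ler_norm _))// lerDl.
Qed.

(* The Riesz theorem is applied twice: to represent B(., w) by a vector S w, and
   then to the inner product a (S w) (S w'). *)
Theorem lax_milgram D a (B : E -> E -> R) (k M : R) f F :
  submodule D -> semi_inner D a -> form_complete D a ->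
  bilinear_on D B -> 0 < k -> 0 <= M ->
  (forall u, D u -> k * a u u <= B u u) ->
  (forall u v, D u -> D v -> B u v ^+ 2 <= M * (a u u * a v v)) ->
  linear_on D f -> 0 <= F -> (forall u, D u -> f u ^+ 2 <= F * a u u) ->
  exists2 g, D g & forall h, D h -> B g h = f h.
Proof.
move=> sD aP ca [Bl Br] k0 M0 kB BM fl F0 fF.
have /choice[S SP] w : exists g, D w -> D g /\ forall h, D h -> a g h = B h w.
  have [Dw|] := pselect (D w); last by exists 0.
  have F1 : 0 <= M * a w w by rewrite mulr_ge0// (si_ge0 aP).
  have F2 u : D u -> B u w ^+ 2 <= M * a w w * a u u.
    by move=> Du; rewrite -mulrA [a w w * _]mulrC; exact: BM.
  by have [g Dg gP] := riesz_representation sD aP ca (Bl w Dw) F1 F2; exists g.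
have DS w : D w -> D (S w) by move=> /SP[].
have aS w h : D w -> D h -> a (S w) h = B h w by move=> /SP[_ +]; apply.
pose b w w' := a (S w) (S w').
have bE w w' : D w -> D w' -> b w w' = B (S w') w.
  by move=> Dw Dw'; rewrite /b aS//; exact: DS.
have bE' w w' : D w -> D w' -> b w w' = B (S w) w'.
  by move=> Dw Dw'; rewrite -(bE w' w)// /b (siC aP)//; exact: DS.
have bP : semi_inner D b.
  split.
  - split=> w Dw; (split=> [u v Du Dv|c u Du]; have [_ DD DZ] := sD).
    + rewrite !bE//; last exact: DD.
      by case: (Br _ (DS _ Dw)) => ->.
    + rewrite !bE//; last exact: DZ.
      by case: (Br _ (DS _ Dw)) => _ ->.
    + rewrite !bE'//; last exact: DD.
      by case: (Br _ (DS _ Dw)) => ->.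
    + rewrite !bE'//; last exact: DZ.
      by case: (Br _ (DS _ Dw)) => _ ->.
  - by move=> u v Du Dv; rewrite /b (siC aP)//; exact: DS.
  - by move=> u Du; rewrite /b (si_ge0 aP)//; exact: DS.
(* [k a(u, u) <= B u u = a (S u) u], whose square is at most [b u u * a u u] by Cauchy-Schwarz. *)
have kb u : D u -> k ^+ 2 * a u u <= b u u.
  move=> Du; have := cauchy_schwarz sD aP (DS _ Du) Du; rewrite aS// -/(b u u).
  have := kB u Du; have := si_ge0 aP Du; have := si_ge0 bP Du.
  move: (b u u) (a u u) (B u u) => x y z x0 y0 yz zxy.
  move: y0; rewrite le_eqVlt => /predU1P[<-|y0]; first by rewrite mulr0.
  rewrite -(ler_pM2r y0); apply: le_trans zxy.
  rewrite -mulrA -!expr2 -exprMn ler_sqr ?nnegrE//.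
    by rewrite mulr_ge0// ltW.
  by apply: le_trans yz; rewrite mulr_ge0// ltW.
have bM u : D u -> b u u <= M * a u u.
  move=> Du; have := BM _ _ (DS _ Du) Du; rewrite -bE// -/(b u u).
  have := si_ge0 aP Du; have := si_ge0 bP Du.
  move: (b u u) (a u u) => x y x0 y0.
  move: x0; rewrite le_eqVlt => /predU1P[<-|x0]; first by rewrite mulr_ge0.
  by rewrite expr2 mulrCA ler_pM2l.
have cb : form_complete D b.
  by apply: (form_complete_equiv sD (exprn_gt0 2 k0) kb bM) => //; exact: (si_ge0 aP).
have F1 : 0 <= F / k ^+ 2 by rewrite divr_ge0// sqr_ge0.
have F2 u : D u -> f u ^+ 2 <= F / k ^+ 2 * b u u.
  move=> Du; apply: le_trans (fF u Du) _; rewrite -mulrA ler_wpM2l//.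
  by rewrite mulrC ler_pdivlMr ?exprn_gt0// mulrC kb.
have [g Dg gP] := riesz_representation sD bP cb fl F1 F2.
(* The vector [g] represents [f] for [b], and [b g h = B (S g) h], so [S g] is the solution for
   [B]. *)
exists (S g) => [|h Dh]; first exact: DS.
by rewrite -bE'// gP.
Qed.

(** Iterating [(S + y)^2 <= 2 S^2 + 2 y^2] yields [2 ^+ n], larger than the optimal [n]; only some
    finite constant matters below. *)
Lemma sqr_sum_le n (x : 'I_n -> R) :
  (\sum_i x i) ^+ 2 <= 2 ^+ n * \sum_i x i ^+ 2.
Proof.
elim: n x => [|n IH] x; first by rewrite !big_ord0 expr0n mulr0.
rewrite !big_ord_recr/=; have := IH (fun i => x (widen_ord (leqnSn n) i)).
have T0 : 0 <= \sum_(i < n) x (widen_ord (leqnSn n) i) ^+ 2.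
  by apply: sumr_ge0 => i _; exact: sqr_ge0.
move: (\sum_(i < n) _ ^+ 2) T0 (\sum_(i < n) _) (x ord_max) => T T0 S y ST.
have n1 : 1 <= 2 ^+ n :> R by rewrite exprn_ege1// ler1n.
rewrite [2 ^+ n.+1]exprS; move: (2 ^+ n) n1 ST => q q1 ST.
have : 0 <= (q - 1) * y ^+ 2 by rewrite mulr_ge0 ?sqr_ge0 ?subr_ge0.
by have := sqr_ge0 (S - y); nra.
Qed.

(* Adding a large multiple of \sum_k l k u * l k v makes the form coercive, and
   removing it again is a finite-rank perturbation, governed by a K x K matrix. *)
Theorem fredholm_alternative D a c s K (l : 'I_K -> E -> R) (eps Z L : R) :
  submodule D -> semi_inner D a -> form_complete D a -> semi_inner D c ->
  (forall u, D u -> c u u <= a u u) ->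
  bilinear_on D s -> 0 <= Z ->
  (forall u v, D u -> D v -> s u v ^+ 2 <= Z ^+ 2 * (c u u * c v v)) ->
  (forall k, linear_on D (l k)) -> 0 <= L ->
  (forall k u, D u -> l k u ^+ 2 <= L * a u u) ->
  (forall u, D u -> c u u <= eps * a u u + \sum_k l k u ^+ 2) ->
  Z * eps <= 1 / 2 ->
  (exists2 u, D u & c u u != 0 /\ forall v, D v -> a u v = s u v) \/
  (exists2 C, 0 <= C & forall f F, linear_on D f -> 0 <= F ->
     (forall u, D u -> f u ^+ 2 <= F * a u u) ->
     (exists2 u, D u & forall v, D v -> a u v = s u v + f v) /\
     (forall u, D u -> (forall v, D v -> a u v = s u v + f v) ->
        a u u <= C * F)).
Proof.
move=> sD aP ca cP ca_le sbil Z0 sZ ll L0 lL cl Ze.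
have [D0 DD DZ] := sD.
have a0 := si_ge0 aP; have c0 := si_ge0 cP.
pose S u v := \sum_k l k u * l k v.
have SE u : S u u = \sum_k l k u ^+ 2 by apply: eq_bigr => k _; rewrite expr2.
pose B u v := a u v - s u v + Z * S u v.
have Sl w : linear_on D (S w) by apply: linear_on_big.
have Sr w : linear_on D (S ^~ w).
  have -> : S ^~ w = fun u => \sum_k l k w * l k u.
    by apply/funext => u; apply: eq_bigr => k _; rewrite mulrC.
  exact: linear_on_big.
have BE u v : B u v = a u v + (-1) * s u v + Z * S u v by rewrite mulN1r.
have Bbil : bilinear_on D B.
  case: aP => -[al ar] _ _; case: sbil => sl sr; split=> w Dw.
    rewrite (_ : B ^~ w = fun u => a u w + (-1) * s u w + Z * S u w).
      by apply: linear_onZD => //; apply: linear_onZD; [exact: al|exact: sl].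
    by apply/funext => u.
  rewrite (_ : B w = fun u => a w u + (-1) * s w u + Z * S w u).
    by apply: linear_onZD => //; apply: linear_onZD; [exact: ar|exact: sr].
  by apply/funext => u.
(* [s u u <= Z c u u <= Z eps a u u + Z S u u]: the added multiple of [S] cancels the last term, and
   [Z eps <= 1 / 2] leaves half of [a u u]. *)
have Bco u : D u -> 2^-1 * a u u <= B u u.
  move=> Du; have := cl u Du; rewrite -SE /B; have := a0 u Du; have := c0 u Du.
  have : s u u <= Z * c u u.
    have H := sZ u u Du Du; rewrite leNgt; apply/negP => H'.
    have := mulr_ge0 Z0 (c0 u Du); nra.
  have := Ze; move: (a u u) (c u u) (s u u) (S u u) => x y z t H1 H2 H3 H4 H5.
  nra.
have [M M0 BM] : exists2 M, 0 <= M & forall u v, D u -> D v ->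
    B u v ^+ 2 <= M * (a u u * a v v).
  (* From [(x - y + Z z)^2 <= 3 x^2 + 3 y^2 + 3 Z^2 z^2], each square being bounded by a multiple of
     [a u u * a v v]. *)
  exists (3 + 3 * Z ^+ 2 + 3 * (Z ^+ 2 * (2 ^+ K * (L ^+ 2 *+ K)))).
    by rewrite !addr_ge0// !mulr_ge0// ?sqr_ge0// ?exprn_ge0// mulrn_wge0// sqr_ge0.
  move=> u v Du Dv.
  have H1 := cauchy_schwarz sD aP Du Dv.
  have H2 : s u v ^+ 2 <= Z ^+ 2 * (a u u * a v v).
    apply: le_trans (sZ u v Du Dv) _; rewrite ler_wpM2l ?sqr_ge0// ler_pM//;
      by [exact: c0|exact: ca_le].
  have H3 : S u v ^+ 2 <= 2 ^+ K * (L ^+ 2 *+ K) * (a u u * a v v).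
    apply: le_trans (sqr_sum_le _) _; rewrite -mulrA ler_wpM2l ?exprn_ge0//.
    rewrite mulrnAl -[in leRHS](card_ord K) -sumr_const ler_sum// => k _.
    rewrite exprMn; apply: le_trans (_ : (L * a u u) * (L * a v v) <= _); last first.
      by rewrite le_eqVlt; apply/orP; left; apply/eqP; ring.
    by rewrite ler_pM// ?sqr_ge0// lL.
  have H4 := ler_wpM2l (sqr_ge0 Z) H3.
  move: H1 H2 H4; rewrite /B.
  move: (2 ^+ K * _) => q.
  move: (a u u * a v v) (a u v) (s u v) (S u v) => A x y z H1 H2 H4.
  have := sqr_ge0 (x + y); have := sqr_ge0 (x - Z * z); have := sqr_ge0 (y + Z * z).
  nra.
have est u F : D u -> B u u ^+ 2 <= F * a u u -> 0 <= F -> a u u <= 4 * F.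
  move=> Du H F0; have := Bco u Du; have := a0 u Du.
  move: (a u u) (B u u) H => x y H x0 xy.
  rewrite leNgt; apply/negP => xF.
  nra.
have solve f F : linear_on D f -> 0 <= F ->
    (forall u, D u -> f u ^+ 2 <= F * a u u) ->
    exists2 g, D g & forall h, D h -> B g h = f h.
  by apply: (lax_milgram sD aP ca Bbil (_ : 0 < 2^-1) M0 Bco BM).
have /choice[G GP] k : exists g, D g /\ forall h, D h -> B g h = l k h.
  by have [g] := solve (l k) L (ll k) L0 (lL k); exists g.
have DG k : D (G k) := (GP k).1.
have BDl u v w : D u -> D v -> D w -> B (u + v) w = B u w + B v w.
  by move=> Du Dv Dw; case: (Bbil.1 w Dw) => ->.
have BGsum (e : 'I_K -> R) v : D v -> B (\sum_i e i *: G i) v = \sum_i e i * l i v.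
  move=> Dv; rewrite (linear_on_sum _ _ sD (Bbil.1 v Dv) DG).
  by apply: eq_bigr => i _; rewrite (GP i).2.
(* In terms of [B], the unknown enters the right-hand side only through the numbers [Z * l k u]. Up
   to a null vector, a solution is therefore the [B]-solution for [f] plus a combination of the
   [G k] with these coefficients. *)
have aBP u f : D u -> (forall v, D v -> a u v = s u v + f v) <->
    (forall v, D v -> B u v = f v + \sum_k Z * l k u * l k v).
  move=> Du; have ZS v : \sum_k Z * l k u * l k v = Z * S u v.
    by rewrite mulr_sumr; apply: eq_bigr => k _; rewrite mulrA.
  by split=> H v Dv; have := H v Dv; rewrite /B ZS; lra.
(* A row [e] with [e *m P = 0] satisfies [e j = Z * l j u] for [u] the combination of the [G i] with
   coefficients [e], so this [u] solves the homogeneous equation. *)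
pose P : 'M[R]_K := 1%:M - Z *: \matrix_(i, j) l j (G i).
have PE (e : 'rV[R]_K) j : (e *m P) ord0 j =
    e ord0 j - Z * l j (\sum_i e ord0 i *: G i).
  rewrite mulmxBr mulmx1 -scalemxAr !mxE; congr (_ - Z * _).
  rewrite (linear_on_sum _ _ sD (ll j) DG).
  by apply: eq_bigr => i _; rewrite !mxE.
have [Pu|Pn] := boolP (P \in unitmx); last first.
  left; have /det0P[e e0 eP] : \det P == 0.
    by move: Pn; rewrite unitmxE unitfE negbK.
  pose u := \sum_i e ord0 i *: G i.
  have Du : D u by exact: submodule_sum.
  have eE j : e ord0 j = Z * l j u.
    have := PE e j; rewrite eP mxE => /esym/eqP; rewrite subr_eq0 => /eqP.
    by [].
  have au v : D v -> a u v = s u v.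
    move=> Dv; have /(aBP u (fun=> 0) Du)/(_ v Dv) : forall v, D v ->
        B u v = 0 + \sum_k Z * l k u * l k v.
      move=> w Dw; rewrite add0r BGsum//; apply: eq_bigr => i _.
      by rewrite -eE.
    by rewrite addr0.
  (* As [c] controls [s], [c u u = 0] would give [a u u = s u u = 0], then [l j u = 0] for all [j],
     hence [e = 0]. *)
  exists u => //; split => //; apply: contra_neq e0 => cu0.
  have au0 : a u u = 0.
    rewrite au//; have := sZ u u Du Du; rewrite cu0 mul0r mulr0.
    by rewrite real_exprn_even_le0 ?num_real//= => /eqP.
  apply/rowP => j; rewrite eE mxE.
  have := lL j u Du; rewrite au0 mulr0 real_exprn_even_le0 ?num_real//= => /eqP ->.
  by rewrite mulr0.
right.
(* [Ck k * F] will bound [e k ^ 2]: the [4] is that of [est], applied to [a g g], and the matrix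
   entries come from solving for [e] with [invmx P]. *)
pose Ck k := Z ^+ 2 * (2 ^+ K * \sum_j (4 * L * (invmx P) j k ^+ 2)).
have Ck0 k : 0 <= Ck k.
  rewrite /Ck !mulr_ge0 ?sqr_ge0 ?exprn_ge0//; apply: sumr_ge0 => j _.
  by apply: mulr_ge0; [exact: mulr_ge0|exact: sqr_ge0].
pose C := 4 * (2 + 2 * (2 ^+ K * (\sum_k Ck k * L))).
exists C => [|f F fl F0 fF].
  by rewrite /C !(mulr_ge0, addr_ge0) ?exprn_ge0// sumr_ge0// => k _; rewrite mulr_ge0.
have [g Dg gP] := solve f F fl F0 fF.
pose lam : 'rV[R]_K := \row_j l j g.
have key (e : 'rV[R]_K) : (forall j, e ord0 j = Z * l j (g + \sum_i e ord0 i *: G i)) <->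
    e = Z *: (lam *m invmx P).
  transitivity (e *m P = Z *: lam); last first.
    by rewrite scalemxAl; split=> [<-|->]; rewrite ?mulmxK ?mulmxKV.
  have Dsum : D (\sum_i e ord0 i *: G i) by exact: submodule_sum.
  have lgD j : l j (g + \sum_i e ord0 i *: G i) = l j g + l j (\sum_i e ord0 i *: G i).
    by case: (ll j) => ->.
  split=> H.
    by apply/rowP => j; rewrite PE H lgD !mxE; ring.
  by move=> j; have /rowP/(_ j) := H; rewrite PE lgD !mxE => /eqP; rewrite subr_eq => /eqP ->; ring.
pose e := Z *: (lam *m invmx P).
have eP : forall j, e ord0 j = Z * l j (g + \sum_i e ord0 i *: G i) by apply/key.
have DGs (e' : 'rV[R]_K) : D (\sum_i e' ord0 i *: G i) by exact: submodule_sum.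
split.
  exists (g + \sum_i e ord0 i *: G i); first exact: DD.
  apply/aBP => [|v Dv]; first exact: DD.
  rewrite BDl// gP// BGsum//; congr (_ + _); apply: eq_bigr => k _.
  by rewrite -eP.
move=> u Du /(aBP _ _ Du) uP.
pose e' : 'rV[R]_K := \row_j (Z * l j u).
(* [r] is annihilated by [B], so by coercivity it is null for [a] and the functionals do not see it.
   Hence the coefficients [e'] of [u] satisfy the fixed-point equation of [key]. *)
pose r := u - (g + \sum_i e' ord0 i *: G i).
have Dw : D (g + \sum_i e' ord0 i *: G i) by exact: DD.
have Dr : D r by exact: submoduleB.
have Br v : D v -> B r v = 0.
  move=> Dv; rewrite /r (linear_onB sD (Bbil.1 v Dv))// uP// BDl// gP// BGsum//.
  by apply/eqP; rewrite subr_eq0; apply/eqP; congr (_ + _); apply: eq_bigr => i _; rewrite mxE.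
have ar0 : a r r = 0.
  by apply/eqP; rewrite eq_le a0// andbT; have := Bco r Dr; rewrite Br//; lra.
have lr j : l j r = 0.
  by have := lL j r Dr; rewrite ar0 mulr0 real_exprn_even_le0 ?num_real//= => /eqP.
have e'E : e' = e.
  apply/key => j; rewrite mxE; congr (Z * _).
  by have := lr j; rewrite /r (linear_onB sD (ll j))// => /eqP; rewrite subr_eq0 => /eqP.
have ag : a g g <= 4 * F by apply: est => //; rewrite gP//; exact: fF.
have eC k : e ord0 k ^+ 2 <= Ck k * F.
  rewrite !mxE exprMn /Ck -[leRHS]mulrA ler_wpM2l ?sqr_ge0//.
  apply: le_trans (sqr_sum_le _) _; rewrite -mulrA ler_wpM2l ?exprn_ge0//.
  rewrite mulr_suml ler_sum// => j _; rewrite mxE exprMn [leRHS]mulrAC ler_wpM2r ?sqr_ge0//.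
  apply: le_trans (lL j g Dg) _.
  by rewrite [4 * L]mulrC -mulrA ler_wpM2l.
apply: le_trans (est u ((2 + 2 * (2 ^+ K * (\sum_k Ck k * L))) * F) Du _ _) _.
- rewrite uP//.
  have -> : \sum_k Z * l k u * l k u = \sum_k e ord0 k * l k u.
    by apply: eq_bigr => k _; rewrite -e'E mxE.
  have H1 := fF u Du.
  have H2 := sqr_sum_le (fun k => e ord0 k * l k u).
  have H3 : \sum_k (e ord0 k * l k u) ^+ 2 <= (\sum_k Ck k * L) * (F * a u u).
    rewrite mulr_suml ler_sum// => k _; rewrite exprMn.
    have -> : Ck k * L * (F * a u u) = (Ck k * F) * (L * a u u) by ring.
    by rewrite ler_pM ?sqr_ge0// lL.
  have H4 : 0 <= 2 ^+ K :> R by rewrite exprn_ge0.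
  have H5 := ler_wpM2l H4 H3; have H6 := le_trans H2 H5.
  move: H1 H6; move: (\sum_i _) (f u) (2 ^+ K) (\sum_k Ck k * L) (a u u) => x y q t A.
  move=> H1 H6; have := sqr_ge0 (x - y); nra.
- by rewrite mulr_ge0// addr_ge0// !mulr_ge0 ?exprn_ge0// sumr_ge0// => k _; rewrite mulr_ge0.
- by rewrite /C mulrA.
Qed.

End semi_inner_product.

(** * Finite-dimensional eigenspaces and isolated eigenvalues *)

Section eigenvalue_counting.
Context {R : realType} {E : lmodType R}.
Implicit Types (D N : set E) (a c : E -> E -> R).

Lemma max_size_exists (P : nat -> Prop) (K : nat) : P 0%N ->
  (forall n, P n -> (n <= K)%N) ->
  exists2 n, P n & forall k, P k -> (k <= n)%N.
Proof.
move=> P0 PK; have exP : exists n, `[< P n >] by exists 0%N; apply/asboolP.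
have leP n : `[< P n >] -> (n <= K)%N by move=> /asboolP/PK.
case: (ex_maxnP exP leP) => n /asboolP Pn nmax.
by exists n => // k Pk; apply: nmax; apply/asboolP.
Qed.

(** A family in [N] whose rows of values under the [l k] are independent has at most [K] members.
    For a maximal one, some combination takes the same values as [u], and the bound on [N] makes the
    difference null. *)
Lemma finite_span D N c K (l : 'I_K -> E -> R) (M : R) :
  submodule D -> semi_inner D c -> submodule N -> N `<=` D ->
  (forall k, linear_on D (l k)) ->
  (forall u, N u -> c u u <= M * \sum_k l k u ^+ 2) ->
  exists n (w : 'I_n -> E), (forall k, N (w k)) /\
    forall u, N u -> exists e : 'I_n -> R,
      let v := u - \sum_k e k *: w k in c v v = 0.
Proof.
move=> sD cP sN ND ll cl.
have lN k : linear_on N (l k).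
  have [lD lZ] := ll k; split=> [u v /ND Du /ND Dv|x u /ND Du]; by [rewrite lD|rewrite lZ].
pose A n (w : 'I_n -> E) : 'M[R]_(n, K) := \matrix_(i, j) l j (w i).
pose P n := exists w : 'I_n -> E, (forall k, N (w k)) /\ row_free (A n w).
have [||n [w [Nw Aw]] nmax] := @max_size_exists P K.
- exists (fun=> 0); split; first by move=> k; case: sN.
  by rewrite -row_leq_rank.
- by move=> n [w [_ /eqP <-]]; exact: rank_leq_col.
exists n, w; split => // u Nu.
pose r : 'rV[R]_K := \row_j l j u.
have : (r <= A n w)%MS.
  apply: contraT => rA.
  suff /nmax : P (n + 1)%N by rewrite addn1 ltnn.
  exists (fun i => match fintype.split i with inl k => w k | inr _ => u end); split.
    by move=> k; case: fintype.splitP => j _ /=; [exact: Nw|exact: Nu].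
  rewrite (_ : A _ _ = col_mx (A n w) r); last first.
    by apply/matrixP => i j; rewrite !mxE; case: fintype.splitP => k _; rewrite !mxE.
  rewrite -row_leq_rank -addsmxE addn1.
  have /eqP {1}<- : row_free (A n w) by [].
  rewrite ltn_neqAle mxrankS ?addsmxSl// andbT.
  apply: contra rA => /eqP E1.
  by rewrite (submx_trans (addsmxSr (A n w) r))// -(geq_leqif (mxrank_leqif_sup (addsmxSl _ _))) E1.
case/submxP => e eE; exists (fun k => e ord0 k) => v.
have Nv : N v.
  by apply: submoduleB => //; exact: submodule_sum.
apply/eqP; rewrite eq_le (si_ge0 cP) ?andbT; last exact: ND.
apply: le_trans (cl v Nv) _; rewrite big1 ?mulr0// => k _.
rewrite /v (linear_onB sN (lN k))//; last exact: submodule_sum.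
rewrite (linear_on_sum _ _ sN (lN k))//.
have /rowP/(_ k) := eE; rewrite !mxE => ->.
rewrite [X in X - _](eq_bigr (fun i => e ord0 i * l k (w i))).
  by rewrite subrr expr0n.
by move=> i _; rewrite mxE.
Qed.

(** If [n > K], a nontrivial combination [u] is annihilated by all [l k]. Orthogonality for both
    forms gives [a u u <= M * c u u], whence [c u u <= eps * M * c u u < c u u]. *)
Lemma orthogonal_family_bound D a c n (w : 'I_n -> E) K (l : 'I_K -> E -> R)
    (eps M : R) :
  submodule D -> semi_inner D a -> semi_inner D c ->
  (forall k, linear_on D (l k)) -> 0 <= eps -> eps * M < 1 ->
  (forall u, D u -> c u u <= eps * a u u + \sum_k l k u ^+ 2) ->
  (forall i, D (w i)) ->
  (forall i j, i != j -> a (w i) (w j) = 0 /\ c (w i) (w j) = 0) ->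
  (forall i, a (w i) (w i) <= M * c (w i) (w i) /\ 0 < c (w i) (w i)) ->
  (n <= K)%N.
Proof.
move=> sD aP cP ll e0 eM cl Dw ort wM.
rewrite leqNgt; apply/negP => Kn.
pose A : 'M[R]_(n, K) := \matrix_(i, j) l j (w i).
have /rowV0Pn[v vk v0] : kermx A != 0.
  by rewrite -mxrank_eq0 mxrank_ker -lt0n subn_gt0 (leq_ltn_trans (rank_leq_col _)).
have vA : v *m A = 0 by apply/sub_kermxP.
pose u := \sum_i v ord0 i *: w i.
have Du : D u by exact: submodule_sum.
have lu k : l k u = 0.
  rewrite (linear_on_sum _ _ sD (ll k))//.
  transitivity ((v *m A) ord0 k); last by rewrite vA mxE.
  by rewrite mxE; apply: eq_bigr => i _; rewrite !mxE.
have diag b : semi_inner D b -> (forall i j, i != j -> b (w i) (w j) = 0) ->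
    b u u = \sum_i v ord0 i ^+ 2 * b (w i) (w i).
  move=> bP bo; have [[bl br] _ _] := bP.
  rewrite (linear_on_sum _ _ sD (bl u Du))//; apply: eq_bigr => i _.
  rewrite (linear_on_sum _ _ sD (br _ (Dw i)))// (bigD1 i)//= big1 ?addr0.
    by rewrite mulrA expr2.
  by move=> j ji; rewrite bo 1?eq_sym// mulr0.
have := cl u Du; rewrite big1 ?addr0; last by move=> k _; rewrite lu expr0n.
have ca : a u u <= M * c u u.
  rewrite (diag a)// ?(diag c)//; [|by move=> i j /ort[]|by move=> i j /ort[]].
  rewrite mulr_sumr ler_sum// => i _; rewrite mulrCA ler_wpM2l ?sqr_ge0//.
  by case: (wM i).
have cu : 0 < c u u.
  rewrite (diag c)//; last by move=> i j /ort[].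
  have [i vi] : exists i, v ord0 i != 0.
    apply/existsP; apply: contraT; rewrite negb_exists => /forallP H.
    case/negP: v0; apply/eqP/rowP => i; rewrite mxE; apply/eqP.
    by have := H i; rewrite negbK.
  rewrite (bigD1 i)//= ltr_pwDl//.
    by rewrite mulr_gt0 ?exprn_even_gt0//; case: (wM i).
  by rewrite sumr_ge0// => j _; rewrite mulr_ge0 ?sqr_ge0// (si_ge0 cP).
have := ler_wpM2l e0 ca; move: (a u u) (c u u) cu => x y y0 H1 H2.
have : eps * M * y < 1 * y by rewrite ltr_pM2r.
by rewrite mul1r -mulrA => H3; have := le_lt_trans (le_trans H2 H1) H3; rewrite ltxx.
Qed.

Definition form_eigenvalue D a c (x : R) :=
  exists2 u, D u & c u u != 0 /\ forall v, D v -> a u v = x * c u v.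

(** Eigenvectors for distinct eigenvalues are orthogonal for both [a] and [c], so there are at most
    [K] eigenvalues below [M]; near [x0] all of them belong to a list of maximal size. *)
Theorem form_eigenvalue_isolated D a c (x0 : R) :
  submodule D -> semi_inner D a -> semi_inner D c ->
  (forall eps, 0 < eps -> exists K (l : 'I_K -> E -> R),
    (forall k, linear_on D (l k)) /\
    (forall u, D u -> c u u <= eps * a u u + \sum_k l k u ^+ 2)) ->
  exists2 e, 0 < e & forall x, form_eigenvalue D a c x -> `|x - x0| < e -> x = x0.
Proof.
move=> sD aP cP Hl.
pose M := `|x0| + 1.
have M0 : 0 < M by rewrite ltr_wpDl.
(* This value of [eps] gives [eps * M = 1 / 2 < 1]. *)
have [|K [l [ll cl]]] := Hl (2 * M)^-1; first by rewrite invr_gt0 mulr_gt0.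
pose P n := exists s : seq R, [/\ size s = n, uniq s &
  forall x, x \in s -> form_eigenvalue D a c x /\ x <= M].
have [||n [s [sn us sP]] nmax] := @max_size_exists P K.
- by exists [::].
- move=> n [s [sn us sP]].
  have /choice[w wP] (i : 'I_n) : exists u, [/\ D u, c u u != 0 &
      forall v, D v -> a u v = s`_i * c u v].
    have /sP[[u Du [cu uP]] _] : s`_i \in s by rewrite mem_nth// sn.
    by exists u.
  apply: (orthogonal_family_bound sD aP cP ll (w := w) _ _ cl (M := M)).
  + by rewrite invr_ge0 mulr_ge0// ltW.
  + by rewrite invfM mulfVK ?gt_eqF// invf_lt1// ltr1n.
  + by move=> i; case: (wP i).
  + move=> i j ij; have [Di _ Hi] := wP i; have [Dj _ Hj] := wP j.
    have H1 := Hi _ Dj; have H2 := Hj _ Di.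
    have : s`_i * c (w i) (w j) = s`_j * c (w i) (w j).
      by rewrite -H1 (siC aP)// H2 (siC cP).
    move/eqP; rewrite -subr_eq0 -mulrBl mulf_eq0 subr_eq0 nth_uniq ?sn//.
    case/orP => [/eqP/val_inj ?|/eqP c0]; first by subst j; rewrite eqxx in ij.
    by rewrite H1 c0 mulr0.
  + move=> i; have [Di ci Hi] := wP i; rewrite Hi//.
    have c0 := si_ge0 cP Di; split; last by rewrite lt_neqAle eq_sym ci.
    rewrite ler_wpM2r//; have /sP[_ ] : s`_i \in s by rewrite mem_nth// sn.
    by [].
have [e e0 eP] : exists2 e, 0 < e & forall x, x \in s -> `|x - x0| < e -> x = x0.
  elim: (s) => [|y t [e e0 IH]]; first by exists 1.
  have [->|yx] := eqVneq y x0.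
    by exists e => // x; rewrite inE => /predU1P[->//|]; exact: IH.
  exists (Num.min e `|y - x0|); first by rewrite lt_min e0 normr_gt0 subr_eq0.
  move=> x; rewrite inE lt_min => /predU1P[->|xt] /andP[H1 H2]; last exact: IH.
  by rewrite ltxx in H2.
(* A radius of at most [1] keeps [x] below [M], so an eigenvalue outside [s] would extend the
   maximal list. *)
exists (Num.min e 1); first by rewrite lt_min e0 ltr01.
move=> x xP; rewrite lt_min => /andP[xe x1]; apply: eP => //.
apply: contraT => xs; suff /nmax : P n.+1 by rewrite ltnn.
exists (x :: s); split => /=; [by rewrite sn|by rewrite xs|].
move=> y; rewrite inE => /predU1P[->|/sP//]; split=> //.
by have := le_trans (ler_norm _) (ltW x1); have := ler_norm x0; rewrite /M; lra.
Qed.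

End eigenvalue_counting.

(** * Square-integrable functions *)

Section integral_monotone.
Context {R : realType}.
Local Open Scope ereal_scope.

(** The integral of a nonnegative function is a supremum over the simple functions below it, which
    grows with the function. This is also what makes [le_mes] hold for arbitrary sets. *)
Lemma ge0_le_integral_nonmeasurable d (T : measurableType d)
    (mu : {measure set T -> \bar R}) (f g : T -> \bar R) :
  (forall x, 0 <= f x) -> (forall x, f x <= g x) ->
  \int[mu]_x f x <= \int[mu]_x g x.
Proof.
move=> f0 fg; rewrite !ge0_integralTE//; last by move=> x; exact: le_trans (fg x).
by apply: ereal_sup_le => _ [h hf <-]; exists h => // x; exact: le_trans (fg x).
Qed.

End integral_monotone.

Section square_integrable.
Context d (T : measurableType d) (R : realType).
Variable mu : {measure set T -> \bar R}.
Implicit Types (f g : T -> R).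

Lemma Lfun2P f : (f \in Lfun mu 2%:E) <->
  measurable_fun setT f /\ (\int[mu]_x (f x ^+ 2)%:E < +oo)%E.
Proof.
split=> [fL|[mf fi]].
  split; first by move: fL => /sub_Lfun_mfun; rewrite inE.
  have /integrableP[_] := Lfun2_integrable_sqr fL.
  by under eq_integral do rewrite /= ger0_norm ?sqr_ge0//.
apply/andP; split; rewrite inE//= /finite_norm unlock /Lnorm.
rewrite poweR_lty//; under eq_integral => x _ do
  rewrite /= -[(_ `^ _)%R]/(`|f x| `^ 2%:R) powR_mulrn// real_normK ?num_real//.
exact: fi.
Qed.

Definition inner f g : R := \int[mu]_x (f x * g x).

Lemma Lfun2_measurable f : f \in Lfun mu 2%:E -> measurable_fun setT f.
Proof. by case/Lfun2P. Qed.

Lemma Lfun2_mul_integrable f g : f \in Lfun mu 2%:E -> g \in Lfun mu 2%:E ->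
  mu.-integrable setT (fun x => (f x * g x)%:E).
Proof. by move=> fL gL; have /Lfun1_integrable := Lfun2_mul_Lfun1 fL gL. Qed.

Lemma Lfun2D f g : f \in Lfun mu 2%:E -> g \in Lfun mu 2%:E ->
  (fun x => f x + g x) \in Lfun mu 2%:E.
Proof. by move=> fL gL; apply: (@rpredD _ _ f g); rewrite ?lee1n. Qed.

Lemma Lfun2Z (k : R) f : f \in Lfun mu 2%:E -> (fun x => k * f x) \in Lfun mu 2%:E.
Proof.
move=> fL; have := @Lfun_scale _ _ _ mu f k 2 _ fL.
rewrite ler1n => /(_ isT); rewrite (_ : k \o* f = fun x => k * f x)//.
by apply/funext => x /=; rewrite mulrC.
Qed.

Lemma Lfun2_submodule : submodule [set f : T -> R | f \in Lfun mu 2%:E].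
Proof.
split=> [|f g|k f]; [|exact: Lfun2D|exact: Lfun2Z].
apply/Lfun2P; split; first exact: measurable_cst.
by under eq_integral do rewrite /= expr0n; rewrite integral0.
Qed.

Lemma inner_semi_inner : semi_inner [set f : T -> R | f \in Lfun mu 2%:E] inner.
Proof.
have ilin g : g \in Lfun mu 2%:E ->
    linear_on [set f : T -> R | f \in Lfun mu 2%:E] (inner ^~ g).
  move=> gL; split=> [u v /= uL vL|k u /= uL].
    rewrite /inner -RintegralD//; try exact: Lfun2_mul_integrable.
    by apply: eq_Rintegral => x _; rewrite mulrDl.
  rewrite /inner -RintegralZl//; last exact: Lfun2_mul_integrable.
  by apply: eq_Rintegral => x _; rewrite /= mulrA.
have iC f g : inner f g = inner g f.
  by apply: eq_Rintegral => x _; rewrite mulrC.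
split=> // [|f _].
  split=> // g gL; rewrite (_ : inner g = inner ^~ g) ?funeqE//.
  exact: ilin.
by apply: Rintegral_ge0 => x _; rewrite -expr2 sqr_ge0.
Qed.

Lemma innerE f : f \in Lfun mu 2%:E ->
  (inner f f)%:E = (\int[mu]_x (f x ^+ 2)%:E)%E.
Proof.
move=> fL; rewrite /inner /Rintegral fineK.
  by under eq_integral do rewrite -expr2.
by apply: integrable_fin_num => //; exact: Lfun2_mul_integrable.
Qed.

Lemma inner_eq0 f : f \in Lfun mu 2%:E -> inner f f = 0 ->
  \forall x \ae mu, f x = 0.
Proof.
move=> fL f0; have := innerE fL; rewrite f0.
have mf := Lfun2_measurable fL.
have /measurable_EFinP mf2 : measurable_fun setT (fun x => f x ^+ 2).
  exact: measurable_funX.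
under eq_integral do rewrite -[(_ ^+ 2)%R]ger0_norm ?sqr_ge0// -abse_EFin.
move/esym/(ae_eq_integral_abs mu measurableT mf2).1.
by apply: filterS => x /(_ I) [/eqP]; rewrite sqrf_eq0 => /eqP.
Qed.

Lemma ae_eq0_inner f g : (\forall x \ae mu, f x = 0) ->
  f \in Lfun mu 2%:E -> g \in Lfun mu 2%:E -> inner f g = 0.
Proof.
move=> f0 fL gL; rewrite /inner /Rintegral (ae_eq_integral (cst 0%E))//.
- by rewrite integral0.
- by case/integrableP : (Lfun2_mul_integrable fL gL).
- by apply: filterS f0 => x -> _; rewrite mul0r.
Qed.

(* Along a subsequence with inner (v k.+1 - v k) < 8^-k the series of
   4^k (v k.+1 - v k)^2 is integrable, hence finite almost everywhere, and there
   the increments are dominated by a geometric sequence. *)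
Theorem riesz_fischer :
  form_complete [set f : T -> R | f \in Lfun mu 2%:E] inner.
Proof.
move=> u /= uL uC.
have sD := Lfun2_submodule.
have DL f g : f \in Lfun mu 2%:E -> g \in Lfun mu 2%:E -> f - g \in Lfun mu 2%:E.
  by move=> fL gL; exact: (submoduleB sD).
have /choice[N NP] k : exists N, forall n l, (N <= n)%N -> (N <= l)%N ->
    inner (u n - u l) (u n - u l) < 8 ^- k.
  by apply: uC; rewrite invr_gt0 exprn_gt0.
(* Summing the [(N i).+1] makes [n_] nondecreasing, at least [N k] and at least [k]. *)
pose n_ k := (\sum_(i < k.+1) (N i).+1)%N.
have n_S k : (n_ k <= n_ k.+1)%N by rewrite /n_ [leqRHS]big_ord_recr/= leq_addr.
have Nn k : (N k <= n_ k)%N by rewrite /n_ big_ord_recr/= addnS ltnW// ltnS leq_addl.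
have n_ge k : (k <= n_ k)%N.
  elim: k => // k IH; rewrite /n_ big_ord_recr/= addnS ltnS.
  by rewrite (leq_trans IH)// leq_addr.
pose v k := u (n_ k).
have vL k : v k \in Lfun mu 2%:E by exact: uL.
pose h k x := 4 ^+ k * (v k.+1 x - v k x) ^+ 2.
have h0 k x : 0 <= h k x by rewrite mulr_ge0 ?sqr_ge0 ?exprn_ge0.
have mv k : measurable_fun setT (v k) by exact: Lfun2_measurable.
have mh k : measurable_fun setT (h k).
  by apply: measurable_funM => //; apply: measurable_funX; exact: measurable_funB.
pose H x := (\sum_(0 <= k <oo) (h k x)%:E)%E.
have mH : measurable_fun setT H.
  by apply: ge0_emeasurable_sum => k *; [rewrite lee_fin|exact/measurable_EFinP].
have H0 x : (0 <= H x)%E by apply: nneseries_ge0 => k _ _; rewrite lee_fin.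
have iH : (\int[mu]_x H x < +oo)%E.
  rewrite integral_nneseries//; last 2 first.
  - by move=> k; exact/measurable_EFinP.
  - by move=> k x _; rewrite lee_fin.
  (* The summand is [4 ^+ k * 8 ^- k = 2 ^- k], written in the form that [epsilon_trick0] sums. *)
  apply: le_lt_trans (_ : \sum_(k <oo) (2 / (2 ^ k.+1)%:R)%:E < _)%E; last first.
    by apply: le_lt_trans (epsilon_trick0 xpredT _) _; rewrite ?ltry.
  apply: lee_nneseries => [k _ _|k _].
    by apply: integral_ge0 => x _; rewrite lee_fin.
  under eq_integral do rewrite EFinM.
  have mB : measurable_fun setT (fun x => (v k.+1 x - v k x) ^+ 2).
    by apply: measurable_funX; exact: measurable_funB.
  rewrite ge0_integralZl//; try by
    [exact/measurable_EFinP|move=> *; rewrite lee_fin ?sqr_ge0 ?exprn_ge0].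
  rewrite -(innerE (DL _ _ (vL k.+1) (vL k))) -EFinM lee_fin.
  have -> : 2 / (2 ^ k.+1)%:R = 4 ^+ k * 8 ^- k :> R.
    rewrite natrX exprS invfM mulrA mulfV// mul1r -!exprVn -exprMn.
    by congr (_ ^+ k); field.
  rewrite ler_pM2l ?exprn_gt0// ltW//.
  exact: NP k (n_ k.+1) (n_ k) (leq_trans (Nn k) (n_S k)) (Nn k).
pose A := [set x | H x < +oo]%E.
have mA : measurable A.
  by rewrite -[X in measurable X]setTI; exact: emeasurable_fun_infty_o.
have aeA : \forall x \ae mu, A x.
  have Hint : mu.-integrable setT H.
    apply/integrableP; split => //.
    by under eq_integral do rewrite gee0_abs//.
  have := integrable_ae measurableT Hint; apply: filterS => x /(_ I).
  by rewrite ge0_fin_numE.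
have vcvg x : A x -> cvgn (v ^~ x).
  move=> Ax; pose C := Num.sqrt (fine (H x)).
  have dv k : `|v k.+1 x - v k x| <= geometric C 2^-1 k.
    have : ((h k x)%:E <= H x)%E.
      have := @nneseries_lim_ge R (fun k => (h k x)%:E) xpredT 0 k.+1.
      rewrite big_nat_recr//= => H1; apply: le_trans (H1 _); last first.
        by move=> *; rewrite lee_fin.
      by rewrite leeDr// sume_ge0// => *; rewrite lee_fin.
    rewrite -(@fineK _ (H x)) ?ge0_fin_numE// lee_fin /h => hH.
    rewrite /geometric/= exprVn ler_pdivlMr ?exprn_gt0//.
    rewrite -ler_sqr ?nnegrE ?mulr_ge0 ?exprn_ge0 ?sqrtr_ge0//.
    rewrite sqr_sqrtr ?fine_ge0// exprMn real_normK ?num_real// exprAC mulrC.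
    by rewrite (_ : 2 ^+ 2 = 4)//; ring.
  have dcv : cvgn (series (fun k => v k.+1 x - v k x)).
    apply: normed_cvg; apply: (series_le_cvg _ _ dv) => [k|k|].
    - exact: normr_ge0.
    - exact: le_trans (dv k).
    - by apply: is_cvg_geometric_series; rewrite ger0_norm ?invr_ge0// invf_lt1// ltr1n.
  rewrite (_ : v ^~ x = fun k => series (fun k => v k.+1 x - v k x) k + v 0%N x).
    by apply: is_cvgD => //; exact: is_cvg_cst.
  apply/funext => k; rewrite /series/= telescope_sumr// subrK//.
(* Replacing [v] by [0] off [A] makes the limit exist at every point, so that [f] is measurable. *)
pose w k x := v k x * \1_A x.
have mw k : measurable_fun setT (w k) by apply: measurable_funM.
have wcvg x : cvgn (w ^~ x).
  have [Ax|nAx] := pselect (A x).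
    rewrite (_ : w ^~ x = v ^~ x); first exact: vcvg.
    by apply/funext => k; rewrite /w indicE mem_set// mulr1.
  rewrite (_ : w ^~ x = fun=> 0); first exact: is_cvg_cst.
  by apply/funext => k; rewrite /w indicE memNset// mulr0.
pose f x := limn (w ^~ x).
have mf : measurable_fun setT f.
  by apply: (measurable_fun_cvg mw) => x _; exact: wcvg.
have key e : 0 < e -> exists N, forall n, (N <= n)%N ->
    (\int[mu]_x ((u n x - f x) ^+ 2)%:E <= e%:E)%E.
  move=> e0; have [N0 HN] := uC e e0; exists N0 => n Nn0.
  (* Fatou's lemma bounds the squared distance from [u n] to [f] by those from [u n] to the [v k];
     the shift by [N0] puts both indices in the Cauchy range. *)
  pose g k x := ((u n x - w (k + N0)%N x) ^+ 2)%:E.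
  have mg k : measurable_fun setT (g k).
    apply/measurable_EFinP/measurable_funX; apply: measurable_funB => //.
    exact: Lfun2_measurable.
  have -> : (\int[mu]_x ((u n x - f x) ^+ 2)%:E = \int[mu]_x limn_einf (g ^~ x))%E.
    apply: eq_integral => x _; apply/esym.
    apply: (cvg_limn_einf_sup _).1; apply/cvg_EFin; first exact: nearW.
    have H1 : (fun k => u n x - w (k + N0)%N x) @ \oo --> u n x - f x.
      apply: cvgB; first exact: cvg_cst.
      by rewrite (cvg_shiftn N0 (w ^~ x)); exact: wcvg.
    rewrite (_ : fine \o _ = fun k =>
        (u n x - w (k + N0)%N x) * (u n x - w (k + N0)%N x)).
      by rewrite expr2; exact: cvgM.
    by apply/funext => k; rewrite /g /= expr2.
  apply: le_trans (fatou _ measurableT mg _) _.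
    by move=> k x _; rewrite lee_fin sqr_ge0.
  rewrite limn_einf_lim; apply: lime_le; first exact: is_cvg_einfs.
  apply: nearW => k; apply: le_trans (ereal_inf_lbound _) _.
    by exists k => //=.
  rewrite /g (ae_eq_integral (fun x => ((u n x - v (k + N0)%N x) ^+ 2)%:E))//.
  - rewrite -(innerE (DL _ _ (uL n) (vL (k + N0)%N))) lee_fin ltW// HN//.
    by rewrite (leq_trans _ (n_ge _))// leq_addl.
  - exact: mg.
  - apply/measurable_EFinP/measurable_funX; apply: measurable_funB => //.
    exact: Lfun2_measurable.
  - by apply: filterS aeA => x Ax _; rewrite /w indicE mem_set// mulr1.
have ufL n e : (\int[mu]_x ((u n x - f x) ^+ 2)%:E <= e%:E)%E ->
    u n - f \in Lfun mu 2%:E.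
  move=> une; apply/Lfun2P; split; last exact: le_lt_trans une (ltry _).
  by apply: measurable_funB => //; exact: Lfun2_measurable.
have fL : f \in Lfun mu 2%:E.
  have [N0 /(_ _ (leqnn N0))/ufL H1] := key 1 ltr01.
  by rewrite -(subKr (u N0) f); exact: DL.
exists f => // e e0; have [N0 HN] := key (e / 2) (divr_gt0 e0 (ltr0Sn _ 1)).
exists N0 => n /HN H1; rewrite -lte_fin innerE; last exact: DL.
by apply: le_lt_trans H1 _; rewrite lte_fin ltr_pdivrMr// ltr_pMr// ltr1n.
Qed.

Lemma inner_mul_bounded (m f : T -> R) (C : R) : measurable_fun setT m ->
  (forall x, `|m x| <= C) -> f \in Lfun mu 2%:E ->
  (fun x => m x * f x) \in Lfun mu 2%:E /\
  inner (fun x => m x * f x) (fun x => m x * f x) <= C ^+ 2 * inner f f.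
Proof.
move=> mm mC fL; have [mf ffin] := (Lfun2P f).1 fL.
have le : (\int[mu]_x ((m x * f x) ^+ 2)%:E <= (C ^+ 2 * inner f f)%:E)%E.
  rewrite EFinM innerE// -ge0_integralZl; last 4 first.
  - exact: measurableT.
  - by apply/measurable_EFinP; exact: measurable_funX.
  - by move=> x _; rewrite lee_fin sqr_ge0.
  - by rewrite lee_fin sqr_ge0.
  apply: ge0_le_integral_nonmeasurable => x; first by rewrite lee_fin sqr_ge0.
  rewrite -EFinM lee_fin exprMn; apply: ler_wpM2r; first exact: sqr_ge0.
  by rewrite -[m x ^+ 2]real_normK ?num_real// lerXn2r// nnegrE (le_trans _ (mC x)).
have mL : (fun x => m x * f x) \in Lfun mu 2%:E.
  apply/Lfun2P; split; first exact: measurable_funM.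
  exact: le_lt_trans le (ltry _).
by split => //; rewrite -lee_fin innerE.
Qed.

End square_integrable.

(** * Lebesgue measure on row vectors *)

Section row_measure.
Context {R : realType} {d : nat}.
Local Notation rV := 'rV[R]_d.
Implicit Types (a b x y h : rV).

Lemma box_bigcap a b : box a b =
  \bigcap_(i in [set: 'I_d]) (fun x : rV => x ord0 i) @^-1` `[a ord0 i, b ord0 i].
Proof.
apply/seteqP; split => x /= H; first by move=> i _; rewrite /= in_itv /= H.
by move=> i; have := H i I; rewrite /= in_itv.
Qed.

Lemma measurable_coord_preimage (i : 'I_d) (A : set R) : measurable A ->
  measurable ((fun x : rV => x ord0 i) @^-1` A).
Proof.
by move=> mA; rewrite -[X in measurable X]setTI; exact: measurable_coord.
Qed.

Lemma measurable_box a b : measurable (box a b).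
Proof.
rewrite box_bigcap; apply: fin_bigcap_measurable => // i _.
exact: measurable_coord_preimage.
Qed.

Lemma bounded_coords x : exists n : nat, forall i, `|x ord0 i| <= n%:R.
Proof.
exists (\max_i (Num.truncn `|x ord0 i|).+1)%N => i.
apply: le_trans (ltW (truncnS_gt _)) _; rewrite ler_nat.
exact: (leq_bigmax (F := fun i => (Num.truncn `|x ord0 i|).+1)).
Qed.

(** Closed boxes form a pi-system on which [mes] is known by [mes_box]; measures are compared on it,
    and so are integrals. *)
Lemma measurable_rVE : (measurable : set (set rV)) =
  <<s [set B | exists a b, B = box a b] >>.
Proof.
apply/seteqP; split; last first.
  apply: smallest_sub; first exact: sigma_algebra_measurable.
  by move=> _ [a [b ->]]; exact: measurable_box.
set G := [set B | _].
apply: smallest_sub; first exact: smallest_sigma_algebra.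
move=> B; rewrite -bigcup_seq => -[i _ [A mA <-]]; rewrite setTI.
suff : (measurable : set (set R)) `<=`
    [set A | <<s G >> ((fun x : rV => x ord0 i) @^-1` A)] by apply.
rewrite [X in X `<=` _](RGenCInfty.measurableE R).
apply: smallest_sub.
  have [H0 HC HU] := smallest_sigma_algebra setT G.
  split=> [|B0 /HC|F HF]; first by rewrite /= preimage_set0.
    by rewrite /= !setTD preimage_setC.
  by rewrite /= preimage_bigcup; exact: HU.
move=> _ [c ->] /=.
rewrite (_ : _ @^-1` _ = \bigcup_n
    box (\row_j if j == i then c else - n%:R) (const_mx n%:R)).
  have [_ _ HU] := smallest_sigma_algebra setT G.
  by apply: HU => n; apply: sub_gen_smallest; eexists; eexists.
apply/seteqP; split => x /=.
  rewrite in_itv/= andbT => cx; have [n xn] := bounded_coords x.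
  exists n => // j; have := xn j; rewrite ler_norml => /andP[x1 x2].
  by rewrite !mxE x2 andbT; case: eqP => // ->.
by case=> n _ /(_ i); rewrite !mxE eqxx in_itv/= andbT => /andP[].
Qed.

Lemma setI_closed_box : setI_closed [set B | exists a b, B = box a b].
Proof.
move=> _ _ [a [b ->]] [a' [b' ->]].
exists (\row_i Num.max (a ord0 i) (a' ord0 i)), (\row_i Num.min (b ord0 i) (b' ord0 i)).
apply/seteqP; split => x /=.
  by move=> [H H'] i; rewrite !mxE ge_max le_min; case/andP: (H i) => -> ->;
    case/andP: (H' i) => -> ->.
by move=> H; split=> i; have := H i; rewrite !mxE ge_max le_min => /andP[/andP[? ?] /andP[? ?]]; apply/andP.
Qed.

Lemma measure_rV_unique (m1 m2 : {measure set rV -> \bar R}) :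
  (forall n : nat, (m1 (box (const_mx (- n%:R)%R) (const_mx n%:R%R)) < +oo)%E) ->
  (forall a b, m1 (box a b) = m2 (box a b)) ->
  forall A, measurable A -> m1 A = m2 A.
Proof.
move=> fin m12; apply: (measure_unique [set B | exists a b, B = box a b]
  (fun n : nat => box (const_mx (- n%:R)) (const_mx n%:R))).
- exact: measurable_rVE.
- exact: setI_closed_box.
- by move=> n; do 2 eexists.
- apply/seteqP; split => // x _; have [n xn] := bounded_coords x.
  by exists n => // j; rewrite !mxE; have := xn j; rewrite ler_norml.
- by move=> _ [a [b ->]]; exact: m12.
- exact: fin.
Qed.

Lemma mes_box_fin a b : (mes d (box a b) < +oo)%E.
Proof.
have [ab|/existsNP[i /negP]] := pselect (forall i, a ord0 i <= b ord0 i).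
  by rewrite mes_box// ltry.
rewrite -ltNge => ba.
rewrite (_ : box a b = set0) ?measure0//; apply/seteqP; split=> // x /(_ i) /andP[H1 H2].
by have := lt_le_trans ba (le_trans H1 H2); rewrite ltxx.
Qed.

Lemma measurable_translate h : measurable_fun setT (fun x : rV => x + h).
Proof.
apply: measurable_fun_row => i; under eq_fun do rewrite mxE.
by apply: measurable_funD => //; exact: measurable_coord.
Qed.

Lemma mes_translate h (A : set rV) : measurable A ->
  mes d ((fun x => x + h) @^-1` A) = mes d A.
Proof.
move=> mA; pose m := measure_function_pushforward__canonical__measure_function_Measure
  (mes d : {measure set rV -> \bar R}) (measurable_translate h).
have boxE a b : (fun x => x + h) @^-1` box a b = box (a - h) (b - h).
  by apply/seteqP; split=> x H i; have := H i; rewrite !mxE lerBlDr lerBrDr.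
suff /(_ A mA) : forall A, measurable A -> m A = mes d A by [].
have mE a b : m (box a b) = mes d (box (a - h) (b - h)) by rewrite -boxE.
apply: measure_rV_unique => [n|a b]; rewrite mE; first exact: mes_box_fin.
have [ab|/existsNP[i /negP]] := pselect (forall i, a ord0 i <= b ord0 i).
  have ab' i : (a - h) ord0 i <= (b - h) ord0 i by rewrite !mxE lerD2r.
  rewrite (mes_box ab'); apply/esym; apply: etrans (mes_box ab) _.
  by congr EFin; apply: eq_bigr => i _; rewrite !mxE; ring.
rewrite -ltNge => ba.
(* Boxes whose corners are not ordered fall outside [mes_box]; they are empty. *)
have box0 (a' b' : rV) : b' ord0 i < a' ord0 i -> box a' b' = set0.
  move=> ba'; apply/seteqP; split=> // x /(_ i) /andP[H1 H2].
  by have := lt_le_trans ba' (le_trans H1 H2); rewrite ltxx.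
have ba' : (b - h) ord0 i < (a - h) ord0 i by rewrite !mxE ltrD2r.
rewrite (box0 _ _ ba') measure0; apply/esym; apply: etrans (measure0 (mes d)).
by congr (mes d _); exact: box0.
Qed.

Lemma ge0_integral_translate h (f : rV -> \bar R) : measurable_fun setT f ->
  (forall x, 0 <= f x)%E ->
  (\int[mes d]_x f (x + h)%R = \int[mes d]_x f x)%E.
Proof.
move=> mf f0.
have /= := @ge0_integral_pushforward _ _ _ _ _ _ (measurable_translate h)
  (mes d) setT f measurableT mf (fun _ _ => f0 _).
rewrite preimage_setT => <-; apply: eq_measure_integral; first exact: measurable_translate.
by move=> mh A mA _; exact: (mes_translate h mA).
Qed.

End row_measure.

(** * Smooth bumps and product test functions *)

Section smooth_functions_on_the_line.
Context {R : realType}.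
Implicit Types (f g : R -> R) (x : R).

(** Carrying the derivative as a witness turns closure under products and affine substitutions into
    an induction on [n]. *)
Fixpoint differentiable_n (n : nat) f : Prop :=
  if n is k.+1 then
    exists2 f', (forall x, is_derive x 1 f (f' x)) & differentiable_n k f'
  else True.

Definition smooth_R f := forall n, differentiable_n n f.

Lemma differentiable_nS n f : differentiable_n n.+1 f -> differentiable_n n f.
Proof.
elim: n f => // n IH f [f' ff' f'n]; exists f' => //; exact: IH.
Qed.

Lemma smooth_R_derive f : smooth_R f ->
  exists2 f', (forall x, is_derive x 1 f (f' x)) & smooth_R f'.
Proof.
move=> fs; exists (derive1 f) => [x|n].
  by have [f' ff' _] := fs 1%N; rewrite derive1E; apply: derivableP; exact: ex_derive.
have [f' ff' f'n] := fs n.+1; rewrite (_ : derive1 f = f')//.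
by apply/funext => x; rewrite derive1E; exact: derive_val.
Qed.

Lemma differentiable_nD n f g : differentiable_n n f -> differentiable_n n g ->
  differentiable_n n (fun x => f x + g x).
Proof.
elim: n f g => // n IH f g [f' ff' f'n] [g' gg' g'n].
exists (fun x => f' x + g' x); last exact: IH.
by move=> x; exact: is_deriveD.
Qed.

Lemma differentiable_nZ n (k : R) f : differentiable_n n f ->
  differentiable_n n (fun x => k * f x).
Proof.
elim: n f => // n IH f [f' ff' f'n].
exists (fun x => k * f' x); last exact: IH.
by move=> x; exact: (@is_deriveZ _ _ _ f k).
Qed.

Lemma differentiable_nM n f g : differentiable_n n f -> differentiable_n n g ->
  differentiable_n n (fun x => f x * g x).
Proof.
elim: n f g => // n IH f g fn gn.
have [f' ff' f'n] := fn; have [g' gg' g'n] := gn.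
exists (fun x => f x * g' x + g x * f' x).
  by move=> x; exact: is_deriveM.
by apply: differentiable_nD; apply: IH => //; exact: differentiable_nS.
Qed.

Lemma is_derive_affine f (f' : R -> R) (a b x : R) :
  (forall x, is_derive x 1 f (f' x)) ->
  is_derive x 1 (fun x => f (a * x + b)) (a * f' (a * x + b)).
Proof.
move=> ff'; rewrite mulrC; apply: (@is_derive1_comp _ f (fun x => a * x + b)).
have H : is_derive x 1 ((a \*: id) \+ cst b)%R (a *: 1 + 0) by exact: is_deriveD.
by move: H; rewrite addr0 /GRing.scale/= mulr1; congr is_derive.
Qed.

Lemma differentiable_n_affine n f (a b : R) : differentiable_n n f ->
  differentiable_n n (fun x => f (a * x + b)).
Proof.
elim: n f => // n IH f [f' ff' f'n].
exists (fun x => a * f' (a * x + b)); last exact/differentiable_nZ/IH.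
by move=> x; exact: is_derive_affine.
Qed.

(** The classical flat function with a polynomial factor in [1 / x]. With this factor the family is
    closed under differentiation ([exp_inv_derive]), so smoothness follows by induction. *)
Definition exp_inv (p : {poly R}) x : R :=
  if 0 < x then p.[x^-1] * expR (- x^-1) else 0.

(** [expR y >= y^(i + 2) / (i + 2)!] at [y = 1 / x]: the two extra degrees leave a factor [x ^+ 2],
    which sends the difference quotient at [0] to [0]. *)
Lemma exp_inv_le (p : {poly R}) : exists2 C, 0 <= C &
  forall x, `|exp_inv p x| <= C * x ^+ 2.
Proof.
pose C := \sum_(i < size p) `|p`_i| * (i + 2)`!%:R.
exists C => [|x]; first by apply: sumr_ge0 => i _; rewrite mulr_ge0.
rewrite /exp_inv; case: ifPn => [x0|_]; last first.
  by rewrite normr0 mulr_ge0 ?sqr_ge0// sumr_ge0// => i _; rewrite mulr_ge0.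
rewrite horner_coef normrM [`|expR _|]ger0_norm ?expR_ge0//.
rewrite expRN ler_pdivrMr ?expR_gt0//.
apply: le_trans (ler_norm_sum _ _ _) _.
rewrite /C !mulr_suml ler_sum// => i _; rewrite normrM.
rewrite [leRHS](_ : _ = `|p`_i| * ((i + 2)`!%:R * expR x^-1 * x ^+ 2)); last by ring.
rewrite ler_wpM2l// ger0_norm; last by rewrite exprn_ge0// invr_ge0 ltW.
have := @expR_ge1Dxn R x^-1 (i + 1) (_ : 0 <= x^-1).
rewrite invr_ge0 ltW// => /(_ isT) H.
have {}H : x^-1 ^+ (i + 2) <= (i + 2)`!%:R * expR x^-1.
  rewrite mulrC -ler_pdivrMr ?ltr0n ?fact_gt0//; apply: le_trans H.
  by rewrite addn1 addn2 lerDr.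
rewrite -(ler_pM2r (exprn_gt0 2 x0)) in H.
rewrite (_ : x^-1 ^+ i = x^-1 ^+ (i + 2) * x ^+ 2).
  exact: H.
by rewrite exprD -mulrA -exprMn mulVf ?gt_eqF// expr1n mulr1.
Qed.

Lemma exp_inv_derive (p : {poly R}) x :
  is_derive x 1 (exp_inv p) (exp_inv ('X^2 * (p - p^`())) x).
Proof.
have [x0|x0|->] := ltgtP x 0.
- rewrite [exp_inv (_ * _) _]/exp_inv ltNge ltW//=.
  apply: (@near_eq_is_derive _ _ _ (cst 0)).
  by near=> y; rewrite /exp_inv ltNge ltW//=; near: y; exact: lt_nbhsl.
- rewrite [exp_inv (_ * _) _]/exp_inv x0.
  have xN0 : x != 0 by rewrite gt_eqF.
  have H1 : is_derive x 1 (fun y : R => y^-1) (- x ^- 2).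
    have /= := is_deriveV xN0 (is_derive_id x (1 : R)).
    by rewrite /GRing.scale/= mulr1.
  have H2 := is_derive1_comp (is_derive_poly p x^-1) H1.
  have H3 := @is_derive1_comp _ expR (fun y => - y^-1) _ _ _
    (is_derive_expR (- x^-1)) (is_deriveN H1).
  apply: (@near_eq_is_derive R R R (fun y : R => p.[y^-1] * expR (- y^-1))).
    by near=> y; rewrite /exp_inv ifT//; near: y; exact: lt_nbhsr.
  apply: is_derive_eq (is_deriveM H2 H3) _.
  rewrite /GRing.scale/= !(hornerE, hornerXn) /=.
  move: p.[x^-1] p^`().[x^-1] (expR _) => P P' e.
  rewrite -[LHS]/(P * e * - - x ^- 2 + e * P' * - x ^- 2).
  by field.
- rewrite [exp_inv (_ * _) _]/exp_inv ltxx.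
  have [C C0 HC] := exp_inv_le p.
  have F0 : exp_inv p 0 = 0 by rewrite /exp_inv ltxx.
  have cv0 : (fun h => h^-1 *: (exp_inv p (h *: 1 + 0) - exp_inv p 0)) @ 0^' --> (0 : R).
    have C1 : 0 < C + 1 by rewrite ltr_wpDl.
    apply/cvgr0Pnorm_lt => e e0; near=> h.
    have h0 : h != 0 by near: h; exact: nbhs_dnbhs_neq.
    rewrite addr0 F0 subr0 /GRing.scale/= mulr1 normrM normfV.
    rewrite ltr_pdivrMl ?normr_gt0//; apply: le_lt_trans (HC h) _.
    rewrite -real_normK ?num_real// expr2 mulrCA ltr_pM2l ?normr_gt0//.
    apply: le_lt_trans (_ : (C + 1) * `|h| < _); first by rewrite ler_wpM2r// lerDl.
    rewrite mulrC -ltr_pdivlMr//; near: h; apply: dnbhs0_lt.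
    by rewrite divr_gt0.
  apply: DeriveDef; first by apply/cvg_ex; exists 0.
  exact: (cvg_lim _ cv0).
Unshelve. all: by end_near. Qed.


Lemma exp_inv_smooth p : smooth_R (exp_inv p).
Proof.
move=> n; elim: n p => // n IH p.
exists (exp_inv ('X^2 * (p - p^`()))); last exact: IH.
exact: exp_inv_derive.
Qed.

Lemma smooth_RM f g : smooth_R f -> smooth_R g -> smooth_R (fun x => f x * g x).
Proof. by move=> fs gs n; exact: differentiable_nM. Qed.

Lemma smooth_R_affine f (a b : R) : smooth_R f -> smooth_R (fun x => f (a * x + b)).
Proof. by move=> fs n; exact: differentiable_n_affine. Qed.

Lemma smooth_RB f g : smooth_R f -> smooth_R g -> smooth_R (fun x => f x - g x).
Proof.
move=> fs gs n; rewrite (_ : (fun _ => _) = fun x => f x + (-1) * g x).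
  by apply: differentiable_nD => //; exact: differentiable_nZ.
by apply/funext => x; rewrite mulN1r.
Qed.

Lemma smooth_R_continuous f : smooth_R f -> continuous f.
Proof.
move=> /(_ 1%N)[f' ff' _] x; apply: differentiable_continuous.
by apply/derivable1_diffP; exact: ex_derive.
Qed.

Lemma exp_inv1_ge0 x : 0 <= exp_inv 1 x.
Proof. by rewrite /exp_inv; case: ifP => // _; rewrite hornerC mul1r expR_ge0. Qed.

Lemma exp_inv1_le1 x : exp_inv 1 x <= 1.
Proof.
rewrite /exp_inv; case: ifP => [x0|//]; rewrite hornerC mul1r.
by rewrite -expR0 ler_expR oppr_le0 invr_ge0 ltW.
Qed.

Lemma exp_inv1_cvg (u : nat -> R) : u @ \oo --> +oo ->
  (fun n => exp_inv 1 (u n)) @ \oo --> (1 : R).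
Proof.
move=> uoo.
apply: (@cvg_trans _ ((fun n => expR (- (u n)^-1)) @ \oo)).
  apply: near_eq_cvg; near=> n; rewrite /exp_inv ifT ?hornerC ?mul1r//.
  by near: n; move/cvgryPgt : uoo; exact.
have H : (fun n => - (u n)^-1) @ \oo --> (0 : R).
  rewrite -oppr0; apply: cvgN; apply/gtr0_cvgV0 => //.
  by move/cvgryPgt : uoo; exact.
by rewrite -expR0; apply: continuous_cvg => //; exact: continuous_expR.
Unshelve. all: by end_near. Qed.

(** With [N = n.+1], the flat function is evaluated at [N^2 (x - a) + N] and [N^2 (b - x) + N]. Both
    are at least [N] on [[a, b]], and one is negative beyond distance [1 / N] from it; so the limit
    is the indicator of the closed interval at every point, endpoints included. *)
Definition smooth_bump (a b : R) (n : nat) x : R :=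
  exp_inv 1 (n.+1%:R ^+ 2 * x + (n.+1%:R - n.+1%:R ^+ 2 * a)) *
  exp_inv 1 (- n.+1%:R ^+ 2 * x + (n.+1%:R + n.+1%:R ^+ 2 * b)).

Lemma smooth_bump_smooth a b n : smooth_R (smooth_bump a b n).
Proof. by apply: smooth_RM; apply: smooth_R_affine; exact: exp_inv_smooth. Qed.

Lemma smooth_bump_ge0 a b n x : 0 <= smooth_bump a b n x.
Proof. by rewrite mulr_ge0// exp_inv1_ge0. Qed.

Lemma smooth_bump_le1 a b n x : smooth_bump a b n x <= 1.
Proof. by rewrite mulr_ile1 ?exp_inv1_ge0// exp_inv1_le1. Qed.

Lemma smooth_bump_eq0 a b n x : (x < a - n.+1%:R^-1) || (b + n.+1%:R^-1 < x) ->
  smooth_bump a b n x = 0.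
Proof.
have n0 : 0 < n.+1%:R :> R by [].
rewrite /smooth_bump /exp_inv; move: n.+1%:R n0 => N N0.
have NV : N * N^-1 = 1 by rewrite mulfV ?gt_eqF.
have N2 : 0 < N ^+ 2 by rewrite exprn_gt0.
case/orP => [xa|bx].
- rewrite ifF ?mul0r//; apply/negbTE; rewrite -leNgt.
  have -> : N ^+ 2 * x + (N - N ^+ 2 * a) = N ^+ 2 * (x - (a - N^-1)).
    by rewrite mulrBr mulrBr opprB expr2 -[N * N * N^-1]mulrA NV mulr1; ring.
  by rewrite pmulr_rle0// subr_le0 ltW.
- rewrite [X in _ * X]ifF ?mulr0//; apply/negbTE; rewrite -leNgt.
  have -> : - N ^+ 2 * x + (N + N ^+ 2 * b) = N ^+ 2 * (b + N^-1 - x).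
    by rewrite mulrBr mulrDr expr2 -[N * N * N^-1]mulrA NV mulr1; ring.
  by rewrite pmulr_rle0// subr_le0 ltW.
Qed.

Lemma smooth_bump_cvg a b x :
  (fun n => smooth_bump a b n x) @ \oo --> ((a <= x <= b)%R%:R : R).
Proof.
have [axb|] := boolP (a <= x <= b).
  have /andP[ax xb] := axb.
  have lim (u : nat -> R) : (forall n, n.+1%:R <= u n) -> u @ \oo --> +oo.
    move=> nu; apply/cvgryPge => A; near=> n; apply: le_trans (nu n).
    apply: (@le_trans _ _ n%:R); last by rewrite ler_nat.
    by near: n; exact: nbhs_infty_ger.
  rewrite -[X in _ --> X]mulr1; apply: cvgM; apply: exp_inv1_cvg; apply: lim => n.
    have : 0 <= n.+1%:R ^+ 2 * (x - a) by rewrite mulr_ge0 ?exprn_ge0// subr_ge0.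
    by move: n.+1%:R => N; nra.
  have : 0 <= n.+1%:R ^+ 2 * (b - x) by rewrite mulr_ge0 ?exprn_ge0// subr_ge0.
  by move: n.+1%:R => N; nra.
rewrite negb_and -!ltNge => xab; apply: cvg_near_cst.
have [e e0 xe] : exists2 e, 0 < e & (x < a - e) || (b + e < x).
  case/orP : xab => [xa|bx].
    exists ((a - x) / 2); first by rewrite divr_gt0// subr_gt0.
    by apply/orP; left; lra.
  exists ((x - b) / 2); first by rewrite divr_gt0// subr_gt0.
  by apply/orP; right; lra.
near=> n; apply: smooth_bump_eq0.
have ne : n.+1%:R^-1 < e.
  by near: n; exact: (near_infty_natSinv_lt (PosNum e0)).
case/orP: xe => H; apply/orP; [left|right].
  by apply: lt_trans H _; rewrite ltrD2l ltrN2.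
by apply: le_lt_trans H; rewrite lerD2l ltW.
Unshelve. all: by end_near. Qed.

Lemma smooth_bump_support a b n x : (x < a - 1) || (b + 1 < x) -> smooth_bump a b n x = 0.
Proof.
have n1 : n.+1%:R^-1 <= 1 :> R by rewrite invf_le1// ler1n.
by move=> H; apply: smooth_bump_eq0; move: n1; move: n.+1%:R^-1 => q q1;
  case/orP: H => H; apply/orP; [left|right]; lra.
Qed.

(** [F] is the integral from minus infinity. It is needed because differences [F y - F (y - s)] have
    bounded support again and can enter test functions. *)
Lemma smooth_R_primitive f (A B C : R) : smooth_R f ->
  (forall x, `|f x| <= C) -> (forall x, (x < A) || (B < x) -> f x = 0) ->
  exists2 F, (forall x, is_derive x 1 F (f x)) & smooth_R F.
Proof.
move=> fs fC f0; have fc := smooth_R_continuous fs.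
have mf : measurable_fun setT f by exact: continuous_measurable_fun.
have intf : lebesgue_measure.-integrable setT (EFin \o f).
  have intg : lebesgue_measure.-integrable setT
      (fun x : R => (C%:E * (\1_`[A, B] x)%:E)%E).
    by apply: integrableZl => //; exact: integrable_indic_itv.
  apply: le_integrable intg => //; first exact/measurable_EFinP.
  move=> x _; rewrite -EFinM /= lee_fin indicE.
  have [AxB|/negP H] := boolP (x \in `[A, B]%classic).
    by rewrite mulr1; exact: le_trans (fC x) (ler_norm _).
  rewrite mulr0 normr0 f0 ?normr0//.
  apply: contra_notT H; rewrite negb_or -!leNgt => AB.
  by rewrite inE/= in_itv.
pose F x : R := \int[lebesgue_measure]_(t in `]-oo, x]) f t.
have dF x : is_derive x 1 F (f x).
  have [||||H1 H2] := @continuous_FTC1 R f -oo%O x (x + 1).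
  - by rewrite ltrDl.
  - exact: integrableS intf.
  - by rewrite /Order.lt/=.
  - exact: fc.
  by apply: DeriveDef; [exact: H1|rewrite -derive1E; exact: H2].
exists F => // n; case: n => // n; exists f => //; exact: fs.
Qed.

Lemma smooth_R_FTC f F (s x : R) : 0 < s -> smooth_R f ->
  (forall x, is_derive x 1 F (f x)) ->
  \int[lebesgue_measure]_(t in `[0, s]) f (x - t) = F x - F (x - s).
Proof.
move=> s0 fs dF; have fc := smooth_R_continuous fs.
pose G (t : R) : R := - F (x - t).
have dG (t : R) : is_derive t 1 G (f (x - t)).
  have := is_derive_affine (-1) x t dF.
  move/is_deriveN; rewrite mulN1r opprK => H.
  rewrite (_ : G = - (fun t : R => F (-1 * t + x) : R)).
    by have -> : x - t = -1 * t + x by rewrite mulN1r addrC.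
  apply/funext => y; rewrite /G -[RHS]/(- F (-1 * y + x)).
  by rewrite mulN1r addrC.
have cG : continuous G.
  move=> t; apply: differentiable_continuous.
  by apply/derivable1_diffP; exact: ex_derive.
rewrite /Rintegral (@continuous_FTC2 _ (fun t => f (x - t)) G)//.
- by rewrite /G subr0 /= opprK addrC.
- apply: continuous_subspaceT => t; apply: continuous_comp; last exact: fc.
  by apply: cvgB => //; exact: cvg_cst.
- split=> [t _||]; first exact: ex_derive.
  + exact/cvg_at_right_filter/cG.
  + exact/cvg_at_left_filter/cG.
- by move=> t _; rewrite derive1E; exact: derive_val.
Qed.

End smooth_functions_on_the_line.

Section product_test_functions.
Context {R : realType} {d : nat}.
Local Notation rV := 'rV[R]_d.
Implicit Types (f : 'I_d -> R -> R) (x : rV).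

Lemma is_derive_line (phi : rV -> R) x v (l : R) :
  is_derive (0 : R) 1 (fun h : R => phi (h *: v + x)) l -> is_derive x v phi l.
Proof.
move=> [dphi Dphi].
have E : (fun h : R => h^-1 *: (phi (h *: v + x) - phi x)) =
    (fun h : R => h^-1 *: ((fun h : R => phi (h *: v + x)) (h *: (1 : R) + 0) -
       (fun h : R => phi (h *: v + x)) 0)).
  apply/funext => h.
  have -> : h *: (1 : R) + 0 = h by rewrite addr0 /GRing.scale/= mulr1.
  by rewrite scale0r add0r.
by split; [rewrite /derivable E|rewrite -Dphi /derive E].
Qed.

(** Partial derivatives of such a product are again products ([prodf_partial]), which reduces
    smoothness in [d] variables to the line. *)
Definition prodf f x := \prod_i f i (x ord0 i).

Lemma prodf_continuous f : (forall i, continuous (f i)) -> continuous (prodf f).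
Proof.
move=> fc x; suff H (r : seq 'I_d) :
  (fun y : rV => \prod_(i <- r) f i (y ord0 i)) @ x --> \prod_(i <- r) f i (x ord0 i).
  exact: H.
elim: r => [|i r IH].
  rewrite big_nil (_ : (fun y : rV => _) = fun=> 1).
    by apply: cvg_cst; exact: nbhs_filter.
  by apply/funext => y; rewrite big_nil.
rewrite big_cons (_ : (fun y : rV => _) =
    fun y => f i (y ord0 i) * \prod_(j <- r) f j (y ord0 j)).
  apply: cvgM => //; first exact: nbhs_filter.
  exact: (continuous_comp (@coord_continuous R 1 d ord0 i x) (fc i _)).
by apply/funext => y; rewrite big_cons.
Qed.

Definition update f i (g : R -> R) := fun j => if j == i then g else f j.

Lemma prodf_line f i (h : R) x : prodf f (h *: delta_mx ord0 i + x) =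
  f i (h + x ord0 i) * \prod_(j | j != i) f j (x ord0 j).
Proof.
rewrite /prodf (bigD1 i)//= !mxE !eqxx mulr1; congr (_ * _).
by apply: eq_bigr => j ji; rewrite !mxE (negbTE ji) andbF mulr0 add0r.
Qed.

Lemma prodf_update f i (g : R -> R) x : prodf (update f i g) x =
  g (x ord0 i) * \prod_(j | j != i) f j (x ord0 j).
Proof.
rewrite /prodf (bigD1 i)//= /update eqxx; congr (_ * _).
by apply: eq_bigr => j ji; rewrite (negbTE ji).
Qed.

Lemma prodf_is_derive f (i : 'I_d) (fi' : R -> R) x :
  (forall y : R, is_derive y 1 (f i) (fi' y)) ->
  is_derive x (delta_mx ord0 i) (prodf f) (prodf (update f i fi') x).
Proof.
move=> dfi; apply: is_derive_line; rewrite prodf_update.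
under eq_fun do rewrite prodf_line.
set c := \prod_(j | j != i) _.
have H := is_derive_affine 1 (x ord0 i) 0 dfi.
rewrite (_ : (fun _ => _) = fun h => c * f i (1 * h + x ord0 i)).
  rewrite (_ : _ * c = c * (1 * fi' (1 * 0 + x ord0 i))).
    exact: (@is_deriveZ _ _ _ _ c).
  by rewrite mulr0 add0r mul1r mulrC.
by apply/funext => h; rewrite mul1r mulrC.
Qed.

Lemma prodf_partial f (i : 'I_d) (fi' : R -> R) :
  (forall y : R, is_derive y 1 (f i) (fi' y)) ->
  partial i (prodf f) = prodf (update f i fi').
Proof.
by move=> dfi; apply/funext => x; have := prodf_is_derive x dfi => -[].
Qed.

Lemma prodf_smooth f : (forall i, smooth_R (f i)) -> smooth (prodf f).
Proof.
move=> fs s.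
have [g gs ->] : exists2 g, (forall i, smooth_R (g i)) &
    foldr partial (prodf f) s = prodf g.
  elim: s => [|i s [g gs IH]]; first by exists f.
  have [gi' dgi gi's] := smooth_R_derive (gs i).
  exists (update g i gi'); last by rewrite /= IH; exact: prodf_partial.
  by move=> j; rewrite /update; case: ifP.
split; first by apply: prodf_continuous => i; exact: smooth_R_continuous.
move=> i x; have [gi' dgi _] := smooth_R_derive (gs i).
by have [] := prodf_is_derive x dgi.
Qed.

Lemma prodf_vanish f x i : f i (x ord0 i) = 0 -> prodf f x = 0.
Proof. by move=> fi0; rewrite /prodf (bigD1 i)//= fi0 mul0r. Qed.

Lemma compact_box (a b : rV) : compact (box a b).
Proof.
rewrite (_ : box a b = [set v | forall i, `[a ord0 i, b ord0 i]%classic (v ord0 i)]).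
  exact: (@rV_compact R d (fun i => `[a ord0 i, b ord0 i]%classic) (fun i => @segment_compact R _ _)).
by apply/seteqP; split=> x H i; have := H i; rewrite /= in_itv.
Qed.

Lemma compact_support_box (phi : rV -> R) (a b : rV) :
  (forall x, phi x != 0 -> box a b x) -> compact (closure [set x | phi x != 0]).
Proof.
move=> H; apply: (subclosed_compact _ (@compact_box a b)).
  exact: closed_closure.
have cb : closed (box a b).
  apply: compact_closed (@compact_box a b); exact: norm_hausdorff.
by rewrite [X in _ `<=` X](closure_id _).1//; exact: closureS.
Qed.

Lemma prodf_test_function f (a b : rV) : (forall i, smooth_R (f i)) ->
  (forall i y, f i y != 0 -> a ord0 i <= y <= b ord0 i) ->
  test_function (prodf f).
Proof.
move=> fs fab; split; first exact: prodf_smooth.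
apply: (@compact_support_box _ a b) => x px i; apply: fab.
by apply: contra_neq px => fi0; exact: prodf_vanish fi0.
Qed.

End product_test_functions.

Section continuous_functions.
Context {R : realType} {d : nat}.
Local Notation rV := 'rV[R]_d.

(** The sigma-algebra is generated by coordinates, not by the topology; an open set is a countable
    union of cubes with rational centres and sizes. *)
Lemma open_measurable_rV (U : set rV) : open U -> measurable U.
Proof.
move=> oU.
pose B (q : 'rV[rat]_d * rat) : set rV :=
  box (map_mx ratr q.1 - const_mx (ratr q.2)) (map_mx ratr q.1 + const_mx (ratr q.2)).
rewrite (_ : U = \bigcup_(n in [set n | exists2 q, unpickle n = Some q & B q `<=` U])
   (if unpickle n is Some q then B q else set0)); last first.
  apply/seteqP; split=> [x Ux|x [n [q nq BU]]]; last by rewrite nq; exact: BU.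
  have [e /= e0 He] : exists2 e : R, 0 < e & ball x e `<=` U.
    by have /nbhs_ballP[e] := open_nbhs_nbhs (conj oU Ux); exists e.
  have [r] := rat_in_itvoo (divr_gt0 e0 (ltr0n R 2)); rewrite in_itv/= => /andP[r0 re].
  have /choice[q qP] (i : 'I_d) : exists q : rat, `|x ord0 i - ratr q| <= ratr r.
    have xr : x ord0 i - ratr r < x ord0 i + ratr r by lra.
    have [q] := rat_in_itvoo xr; rewrite in_itv/= => /andP[q1 q2].
    by exists q; rewrite ler_norml; lra.
  pose Q : 'rV[rat]_d * rat := (\row_i q i, r).
  exists (pickle Q); rewrite /= ?pickleK.
    exists Q => // y By; apply: He; split=> // i j; rewrite (ord1 i).
    have := By j; have := qP j; rewrite /Q /= !mxE ler_norml => /andP[H1 H2] /andP[H3 H4].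
    by rewrite /ball/= ltr_norml; lra.
  by move=> i; have := qP i; rewrite /Q /= !mxE ler_norml; lra.
apply: bigcup_measurable => n [q -> _]; exact: measurable_box.
Qed.

Lemma continuous_measurable_rV (f : rV -> R) : continuous f -> measurable_fun setT f.
Proof.
move=> fc; apply: (measurability _ (RGenOInfty.measurableE R)).
move=> _ [_ [c ->] <-]; rewrite setTI; apply: open_measurable_rV.
by apply: open_comp => [x _|]; [exact: fc|exact: interval_open].
Qed.

End continuous_functions.

Section orthogonal_to_bumps.
Context {R : realType} {d : nat}.
Local Notation rV := 'rV[R]_d.
Local Notation mu := (mes d : {measure set 'rV[R]_d -> \bar R}).
Implicit Types (a b x : rV) (u g w : rV -> R).

Lemma Lfun2_box (f : rV -> R) a b (C : R) : measurable_fun setT f ->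
  (forall x, `|f x| <= C) -> (forall x, f x != 0 -> box a b x) ->
  f \in Lfun mu 2%:E.
Proof.
move=> mf fC fab; apply/Lfun2P; split => //.
apply: (@le_lt_trans _ _ (\int[mu]_x (C ^+ 2 * \1_(box a b) x)%:E)%E).
  apply: ge0_le_integral_nonmeasurable => x; first by rewrite lee_fin sqr_ge0.
  rewrite lee_fin indicE; have [f0|/fab xab] := eqVneq (f x) 0.
    by rewrite f0 expr0n mulr_ge0// sqr_ge0.
  rewrite mem_set// mulr1 -[leLHS]real_normK ?num_real// ler_sqr ?nnegrE//.
  exact: le_trans (fC x).
under eq_integral do rewrite EFinM.
rewrite ge0_integralZl//; try by [move=> *; rewrite lee_fin ?sqr_ge0|
  apply/measurable_EFinP/measurable_indic; exact: measurable_box|rewrite lee_fin sqr_ge0].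
rewrite integral_indic//; last exact: measurable_box.
by rewrite setIT lte_mul_pinfty ?lee_fin ?sqr_ge0//; exact: mes_box_fin.
Qed.

Lemma coord_le_norm x i : `|x ord0 i| <= `|x|.
Proof.
rewrite [leRHS]/Num.norm/= mx_normrE.
exact: (le_bigmax _ (fun ij => `|x ij.1 ij.2|) (ord0, i)).
Qed.

Lemma test_function_Lfun2 (phi : rV -> R) : continuous phi ->
  compact (closure [set x | phi x != 0]) -> phi \in Lfun mu 2%:E.
Proof.
move=> cphi kphi; set K := closure _ in kphi.
have sK x : phi x != 0 -> K x by move=> ?; exact: subset_closure.
have [M [_ HM]] := compact_bounded kphi.
have [C HC] : exists C, forall x, K x -> `|phi x| <= C.
  have /compact_bounded[M' [_ HM']] : compact (phi @` K).
    by apply: continuous_compact => //; exact: continuous_subspaceT.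
  exists (M' + 1) => x Kx; apply: (HM' (M' + 1) _ (phi x)); first by rewrite ltrDl.
  by exists x.
apply: (@Lfun2_box phi (const_mx (- (M + 1))) (const_mx (M + 1)) (Num.max C 0)).
- exact: continuous_measurable_rV.
- move=> x; have [->|/sK Kx] := eqVneq (phi x) 0.
    by rewrite normr0 le_max lexx orbT.
  by rewrite le_max HC.
- move=> x /sK Kx i; rewrite !mxE -ler_norml.
  have := HM (M + 1) _ x Kx; rewrite ltrDl => /(_ ltr01); apply: le_trans.
  exact: coord_le_norm.
Qed.

Definition bumps a b n : rV -> R := prodf (fun i => smooth_bump (a ord0 i) (b ord0 i) n).

Lemma bumps_ge0 a b n x : 0 <= bumps a b n x.
Proof. by apply: prodr_ge0 => i _; exact: smooth_bump_ge0. Qed.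

Lemma bumps_le1 a b n x : bumps a b n x <= 1.
Proof. by apply: prodr_ile1 => i _; rewrite smooth_bump_ge0 smooth_bump_le1. Qed.

Lemma bumps_support a b n x : bumps a b n x != 0 ->
  box (a - const_mx 1) (b + const_mx 1) x.
Proof.
move=> H i; rewrite !mxE; apply: contra_neqT H => H.
apply: (prodf_vanish (i := i)); apply: smooth_bump_support.
by move: H; rewrite negb_and -!ltNge.
Qed.

Lemma bumps_continuous a b n : continuous (bumps a b n).
Proof.
by apply: prodf_continuous => i; apply: smooth_R_continuous; exact: smooth_bump_smooth.
Qed.

Lemma bumps_Lfun2 a b n : bumps a b n \in Lfun mu 2%:E.
Proof.
apply: (@Lfun2_box _ (a - const_mx 1) (b + const_mx 1) 1).
- by apply: continuous_measurable_rV; exact: bumps_continuous.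
- by move=> x; rewrite ger0_norm ?bumps_ge0// bumps_le1.
- exact: bumps_support.
Qed.

Lemma bumps_cvg a b x : (fun n => bumps a b n x) @ \oo --> (\1_(box a b) x : R).
Proof.
rewrite (_ : \1_(box a b) x = \prod_i (a ord0 i <= x ord0 i <= b ord0 i)%R%:R).
  rewrite /bumps /prodf; elim: (index_enum _) => [|i r IH].
    rewrite big_nil (_ : (fun n => _) = fun=> 1); first exact: cvg_cst.
    by apply/funext => n; rewrite big_nil.
  rewrite big_cons (_ : (fun n => _) = fun n => smooth_bump (a ord0 i) (b ord0 i) n (x ord0 i) *
    \prod_(j <- r) smooth_bump (a ord0 j) (b ord0 j) n (x ord0 j)).
    by apply: cvgM => //; exact: smooth_bump_cvg.
  by apply/funext => n; rewrite big_cons.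
rewrite indicE; have [H|] := pselect (box a b x).
  by rewrite mem_set// big1// => i _; rewrite H.
move=> /[dup] H /existsNP[i /negP/negbTE Hi]; rewrite memNset//.
by rewrite (bigD1 i)//= Hi mul0r.
Qed.

(** Dominated convergence passes from bumps to indicators of boxes; a Dynkin argument then gives a
    zero integral over every measurable part of a large box, hence [w = 0] almost everywhere
    there. *)
Lemma ae_eq0_of_orthogonal_bumps w : w \in Lfun mu 2%:E ->
  (forall a b n, inner mu w (bumps a b n) = 0) -> \forall x \ae mu, w x = 0.
Proof.
move=> wL w0; have mw := Lfun2_measurable wL.
have boxL a b : \1_(box a b) \in Lfun mu 2%:E.
  apply: (@Lfun2_box _ a b 1).
  - by apply: measurable_indic; exact: measurable_box.
  - by move=> x; rewrite indicE; case: (_ \in _); rewrite ?normr1 ?normr0.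
  - by move=> x; rewrite indicE; case: (boolP (x \in box a b)) => [/set_mem|_ /eqP].
have nwL : (fun x => `|w x|) \in Lfun mu 2%:E.
  apply/Lfun2P; split; first exact: measurableT_comp.
  under eq_integral do rewrite real_normK ?num_real//.
  by case/Lfun2P : wL.
have wbox a b : (\int[mu]_(x in box a b) (w x)%:E = 0)%E.
  have mb := measurable_box a b.
  (* All bumps of the sequence are supported in this larger box, so [|w|] times its indicator
     dominates. *)
  pose B := box (a - const_mx 1) (b + const_mx 1).
  have mwb n : measurable_fun setT (fun x => (w x * bumps a b n x)%:E).
    apply/measurable_EFinP; apply: measurable_funM => //.
    exact: Lfun2_measurable (bumps_Lfun2 a b n).
  have mw1 : measurable_fun setT (fun x => (w x * \1_(box a b) x)%:E).
    by apply/measurable_EFinP; apply: measurable_funM => //; exact: measurable_indic.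
  have wcv : \forall x \ae mu, setT x ->
      (fun n => (w x * bumps a b n x)%:E) @ \oo --> (w x * \1_(box a b) x)%:E.
    apply: aeW => x _; apply: cvg_EFin; first exact: nearW.
    by apply: cvgM; [exact: cvg_cst|exact: bumps_cvg].
  have wdom : \forall x \ae mu, forall n, setT x ->
      (`|(w x * bumps a b n x)%:E| <= (`|w x| * \1_B x)%:E)%E.
    apply: aeW => x n _; rewrite abse_EFin lee_fin normrM ler_wpM2l//.
    rewrite ger0_norm ?bumps_ge0//.
    have [->|/bumps_support Bx] := eqVneq (bumps a b n x) 0.
      by rewrite indicE; case: (_ \in _).
    by rewrite indicE mem_set// bumps_le1.
  have [_ _ H] := dominated_convergence measurableT mwb mw1 wcv
    (Lfun2_mul_integrable nwL (boxL (a - const_mx 1) (b + const_mx 1))) wdom.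
  rewrite integral_mkcond (eq_integral (fun x => (w x * \1_(box a b) x)%:E)).
    move/cvg_lim : H => <- //; rewrite (_ : [sequence _]_n = fun=> 0%E).
      exact: lim_cst.
    apply/funext => n /=; rewrite -[LHS]fineK.
      by congr EFin; exact: w0.
    by apply: integrable_fin_num => //; exact: (Lfun2_mul_integrable wL (bumps_Lfun2 a b n)).
  move=> x _; rewrite patchE indicE; case: ifPn => _; first by rewrite mulr1.
  by rewrite mulr0.
have wD k : \forall x \ae mu,
    box (const_mx (- k%:R)) (const_mx k%:R : rV) x -> (w x)%:E = 0%E.
  set D := box _ _; have mD : measurable D by exact: measurable_box.
  have iw : mu.-integrable D (EFin \o w).
    have := Lfun2_mul_integrable wL (boxL (const_mx (- k%:R)) (const_mx k%:R)).
    move=> /(integrableS measurableT mD (@subsetT _ _)).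
    apply: eq_integrable => // x /set_mem Dx.
    by rewrite /= indicE mem_set// mulr1.
  apply: (integral_ae_eq mD iw) => //.
  have wi A : measurable A -> (\int[mu]_(x in A `&` D) (w x)%:E = 0)%E.
    rewrite measurable_rVE -setI_closed_g_dynkin_g_sigma_algebra; last exact: setI_closed_box.
    pose H A := measurable A /\ (\int[mu]_(x in A `&` D) (w x)%:E = 0)%E.
    suff HH : <<d [set B | exists a b : rV, B = box a b] >> `<=` H.
      by move=> /HH[].
    apply: smallest_sub; last first.
      move=> _ [a [b ->]]; split; first exact: measurable_box.
      have [a' [b' ->]] := setI_closed_box
        (ex_intro _ a (ex_intro _ b erefl)) (ex_intro _ _ (ex_intro _ _ erefl) : _ D).
      exact: wbox.
    have iwS A' : measurable A' -> mu.-integrable (A' `&` D) (EFin \o w).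
      by move=> mA'; apply: integrableS iw => //; exact: measurableI.
    split.
    - by split; rewrite ?setTI//; exact: wbox.
    - move=> A' [mA' wA']; split; first exact: measurableC.
      have := wbox (const_mx (- k%:R)) (const_mx k%:R); rewrite -/D.
      rewrite [X in (\int[_]_(x in X) _ = _)%E](_ : D = (A' `&` D) `|` (~` A' `&` D)).
        rewrite integral_setU//; try by apply: measurableI => //; exact: measurableC.
        - by rewrite wA' add0e.
        - rewrite -setIUl setUv setTI; exact/measurable_EFinP/measurable_funTS.
        - by apply/disj_set2P; rewrite setIACA setICr set0I.
      by rewrite -setIUl setUv setTI.
    - move=> F tF HF; split; first by apply: bigcup_measurable => k' _; case: (HF k').
      rewrite setI_bigcupl integral_bigcup//.
      + by rewrite eseries0// => k' _ _; case: (HF k').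
      + exact: trivIset_setIr.
      + by move=> k'; apply: measurableI => //; case: (HF k').
      + rewrite -setI_bigcupl; apply: iwS; apply: bigcup_measurable => k' _.
        by case: (HF k').
  move=> E ED mE; rewrite integral0 -(setIidl ED); exact: wi.
have := ae_foralln wD; apply: filterS => x Hx.
have [k xk] := bounded_coords x.
have /Hx[] // : box (const_mx (- k%:R)) (const_mx k%:R : rV) x.
by move=> i; rewrite !mxE -ler_norml.
Qed.

End orthogonal_to_bumps.

(** * Translations and weak derivatives *)

Section translation_estimate.
Context {R : realType} {d : nat}.
Local Notation rV := 'rV[R]_d.
Local Notation mu := (mes d : {sigma_finite_measure set 'rV[R]_d -> \bar R}).
Local Notation leb := (@lebesgue_measure R).
Implicit Types (a b x h : rV) (u g : rV -> R).

Lemma integral_translate h (f : rV -> \bar R) : measurable_fun setT f ->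
  (\int[mu]_x f (x + h)%R = \int[mu]_x f x)%E.
Proof.
move=> mf; rewrite integralE [RHS]integralE.
congr (_ - _)%E.
  have H := ge0_integral_translate h (measurable_funepos mf) (fun x => funepos_ge0 f x).
  by rewrite -H; apply: eq_integral => x _; rewrite !funeposE.
have H := ge0_integral_translate h (measurable_funeneg mf) (fun x => funeneg_ge0 f x).
by rewrite -H; apply: eq_integral => x _; rewrite !funenegE.
Qed.

Lemma Lfun2_translate h g : g \in Lfun mu 2%:E -> (fun x => g (x + h)) \in Lfun mu 2%:E.
Proof.
case/Lfun2P => mg ig; apply/Lfun2P; split.
  by apply: measurableT_comp => //; exact: measurable_translate.
rewrite (@ge0_integral_translate _ _ h (fun x => (g x ^+ 2)%:E))//.
  by apply/measurable_EFinP; exact: measurable_funX.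
by move=> x; rewrite lee_fin sqr_ge0.
Qed.

Lemma inner_translate h u g : u \in Lfun mu 2%:E -> g \in Lfun mu 2%:E ->
  inner mu (fun x => u (x + h)) g = inner mu u (fun x => g (x - h)).
Proof.
move=> uL gL; rewrite /inner /Rintegral; congr fine.
rewrite -(@integral_translate h (fun x => (u x * g (x - h))%:E)).
  by apply: eq_integral => x _; rewrite addrK.
apply/measurable_EFinP; apply: measurable_funM; first exact: (Lfun2_measurable uL).
exact: (Lfun2_measurable (Lfun2_translate _ gL)).
Qed.

Section average.
Variables (i : 'I_d) (s : R).
Hypothesis s0 : 0 < s.
Let e : rV := delta_mx ord0 i.
Let I : set R := `[0, s]%classic.

Let mI : measurable I. Proof. exact: measurable_itv. Qed.

Let ind2 (t : R) : (\1_I t : R) ^+ 2 = \1_I t.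
Proof. by rewrite indicE; case: (_ \in _); rewrite ?expr1n ?expr0n. Qed.

Let lebI : leb I = s%:E.
Proof.
have := @lebesgue_measure_itv R `[0, s]; rewrite /= lte_fin s0 oppr0 adde0.
exact.
Qed.

Lemma measurable_shift : measurable_fun setT (fun p : rV * R => p.1 + p.2 *: e).
Proof.
apply: measurable_fun_row => j; under eq_fun do rewrite !mxE.
apply: measurable_funD.
  apply: (measurableT_comp (f := fun x : rV => x ord0 j)) => //.
  exact: measurable_coord.
by apply: measurable_funM.
Qed.

(** There is no factor [1 / s]: for a smooth function with [i]-th derivative [g] this is its
    increment from [x] to [x + s *: e]. *)
Definition line_average g x : R := \int[leb]_t (g (x + t *: e) * \1_I t).

Let measurable_K g : measurable_fun setT g ->
  measurable_fun setT (fun p : rV * R => (g (p.1 + p.2 *: e) * \1_I p.2)).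
Proof.
move=> mg; apply: measurable_funM.
  exact: (measurableT_comp mg measurable_shift).
have H : measurable_fun setT (\1_I : R -> R) by exact: measurable_indic.
exact: (measurableT_comp H (@measurable_snd _ _ rV (measurableTypeR R))).
Qed.

Lemma measurable_line_average g : measurable_fun setT g ->
  measurable_fun setT (line_average g).
Proof.
move=> mg; apply: measurableT_comp => //.
(* The integral along a line may be infinite for some [x], so Tonelli is applied to the positive and
   the negative part separately. *)
under eq_fun do rewrite integralE.
have mK : measurable_fun setT (fun p : rV * R => (g (p.1 + p.2 *: e) * \1_I p.2)%:E).
  by apply/measurable_EFinP; exact: measurable_K.
have H1 := measurable_fun_fubini_tonelli_F (m2 := leb) _ (measurable_funepos mK)
  (fun p => funepos_ge0 _ p).
have H2 := measurable_fun_fubini_tonelli_F (m2 := leb) _ (measurable_funeneg mK)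
  (fun p => funeneg_ge0 _ p).
apply: emeasurable_funB.
  apply: eq_measurable_fun H1 => x _; apply: eq_integral => t _.
  by rewrite !funeposE.
apply: eq_measurable_fun H2 => x _; apply: eq_integral => t _.
by rewrite !funenegE.
Qed.

Let line_sqr g x := (\int[leb]_t (g (x + t *: e) ^+ 2 * \1_I t)%:E)%E.

Let line_sqr_int g : g \in Lfun mu 2%:E ->
  (\int[mu]_x line_sqr g x = s%:E * \int[mu]_x (g x ^+ 2)%:E)%E.
Proof.
case/Lfun2P => mg _.
have mg2 : measurable_fun setT (fun x => g x ^+ 2) by exact: measurable_funX.
have mK : measurable_fun setT
    (fun p : rV * R => (g (p.1 + p.2 *: e) ^+ 2 * \1_I p.2)%:E).
  by apply/measurable_EFinP; exact: (measurable_K mg2).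
have K0 (p : rV * R) : (0 <= (g (p.1 + p.2 *: e) ^+ 2 * \1_I p.2)%:E)%E.
  by rewrite lee_fin mulr_ge0 ?sqr_ge0.
apply: etrans (fubini_tonelli (m1 := mu) (m2 := leb) _ mK K0) _ => /=.
transitivity (\int[leb]_t ((\int[mu]_x (g x ^+ 2)%:E) * (\1_I t)%:E))%E.
  apply: eq_integral => t _; under eq_integral do rewrite EFinM.
  have mgt : measurable_fun setT (fun x => (g (x + t *: e) ^+ 2)%:E).
    by apply/measurable_EFinP; apply: (measurableT_comp mg2); exact: measurable_translate.
  rewrite ge0_integralZr//; try by [move=> x _; rewrite lee_fin sqr_ge0|rewrite lee_fin].
  by rewrite (ge0_integral_translate (t *: e) (f := fun x => (g x ^+ 2)%:E))//;
   [exact/measurable_EFinP|move=> x; rewrite lee_fin sqr_ge0].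
have m1 : measurable_fun setT (fun t => (\1_I t : R)%:E).
  by apply/measurable_EFinP; exact: measurable_indic.
rewrite ge0_integralZl//; try by
  [move=> t _; rewrite lee_fin|apply: integral_ge0 => x _; rewrite lee_fin sqr_ge0].
by rewrite integral_indic// setIT [X in (_ * X)%E]lebI muleC.
Qed.

Let line_L2 g x : measurable_fun setT g -> (line_sqr g x < +oo)%E ->
  (fun t => g (x + t *: e) * \1_I t) \in Lfun leb 2%:E.
Proof.
move=> mg gx; apply/Lfun2P; split.
  apply: measurable_funM; last exact: measurable_indic.
  exact: (measurableT_comp (measurableT_comp mg measurable_shift) (pair1_measurable x)).
apply: le_lt_trans gx; rewrite le_eqVlt; apply/orP; left; apply/eqP.
by apply: eq_integral => t _; rewrite exprMn ind2.
Qed.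

Let indic_L2 : (\1_I : R -> R) \in Lfun leb 2%:E.
Proof.
apply/Lfun2P; split; first exact: measurable_indic.
under eq_integral do rewrite ind2.
by rewrite integral_indic// setIT [X in (X < _)%E]lebI ltry.
Qed.

Let inner_indic : inner leb (\1_I) (\1_I) = s.
Proof.
apply: EFin_inj; rewrite innerE//.
under eq_integral do rewrite ind2.
by rewrite integral_indic// setIT; exact: lebI.
Qed.

Lemma line_average_sqr g x : measurable_fun setT g ->
  ((line_average g x ^+ 2)%:E <= s%:E * line_sqr g x)%E.
Proof.
move=> mg; have ls0 : (0 <= line_sqr g x)%E.
  by apply: integral_ge0 => t _; rewrite lee_fin mulr_ge0 ?sqr_ge0.
have [gx|] := ltP (line_sqr g x) +oo%E; last first.
  by rewrite leye_eq => /eqP ->; rewrite gt0_muley ?lte_fin// leey.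
have fL := line_L2 mg gx.
have := cauchy_schwarz (Lfun2_submodule leb) (inner_semi_inner leb) fL indic_L2.
rewrite inner_indic (_ : inner _ _ _ = line_average g x); last first.
  by apply: eq_Rintegral => t _; rewrite -mulrA -expr2 ind2.
rewrite -lee_fin [in leRHS]EFinM innerE// muleC.
rewrite (_ : (\int[leb]_t ((g (x + t *: e) * \1_I t) ^+ 2)%:E)%E = line_sqr g x)//.
by apply: eq_integral => t _; rewrite exprMn ind2.
Qed.

(** Cauchy-Schwarz on the segment gives one factor [s]; integrating over [x] first, with translation
    invariance, gives the other. *)
Lemma line_average_norm g : g \in Lfun mu 2%:E ->
  (\int[mu]_x (line_average g x ^+ 2)%:E <= (s ^+ 2)%:E * \int[mu]_x (g x ^+ 2)%:E)%E.
Proof.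
move=> gL; have mg := Lfun2_measurable gL.
rewrite expr2 EFinM -muleA -line_sqr_int//.
have mK : measurable_fun setT
    (fun p : rV * R => (g (p.1 + p.2 *: e) ^+ 2 * \1_I p.2)%:E).
  by apply/measurable_EFinP; apply: (measurable_K (g := fun x => g x ^+ 2)); exact: measurable_funX.
have K0 (p : rV * R) : (0 <= (g (p.1 + p.2 *: e) ^+ 2 * \1_I p.2)%:E)%E.
  by rewrite lee_fin mulr_ge0 ?sqr_ge0.
have mJ : measurable_fun setT (line_sqr g).
  exact: (measurable_fun_fubini_tonelli_F (m2 := leb) _ mK K0).
have J0 x : (0 <= line_sqr g x)%E.
  by apply: integral_ge0 => t _; exact: (K0 (x, t)).
rewrite -ge0_integralZl//; last by rewrite lee_fin ltW.
apply: ge0_le_integral_nonmeasurable => x; first by rewrite lee_fin sqr_ge0.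
exact: line_average_sqr.
Qed.

Lemma line_average_Lfun2 g : g \in Lfun mu 2%:E -> line_average g \in Lfun mu 2%:E.
Proof.
move=> gL; have [mg ig] := (Lfun2P _ _).1 gL.
apply/Lfun2P; split; first exact: measurable_line_average.
apply: le_lt_trans (line_average_norm gL) _.
by rewrite lte_mul_pinfty// lee_fin sqr_ge0.
Qed.

Let line_integrable g x : measurable_fun setT g -> (line_sqr g x < +oo)%E ->
  leb.-integrable setT (fun t => (g (x + t *: e) * \1_I t)%:E).
Proof.
move=> mg gx; have := Lfun2_mul_integrable (line_L2 mg gx) indic_L2.
apply: eq_integrable => // t _ /=.
by rewrite -mulrA -expr2 ind2.
Qed.

Let line_sqr_fin g : g \in Lfun mu 2%:E -> \forall x \ae mu, (line_sqr g x < +oo)%E.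
Proof.
move=> gL; have [mg ig] := (Lfun2P _ _).1 gL.
have mK : measurable_fun setT
    (fun p : rV * R => (g (p.1 + p.2 *: e) ^+ 2 * \1_I p.2)%:E).
  by apply/measurable_EFinP; apply: (measurable_K (g := fun x => g x ^+ 2)); exact: measurable_funX.
have K0 (p : rV * R) : (0 <= (g (p.1 + p.2 *: e) ^+ 2 * \1_I p.2)%:E)%E.
  by rewrite lee_fin mulr_ge0 ?sqr_ge0.
have mJ : measurable_fun setT (line_sqr g).
  exact: (measurable_fun_fubini_tonelli_F (m2 := leb) _ mK K0).
have J0 x : (0 <= line_sqr g x)%E.
  by apply: integral_ge0 => t _; exact: (K0 (x, t)).
have iJ : (mu : {measure set rV -> \bar R}).-integrable setT (line_sqr g).
  apply/integrableP; split => //.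
  under eq_integral do rewrite gee0_abs//.
  by rewrite line_sqr_int// lte_mul_pinfty// lee_fin ltW.
have := integrable_ae measurableT iJ; apply: filterS => x /(_ Logic.I).
by rewrite ge0_fin_numE.
Qed.

Let product_integrable (F : rV * R -> R) (C : R) : measurable_fun setT F ->
  (forall t, (\int[mu]_x `|F (x, t)|%:E <= (C * \1_I t)%:E)%E) ->
  (mu \x leb)%E.-integrable setT (EFin \o F).
Proof.
move=> mF FC.
have mEF : measurable_fun setT (EFin \o F) by exact/measurable_EFinP.
have FC' t : (\int[mu]_x `|F (x, t)|%:E <= (`|C| * \1_I t)%:E)%E.
  by apply: le_trans (FC t) _; rewrite lee_fin ler_wpM2r// ler_norm.
apply/integrable21ltyP => //.
apply: (@le_lt_trans _ _ (\int[leb]_t (`|C| * \1_I t)%:E)%E).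
  apply: ge0_le_integral_nonmeasurable => t; last exact: FC'.
  by apply: integral_ge0 => x _; rewrite lee_fin.
under eq_integral do rewrite EFinM.
rewrite ge0_integralZl//; try by [move=> t _; rewrite lee_fin|rewrite lee_fin].
  by rewrite integral_indic// setIT [X in (_ * X)%E]lebI -EFinM ltry.
by apply/measurable_EFinP; exact: measurable_indic.
Qed.

Let norm_mul_le (a b : R) : `|a * b| <= a ^+ 2 + b ^+ 2.
Proof.
rewrite ler_norml; have := sqr_ge0 (a - b); have := sqr_ge0 (a + b).
by have := sqr_ge0 a; have := sqr_ge0 b => *; apply/andP; split; nra.
Qed.

Let integral_mul_le g phi : g \in Lfun mu 2%:E -> phi \in Lfun mu 2%:E ->
  (\int[mu]_x `|g x * phi x|%:E <= (inner mu g g + inner mu phi phi)%:E)%E.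
Proof.
move=> gL phiL; have mg := Lfun2_measurable gL; have mphi := Lfun2_measurable phiL.
rewrite EFinD !innerE// -ge0_integralD//; try by
  [move=> x _; rewrite lee_fin sqr_ge0|apply/measurable_EFinP; exact: measurable_funX].
apply: ge0_le_integral_nonmeasurable => x; first by rewrite lee_fin.
by rewrite -EFinD lee_fin; exact: norm_mul_le.
Qed.

Let inner_sqr_translate h g : g \in Lfun mu 2%:E ->
  inner mu (fun x => g (x + h)) (fun x => g (x + h)) = inner mu g g.
Proof.
move=> gL; rewrite inner_translate//; last exact: Lfun2_translate.
by congr inner; apply/funext => x; rewrite subrK.
Qed.

(* Fubini, with the translation by t performed under the outer integral in t. *)
Lemma inner_line_average g phi : g \in Lfun mu 2%:E -> phi \in Lfun mu 2%:E ->
  (forall x, `|phi x| <= 1) ->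
  inner mu (line_average g) phi =
  inner mu g (fun x => \int[leb]_t (phi (x - t *: e) * \1_I t)).
Proof.
move=> gL phiL phi1.
have mg := Lfun2_measurable gL; have mphi := Lfun2_measurable phiL.
rewrite /inner /Rintegral; congr fine.
pose f (p : rV * R) := (g (p.1 + p.2 *: e) * \1_I p.2 * phi p.1)%:E.
pose f' (p : rV * R) := (g p.1 * (phi (p.1 - p.2 *: e) * \1_I p.2))%:E.
have mf : measurable_fun setT f.
  apply/measurable_EFinP; apply: measurable_funM; first exact: measurable_K.
  exact: measurableT_comp.
have mphi' : measurable_fun setT (fun p : rV * R => phi (p.1 - p.2 *: e)).
  have H : measurable_fun setT (fun p : rV * R => (p.1, - p.2)).
    by apply: measurable_fun_pair => //; exact: measurableT_comp.
  have := measurableT_comp mphi (measurableT_comp measurable_shift H).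
  by apply: eq_measurable_fun => p _ /=; rewrite scaleNr.
have mI2 : measurable_fun setT (fun p : rV * R => \1_I p.2 : R).
  have H : measurable_fun setT (\1_I : R -> R) by exact: measurable_indic.
  exact: (measurableT_comp H (@measurable_snd _ _ rV (measurableTypeR R))).
have mf' : measurable_fun setT f'.
  apply/measurable_EFinP; apply: measurable_funM; last exact: measurable_funM.
  exact: measurableT_comp.
have iff : (mu \x leb)%E.-integrable setT f.
  apply: (@product_integrable _ (inner mu g g + inner mu phi phi)).
    exact/measurable_EFinP.
  move=> t; rewrite indicE; case: (boolP (t \in I)) => tI; last first.
    by under eq_integral do rewrite mulr0 mul0r normr0; rewrite integral0 mulr0.
  under eq_integral do rewrite mulr1.
  rewrite mulr1 -(inner_sqr_translate (t *: e) gL).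
  exact: (integral_mul_le (Lfun2_translate (t *: e) gL) phiL).
have iff' : (mu \x leb)%E.-integrable setT f'.
  apply: (@product_integrable _ (inner mu g g + inner mu phi phi)).
    exact/measurable_EFinP.
  move=> t; rewrite indicE; case: (boolP (t \in I)) => tI; last first.
    by under eq_integral do rewrite !mulr0 normr0; rewrite integral0 mulr0.
  under eq_integral do rewrite mulr1.
  rewrite mulr1 -(inner_sqr_translate (- (t *: e)) phiL).
  exact: (integral_mul_le gL (Lfun2_translate (- (t *: e)) phiL)).
transitivity (\int[mu]_x \int[leb]_t f (x, t))%E.
  apply: ae_eq_integral => //.
  - apply/measurable_EFinP; apply: measurable_funM => //.
    exact: measurable_line_average.
  - exact: (measurable_fubini_F iff).
  - apply: filterS (line_sqr_fin gL) => x gx _.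
    have ig := line_integrable mg gx.
    rewrite /f; under eq_integral do rewrite /= EFinM.
    by rewrite integralZr// EFinM /line_average /Rintegral fineK//; exact: integrable_fin_num.
rewrite (Fubini iff).
transitivity (\int[leb]_t \int[mu]_x f' (x, t))%E.
  apply: eq_integral => t _.
  rewrite -(@integral_translate (t *: e) (fun x => f' (x, t))).
    by apply: eq_integral => x _; rewrite /f /f' /= addrK mulrAC mulrA.
  exact: (measurableT_comp mf' (pair2_measurable t)).
rewrite -(Fubini iff').
apply: eq_integral => x _.
have iphi : leb.-integrable setT (fun t => (phi (x - t *: e) * \1_I t)%:E).
  have i1 : leb.-integrable setT (fun t : R => (\1_I t)%:E).
    have := Lfun2_mul_integrable indic_L2 indic_L2.
    by apply: eq_integrable => // t _; rewrite -expr2 ind2.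
  apply: le_integrable i1 => //.
    apply/measurable_EFinP; apply: measurable_funM; last exact: measurable_indic.
    exact: (measurableT_comp mphi' (pair1_measurable x)).
  move=> t _; rewrite /= lee_fin normrM ler_piMl//.
transitivity (\int[leb]_t ((g x)%:E * (phi (x - t *: e) * \1_I t)%:E))%E.
  by apply: eq_integral => t _; rewrite -EFinM.
by rewrite integralZl// EFinM /Rintegral fineK//; exact: integrable_fin_num.
Qed.

End average.
End translation_estimate.

Section weak_derivative_translation.
Context {R : realType} {d : nat}.
Local Notation rV := 'rV[R]_d.
Local Notation mu := (mes d : {sigma_finite_measure set 'rV[R]_d -> \bar R}).
Local Notation leb := (@lebesgue_measure R).
Implicit Types (a b x h : rV) (u g : rV -> R).

Definition weak_partial_R (i : 'I_d) u g := forall phi : rV -> R,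
  test_function phi -> inner mu u (partial i phi) = - inner mu g phi.

Lemma Lfun2B u g : u \in Lfun mu 2%:E -> g \in Lfun mu 2%:E ->
  (fun x => u x - g x) \in Lfun mu 2%:E.
Proof. exact: (submoduleB (Lfun2_submodule mu)). Qed.

Lemma innerBl u g w : u \in Lfun mu 2%:E -> g \in Lfun mu 2%:E -> w \in Lfun mu 2%:E ->
  inner mu (fun x => u x - g x) w = inner mu u w - inner mu g w.
Proof.
move=> uL gL wL; have [[il _] _ _] := inner_semi_inner mu.
exact: (linear_onB (Lfun2_submodule mu) (il w wL)).
Qed.

Lemma innerBr u g w : u \in Lfun mu 2%:E -> g \in Lfun mu 2%:E -> w \in Lfun mu 2%:E ->
  inner mu w (fun x => u x - g x) = inner mu w u - inner mu w g.
Proof.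
move=> uL gL wL; have [[_ ir] _ _] := inner_semi_inner mu.
exact: (linear_onB (Lfun2_submodule mu) (ir w wL)).
Qed.

Section one_direction.
Variables (i : 'I_d) (s : R) (u g : rV -> R).
Hypotheses (s0 : 0 < s) (uL : u \in Lfun mu 2%:E) (gL : g \in Lfun mu 2%:E).
Hypothesis ug : weak_partial_R i u g.
Let e : rV := delta_mx ord0 i.

(* The test function is the integral of the bump over [0, s] in direction i. *)
Lemma weak_translate_bumps a b n :
  inner mu (fun x => u (x + s *: e) - u x) (bumps a b n) =
  inner mu (line_average i s g) (bumps a b n).
Proof.
pose f j := smooth_bump (a ord0 j) (b ord0 j) n.
have fs j : smooth_R (f j) by exact: smooth_bump_smooth.
have f0 j (x : R) : (x < a ord0 j - 1) || (b ord0 j + 1 < x) -> f j x = 0.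
  exact: smooth_bump_support.
have f1 j (x : R) : `|f j x| <= 1.
  by rewrite ger0_norm ?smooth_bump_ge0// smooth_bump_le1.
have [F dF Fs] := smooth_R_primitive (fs i) (f1 i) (f0 i).
pose H y := F y - F (y - s).
have HE y : \int[leb]_(t in `[0, s]) f i (y - t) = H y by exact: smooth_R_FTC.
have Fss : smooth_R (fun y => F (y - s)).
  have := smooth_R_affine 1 (- s) Fs.
  by congr smooth_R; apply/funext => y; rewrite mul1r.
have Hs : smooth_R H by exact: smooth_RB.
have dH (y : R) : is_derive y 1 H (f i y - f i (y - s)).
  apply: is_deriveB => //.
  have := is_derive_affine 1 (- s) y dF; rewrite !mul1r.
  by congr is_derive; apply/funext => z; rewrite mul1r.
pose Phi := prodf (update f i H).
have tPhi : test_function Phi.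
  (* [H y] involves the bump on [[y - s, y]], so the support grows by [s] on the right. *)
  apply: (@prodf_test_function _ _ _ (a - const_mx 1) (b + const_mx (1 + s))).
    by move=> j; rewrite /update; case: ifP.
  move=> j y; rewrite !mxE /update; case: (eqVneq j i) => [->|_] Hy; last first.
    apply: contra_neqT Hy => Hy; apply: f0.
    move: Hy; rewrite negb_and -!ltNge => /orP[->//|Hy]; apply/orP; right.
    by apply: lt_trans Hy; rewrite ltrD2l ltrDl.
  apply: contra_neqT Hy => Hy; rewrite -HE.
  transitivity (\int[leb]_(t in `[0, s]) (0 : R)); last by rewrite /Rintegral integral0.
  apply: eq_Rintegral => t; rewrite inE/= in_itv/= => /andP[t0 ts]; apply: f0.
  by move: Hy; rewrite negb_and -!ltNge => /orP[Hy|Hy]; apply/orP; [left|right]; lra.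
have bumpsE x t : bumps a b n (x - t *: e) =
    f i (x ord0 i - t) * \prod_(j | j != i) f j (x ord0 j).
  by rewrite -scaleNr [x + _]addrC /e /bumps prodf_line [- t + _]addrC.
have PhiE x : Phi x = \int[leb]_t (bumps a b n (x - t *: e) * \1_`[0, s]%classic t).
  rewrite /Phi prodf_update -HE; set c := \prod_(j | j != i) _.
  have ic : leb.-integrable `[0, s] (EFin \o (fun t => f i (x ord0 i - t))).
    apply: continuous_compact_integrable; first exact: segment_compact.
    apply: continuous_subspaceT => t.
    apply: (@continuous_comp R R R (fun t => x ord0 i - t) (f i)).
      by apply: cvgB => //; exact: cvg_cst.
    exact: smooth_R_continuous (fs i) _.
  rewrite -RintegralZr// Rintegral_mkcond; apply: eq_Rintegral => t _.
  rewrite patchE indicE; case: ifPn => _; last by rewrite mulr0.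
  by rewrite mulr1 bumpsE.
(* The derivative is the bump minus its translate. Tested against [u], the translation can be moved
   onto [u], which produces the difference [u (x + s *: e) - u x]. *)
have pPhi : partial i Phi = (fun x => bumps a b n x - bumps a b n (x - s *: e)).
  have dU (y : R) : is_derive y 1 (update f i H i) (f i y - f i (y - s)).
    by rewrite /update eqxx.
  rewrite /Phi (prodf_partial dU).
  apply/funext => x; rewrite prodf_update mulrBl.
  rewrite (eq_bigr (fun j => f j (x ord0 j))); last first.
    by move=> j ji; rewrite /update (negbTE ji).
  rewrite -bumpsE; congr (_ - _).
  by rewrite /bumps /prodf [RHS](bigD1 i).
have phiL := bumps_Lfun2 a b n.
have phisL : (fun x => bumps a b n (x - s *: e)) \in Lfun mu 2%:E by exact: Lfun2_translate.
rewrite innerBl//; last exact: Lfun2_translate.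
rewrite inner_translate//.
have := ug tPhi; rewrite pPhi innerBr// => /(congr1 (@GRing.opp R)).
rewrite opprK opprB => ->.
rewrite (inner_line_average i s0 gL phiL); last first.
  by move=> x; rewrite ger0_norm ?bumps_ge0// bumps_le1.
by congr inner; apply/funext => x; rewrite PhiE.
Qed.

(** The increment of [u] and the line average of [g] have the same inner products with all bumps, so
    they agree almost everywhere; [line_average_norm] concludes. *)
Lemma weak_translate_pos :
  (\int[mu]_x ((u (x + s *: e) - u x) ^+ 2)%:E <= (s ^+ 2)%:E * \int[mu]_x (g x ^+ 2)%:E)%E.
Proof.
have dL : (fun x => u (x + s *: e) - u x) \in Lfun mu 2%:E.
  by apply: Lfun2B => //; exact: Lfun2_translate.
have aL := line_average_Lfun2 i s0 gL.
have ae0 : \forall x \ae mu, (u (x + s *: e) - u x) - line_average i s g x = 0.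
  apply: (ae_eq0_of_orthogonal_bumps (Lfun2B dL aL)) => a b n.
  rewrite innerBl//; last exact: bumps_Lfun2.
  by rewrite weak_translate_bumps subrr.
apply: le_trans (line_average_norm i s0 gL); rewrite le_eqVlt; apply/orP; left; apply/eqP.
apply: ae_eq_integral => //.
- by apply/measurable_EFinP; apply: measurable_funX; exact: (Lfun2_measurable dL).
- by apply/measurable_EFinP; apply: measurable_funX; exact: (Lfun2_measurable aL).
- by apply: filterS ae0 => x /eqP; rewrite subr_eq0 => /eqP -> _.
Qed.

End one_direction.

Definition sqr_norm u : \bar R := (\int[mu]_x (u x ^+ 2)%:E)%E.

Lemma weak_translate (i : 'I_d) (s : R) u g :
  u \in Lfun mu 2%:E -> g \in Lfun mu 2%:E -> weak_partial_R i u g ->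
  (sqr_norm (fun x => (u (x + s *: delta_mx ord0 i) - u x)%R) <=
   (s ^+ 2)%:E * sqr_norm g)%E.
Proof.
move=> uL gL ug; have [s0|s0|->] := ltgtP s 0; last first.
- rewrite expr0n mul0e /sqr_norm; under eq_integral do rewrite scale0r addr0 subrr expr0n.
  by rewrite integral0.
- exact: weak_translate_pos.
(* A negative step is reduced to the positive step [- s] by translating the variable. *)
have Ns0 : 0 < - s by rewrite oppr_gt0.
have := weak_translate_pos Ns0 uL gL ug; rewrite sqrrN; apply: le_trans.
rewrite /sqr_norm le_eqVlt; apply/orP; left; apply/eqP.
rewrite -(integral_translate (s *: delta_mx ord0 i)
  (f := fun x => ((u (x + (- s) *: delta_mx ord0 i) - u x) ^+ 2)%:E)); last first.
  apply/measurable_EFinP; apply: measurable_funX; apply: measurable_funB.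
    exact: Lfun2_measurable (Lfun2_translate _ uL).
  exact: Lfun2_measurable uL.
apply: eq_integral => x _; congr EFin.
by rewrite scaleNr addrK -sqrrN opprB.
Qed.

End weak_derivative_translation.

(** * Tiles and the compactness inequality *)

Section weak_gradient_translation.
Context {R : realType} {d : nat}.
Local Notation rV := 'rV[R]_d.
Local Notation mu := (mes d : {sigma_finite_measure set 'rV[R]_d -> \bar R}).
Implicit Types (x y h : rV) (u : rV -> R).

Lemma inner_le_sqr_norm u (M : R) : u \in Lfun mu 2%:E ->
  (sqr_norm u <= M%:E)%E = (inner mu u u <= M).
Proof. by move=> uL; rewrite /sqr_norm -innerE// lee_fin. Qed.

Lemma inner_translate_sqr h u : u \in Lfun mu 2%:E ->
  inner mu (fun x => u (x + h)) (fun x => u (x + h)) = inner mu u u.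
Proof.
move=> uL; rewrite inner_translate//; last exact: Lfun2_translate.
by congr inner; apply/funext => x; rewrite subrK.
Qed.

(** One coordinate is moved at a time: the increment by [e + s] is the increment by [e], translated
    by [s], plus the increment by [s]. Each [(x + y)^2 <= 2 x^2 + 2 y^2] costs a factor [2]. *)
Lemma weak_gradient_translate_seq (r : seq 'I_d) u (g : 'I_d -> rV -> R) h :
  u \in Lfun mu 2%:E -> (forall i, g i \in Lfun mu 2%:E) ->
  (forall i, weak_partial_R i u (g i)) ->
  let hr := \sum_(i <- r) h ord0 i *: delta_mx ord0 i in
  inner mu (fun x => u (x + hr) - u x) (fun x => u (x + hr) - u x) <=
  2 ^+ size r * \sum_(i <- r) h ord0 i ^+ 2 * inner mu (g i) (g i).
Proof.
move=> uL gL ug /=; have iL := inner_semi_inner mu.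
elim: r => [|i r IH].
  rewrite !big_nil mulr0 (_ : (fun x => _) = cst 0); last first.
    by apply/funext => x; rewrite addr0 subrr.
  by rewrite /inner /Rintegral integral0_eq// => x _; rewrite mul0r.
rewrite !big_cons /=; set s := \sum_(j <- r) _ *: _ in IH *.
set e := h ord0 i *: _; set G := \sum_(j <- r) _ in IH *.
pose w x := u (x + e) - u x.
have wL : w \in Lfun mu 2%:E by apply: Lfun2B => //; exact: Lfun2_translate.
have vL : (fun x => u (x + s) - u x) \in Lfun mu 2%:E.
  by apply: Lfun2B => //; exact: Lfun2_translate.
have -> : (fun x => u (x + (e + s)) - u x) =
    ((fun x => w (x + s)) + (fun x => u (x + s) - u x))%R.
  apply/funext => x.
  change (u (x + (e + s)) - u x = u (x + s + e) - u (x + s) + (u (x + s) - u x)).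
  by rewrite (_ : x + (e + s) = x + s + e); [ring|rewrite [e + s]addrC addrA].
apply: le_trans (si_sqrD_le (Lfun2_submodule mu) iL _ vL) _.
  exact: (Lfun2_translate s wL).
rewrite inner_translate_sqr//.
have wle : inner mu w w <= h ord0 i ^+ 2 * inner mu (g i) (g i).
  rewrite -inner_le_sqr_norm//.
  apply: le_trans (weak_translate (h ord0 i) uL (gL i) (ug i)) _.
  by rewrite /sqr_norm -innerE ?gL// -EFinM.
have G0 : 0 <= h ord0 i ^+ 2 * inner mu (g i) (g i).
  by rewrite mulr_ge0 ?sqr_ge0//; exact: (si_ge0 iL (gL i)).
have H1 : (1 : R) <= 2 ^+ size r by rewrite exprn_ege1// ler1n.
rewrite exprS; set P := 2 ^+ size r in IH H1 *.
have : h ord0 i ^+ 2 * inner mu (g i) (g i) <= P * (h ord0 i ^+ 2 * inner mu (g i) (g i)).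
  by rewrite ler_peMl.
lra.
Qed.

Lemma weak_gradient_translate u (g : 'I_d -> rV -> R) h (r : R) :
  u \in Lfun mu 2%:E -> (forall i, g i \in Lfun mu 2%:E) ->
  (forall i, weak_partial_R i u (g i)) -> (forall i, `|h ord0 i| <= r) ->
  (sqr_norm (fun x => (u (x + h) - u x)%R) <=
   (2 ^+ d * r ^+ 2 * \sum_i inner mu (g i) (g i))%:E)%E.
Proof.
move=> uL gL ug hr; rewrite inner_le_sqr_norm; last first.
  by apply: Lfun2B => //; exact: Lfun2_translate.
have hE : h = \sum_(i <- enum 'I_d) h ord0 i *: delta_mx ord0 i.
  by rewrite {1}(row_sum_delta h) big_enum.
have := weak_gradient_translate_seq (enum 'I_d) h uL gL ug.
rewrite -hE => H; apply: le_trans H _.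
rewrite size_enum_ord big_enum/=.
rewrite -mulrA ler_pM2l ?exprn_gt0// mulr_sumr; apply: ler_sum => i _.
apply: ler_wpM2r; first exact: (si_ge0 (inner_semi_inner mu) (gL i)).
by rewrite -[h ord0 i ^+ 2]real_normK ?num_real// lerXn2r// nnegrE// (le_trans _ (hr i)).
Qed.

End weak_gradient_translation.

Section tiles.
Context {R : realType} {d : nat}.
Local Notation rV := 'rV[R]_d.
Local Notation mu := (mes d : {sigma_finite_measure set 'rV[R]_d -> \bar R}).
Implicit Types (x y h : rV) (u : rV -> R) (k : R).

(* Cubes of edge 1 / k with corners in k^-1 Z^d, half-open so that they partition space. *)
Definition same_tile k x y : bool :=
  [forall i, Num.floor (k * x ord0 i) == Num.floor (k * y ord0 i)].

Definition tile_kernel k x y : R := (same_tile k x y)%:R.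

Lemma tile_kernelP k x y : 0 < k -> tile_kernel k x y != 0 ->
  forall i, `|y ord0 i - x ord0 i| <= k^-1.
Proof.
move=> k0; rewrite /tile_kernel pnatr_eq0 eqb0 negbK => /forallP xy i.
have /eqP xyi := xy i; have := floor_itv (k * x ord0 i); rewrite xyi.
have := floor_itv (k * y ord0 i); move: (Num.floor _) => z.
rewrite intrD => /andP[y1 y2] /andP[x1 x2].
rewrite -(ler_pM2l k0) divff ?gt_eqF// -{1}(gtr0_norm k0) -normrM mulrBr.
by rewrite ler_norml; apply/andP; split; lra.
Qed.

Lemma measurable_floor : measurable_fun setT (fun x : R => (Num.floor x)%:~R : R).
Proof.
by apply: nondecreasing_measurable => // x y xy; rewrite ler_int; exact: le_floor.
Qed.

Lemma measurable_tile_kernel k :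
  measurable_fun setT (fun p : rV * rV => tile_kernel k p.1 p.2).
Proof.
have mfl (f : rV * rV -> rV) : measurable_fun setT f -> forall i,
    measurable_fun setT (fun p => (Num.floor (k * f p ord0 i))%:~R : R).
  move=> mf i; apply: (measurableT_comp measurable_floor).
  apply: measurable_funM => //.
  exact: (measurableT_comp (measurable_coord i) mf).
rewrite /tile_kernel.
have -> : (fun p : rV * rV => (same_tile k p.1 p.2)%:R : R) = \1_(\bigcap_(i in [set: 'I_d])
   [set p : rV * rV | ((Num.floor (k * p.1 ord0 i))%:~R : R) == (Num.floor (k * p.2 ord0 i))%:~R]).
  apply/funext => p; rewrite indicE; congr (nat_of_bool _)%:R.
  apply/forallP/idP => [H|].
    by rewrite inE => i _ /=; rewrite (eqP (H i)).
  by rewrite inE => H i; have := H i I; rewrite /= eqr_int.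
apply: measurable_indic; apply: fin_bigcap_measurable => // i _.
have := measurable_fun_eqr (mfl _ measurable_fst i) (mfl _ measurable_snd i).
move=> /(_ measurableT [set true] I); rewrite setTI; congr measurable.
Qed.

Lemma measurable_add_rV : measurable_fun setT (fun p : rV * rV => p.1 + p.2).
Proof.
apply: measurable_fun_row => i; under eq_fun do rewrite mxE.
by apply: measurable_funD; [exact: (measurableT_comp (measurable_coord i) measurable_fst)
  |exact: (measurableT_comp (measurable_coord i) measurable_snd)].
Qed.

(** Put [y = x + h]. Points of one tile differ by at most [1 / k] in each coordinate, so the double
    integral is at most that of the squared increments over [h] in a box of measure
    [(2 / k) ^+ d]. *)
Lemma tile_difference k u (g : 'I_d -> rV -> R) : 0 < k ->
  u \in Lfun mu 2%:E -> (forall i, g i \in Lfun mu 2%:E) ->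
  (forall i, weak_partial_R i u (g i)) ->
  (\int[mu]_x \int[mu]_y (tile_kernel k x y * (u x - u y) ^+ 2)%:E <=
   ((2 / k) ^+ d * (2 ^+ d * k ^- 2 * \sum_i inner mu (g i) (g i)))%:E)%E.
Proof.
move=> k0 uL gL ug; have mu_ := Lfun2_measurable uL.
pose B : set rV := box (const_mx (- k^-1)) (const_mx k^-1).
pose F (p : rV * rV) : R := \1_B p.2 * (u (p.1 + p.2) - u p.1) ^+ 2.
have mF : measurable_fun setT (fun p => (F p)%:E).
  apply/measurable_EFinP; apply: measurable_funM.
    exact: (measurableT_comp (measurable_indic (measurable_box _ _)) measurable_snd).
  apply: measurable_funX; apply: measurable_funB.
    exact: (measurableT_comp mu_ measurable_add_rV).
  exact: (measurableT_comp mu_ measurable_fst).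
have F0 p : (0 <= (F p)%:E)%E by rewrite lee_fin mulr_ge0// sqr_ge0.
have mK (x : rV) : measurable_fun setT (fun y => (tile_kernel k x y * (u x - u y) ^+ 2)%:E).
  apply/measurable_EFinP; apply: measurable_funM.
    exact: (measurableT_comp (measurable_tile_kernel k) (pair1_measurable x)).
  by apply: measurable_funX; exact: measurable_funB.
have K0 x y : (0 <= (tile_kernel k x y * (u x - u y) ^+ 2)%:E)%E.
  by rewrite lee_fin mulr_ge0// sqr_ge0.
have HG := fubini_tonelli (m1 := mu) (m2 := mu) _ mF F0.
apply: (@le_trans _ _ (\int[mu]_x \int[mu]_h (F (x, h))%:E)%E).
  apply: ge0_le_integral_nonmeasurable => x; first by apply: integral_ge0 => y _; exact: K0.
  rewrite -(integral_translate x (mK x)).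
  apply: ge0_le_integral_nonmeasurable => h; first exact: K0.
  rewrite /F lee_fin/= [h + x]addrC -[(u x - _) ^+ 2]sqrrN opprB.
  apply: ler_wpM2r; first exact: sqr_ge0.
  have [->|K] := eqVneq (tile_kernel k x (x + h)) 0; first by [].
  rewrite indicE mem_set ?lern1 ?leq_b1// => i; rewrite !mxE -ler_norml.
  by have := tile_kernelP k0 K i; rewrite mxE addrAC subrr add0r.
rewrite HG.
set C := 2 ^+ d * _ * _.
have C0 : 0 <= C.
  rewrite /C !mulr_ge0 ?exprn_ge0 ?invr_ge0 ?exprn_ge0 ?(ltW k0)//.
  by apply: sumr_ge0 => i _; exact: (si_ge0 (inner_semi_inner mu) (gL i)).
apply: (@le_trans _ _ (\int[mu]_h ((\1_B h)%:E * C%:E))%E).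
  apply: ge0_le_integral_nonmeasurable => h; first by apply: integral_ge0 => x _; exact: F0.
  rewrite /F/=; under eq_integral do rewrite EFinM.
  rewrite ge0_integralZl; last 4 first.
  - exact: measurableT.
  - apply/measurable_EFinP; apply: measurable_funX; apply: measurable_funB; last exact: mu_.
    exact: (measurableT_comp mu_ (measurable_translate h)).
  - by move=> x _; rewrite lee_fin sqr_ge0.
  - by rewrite lee_fin.
  rewrite indicE; case: (boolP (h \in B)) => [|_]; last by rewrite !mul0e.
  rewrite inE => Bh; rewrite !mul1e /C -exprVn.
  apply: (weak_gradient_translate uL gL ug) => i.
  by have := Bh i; rewrite !mxE -ler_norml.
rewrite ge0_integralZr; last 4 first.
- exact: measurableT.
- by apply/measurable_EFinP; exact: measurable_indic (measurable_box _ _).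
- by move=> h _; rewrite lee_fin.
- by rewrite lee_fin.
rewrite integral_indic; [|exact: measurableT|exact: measurable_box].
have k1 : 0 < k^-1 by rewrite invr_gt0.
have mB : (mes d B = ((2 / k) ^+ d)%:E)%E.
  rewrite /B mes_box; last by move=> i; rewrite !mxE; lra.
  rewrite (eq_bigr (fun=> 2 / k)); last by move=> i _; rewrite !mxE; lra.
  by rewrite prodr_const card_ord.
by rewrite setIT [X in (X * _)%E]mB EFinM.
Qed.

End tiles.

(** * Poincare-type estimates on tiles *)

Section average_bound.
Context {R : realType} {disp : measure_display} {T : measurableType disp}.
Variable mu : {measure set T -> \bar R}.

Lemma indic_Lfun2 (S : set T) : measurable S -> (mu S < +oo)%E ->
  (\1_S : T -> R) \in Lfun mu 2%:E /\ (inner mu \1_S \1_S)%:E = mu S.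
Proof.
move=> mS Sfin.
have E : (\int[mu]_x ((\1_S x : R) ^+ 2)%:E = mu S)%E.
  under eq_integral do rewrite indicE -natrX -[(_ ^ 2)%N]mulnn mulnb andbb -indicE.
  by rewrite integral_indic// setIT.
have SL : (\1_S : T -> R) \in Lfun mu 2%:E.
  by apply/Lfun2P; split; [exact: measurable_indic|rewrite E].
by split => //; rewrite innerE.
Qed.

(** A pointwise Poincare inequality, to be used with [a = u x] and [S] the tile of [x]: [a] is the
    mean over [S] of [a - u] plus the mean of [u]. *)
Lemma average_bound (S : set T) (u : T -> R) (a c : R) :
  measurable S -> (mu S < +oo)%E -> 0 < c -> (c%:E <= mu S)%E -> u \in Lfun mu 2%:E ->
  ((a ^+ 2)%:E <= (2 / c)%:E * \int[mu]_y (\1_S y * (a - u y) ^+ 2)%:E +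
    (2 / c ^+ 2 * inner mu \1_S u ^+ 2)%:E)%E.
Proof.
move=> mS Sfin c0 cS uL.
have [SL SE] := indic_Lfun2 mS Sfin.
set M := inner mu \1_S \1_S in SE.
have cM : c <= M by rewrite -lee_fin SE.
pose w y := \1_S y * u y.
have S2 y : (\1_S y : R) ^+ 2 = \1_S y.
  by rewrite indicE -natrX -[(_ ^ 2)%N]mulnn mulnb andbb.
have [wL _] : w \in Lfun mu 2%:E /\ inner mu w w <= 1 ^+ 2 * inner mu u u.
  apply: (inner_mul_bounded (measurable_indic mS)) uL => x.
  by rewrite indicE normr_nat lern1 leq_b1.
have iL := inner_semi_inner mu.
have wE : inner mu \1_S w = inner mu \1_S u.
  by congr fine; apply: eq_integral => y _; rewrite /w mulrA -expr2 S2.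
set L := inner mu \1_S u in wE *.
have := cauchy_schwarz (Lfun2_submodule mu) iL SL wL; rewrite wE -/M => CS.
have aSL := Lfun2Z a SL.
have dL : ((fun y => a * \1_S y) + (-1) *: w) \in Lfun mu 2%:E.
  exact: (Lfun2D aSL (Lfun2Z (-1) wL)).
have NE : (\int[mu]_y (\1_S y * (a - u y) ^+ 2)%:E)%E =
    (inner mu ((fun y => a * \1_S y) + (-1) *: w) ((fun y => a * \1_S y) + (-1) *: w))%:E.
  rewrite innerE//; apply: eq_integral => y _; congr EFin.
  change (\1_S y * (a - u y) ^+ 2 = (a * \1_S y + (-1) * w y) ^+ 2).
  by rewrite /w -{1}S2; ring.
have := si_sqrD (Lfun2_submodule mu) iL (-1) aSL wL.
have -> : inner mu (fun y => a * \1_S y) (fun y => a * \1_S y) = a ^+ 2 * M.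
  have H := siZl iL a SL aSL; have H' := siZr iL a SL SL.
  by rewrite expr2 -mulrA -H' -H.
have -> : inner mu (fun y => a * \1_S y) w = a * L by rewrite -wE -(siZl iL a SL wL).
rewrite NE; set N := inner mu _ _; set Q := inner mu w w in CS * => NQ.
rewrite -EFinM -EFinD lee_fin.
have M0 : 0 < M by exact: lt_le_trans cM.
have N0 : 0 <= N by exact: (si_ge0 iL dL).
(* [N = a^2 M - 2 a L + Q] and [L^2 <= M Q], so the right side exceeds the left by at least
   [(M a - 2 L)^2]. *)
have H1 : M ^+ 2 * a ^+ 2 <= 2 * M * N + 2 * L ^+ 2.
  have : 0 <= (M * a - 2 * L) ^+ 2 by exact: sqr_ge0.
  by rewrite NQ; nra.
apply: (@le_trans _ _ (2 / M * N + 2 / M ^+ 2 * L ^+ 2)).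
  rewrite -(ler_pM2l (exprn_gt0 2 M0)); apply: le_trans H1 _.
  rewrite le_eqVlt; apply/orP; left; apply/eqP; field.
  by rewrite gt_eqF.
apply: lerD; apply: ler_wpM2r => //; rewrite ?sqr_ge0// ler_pM2l// lef_pV2 ?posrE ?exprn_gt0//.
by rewrite lerXn2r// nnegrE ltW.
Qed.

End average_bound.

Section tile_estimates.
Context {R : realType} {d : nat}.
Local Notation rV := 'rV[R]_d.
Local Notation mu := (mes d : {sigma_finite_measure set 'rV[R]_d -> \bar R}).
Implicit Types (x y h : rV) (u : rV -> R) (k : R).

Lemma integral_tile_kernel k y : 0 < k ->
  (\int[mu]_x (tile_kernel k x y)%:E <= ((2 / k) ^+ d)%:E)%E.
Proof.
move=> k0; pose B : set rV := box (y - const_mx k^-1) (y + const_mx k^-1).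
apply: (@le_trans _ _ (\int[mu]_x (\1_B x)%:E)%E).
  apply: ge0_le_integral_nonmeasurable => x; rewrite lee_fin; first by [].
  have [->|K] := eqVneq (tile_kernel k x y) 0; first by [].
  rewrite indicE mem_set ?lern1 ?leq_b1// => i; rewrite !mxE.
  have := tile_kernelP k0 K i; rewrite ler_norml => /andP[? ?].
  by apply/andP; split; lra.
rewrite integral_indic; [|exact: measurableT|exact: measurable_box].
have k1 : 0 < k^-1 by rewrite invr_gt0.
have mB : (mes d B = ((2 / k) ^+ d)%:E)%E.
  rewrite /B mes_box; last by move=> i; rewrite !mxE; lra.
  rewrite (eq_bigr (fun=> 2 / k)); last by move=> i _; rewrite !mxE; lra.
  by rewrite prodr_const card_ord.
by rewrite setIT [X in (X <= _)%E]mB.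
Qed.

Variables (u : rV -> R) (g : 'I_d -> rV -> R).
Hypotheses (uL : u \in Lfun mu 2%:E) (gL : forall i, g i \in Lfun mu 2%:E).
Hypothesis ug : forall i, weak_partial_R i u (g i).
Let G := \sum_i inner mu (g i) (g i).
Let mu_ : measurable_fun setT u := Lfun2_measurable uL.

Let mdiff k : measurable_fun setT
  (fun p : rV * rV => (tile_kernel k p.1 p.2 * (u p.1 - u p.2) ^+ 2)%:E).
Proof.
apply/measurable_EFinP; apply: measurable_funM; first exact: measurable_tile_kernel.
apply: measurable_funX; apply: measurable_funB.
  exact: (measurableT_comp mu_ measurable_fst).
exact: (measurableT_comp mu_ measurable_snd).
Qed.

Let diff_ge0 k (p : rV * rV) :
  (0 <= (tile_kernel k p.1 p.2 * (u p.1 - u p.2) ^+ 2)%:E)%E.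
Proof. by rewrite lee_fin mulr_ge0// sqr_ge0. Qed.

Let mdiff1 k : measurable_fun setT (fun x =>
  (\int[mu]_y (tile_kernel k x y * (u x - u y) ^+ 2)%:E)%E).
Proof. exact: (measurable_fun_fubini_tonelli_F (m2 := mu) _ (mdiff k) (diff_ge0 k)). Qed.

(** For [y] in the tile of [x] with [V y >= sigma], [u(x)^2] is at most [2 (u(x) - u(y))^2 + (2 /
    sigma) V(y) u(y)^2]. Integration over these [y] produces [kappa] on the left, while the right
    side is enlarged to the whole tile. *)
Lemma far_estimate k (V : rV -> R) (sigma kappa : R) (F : set rV) :
  0 < k -> 0 < sigma -> 0 <= kappa -> measurable_fun setT V -> (forall x, 0 <= V x) ->
  (fun x => Num.sqrt (V x) * u x) \in Lfun mu 2%:E -> measurable F ->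
  (forall x, F x -> (kappa%:E <= mu [set y | same_tile k x y /\ (sigma <= V y)%R])%E) ->
  (kappa%:E * \int[mu]_x (\1_F x * u x ^+ 2)%:E <=
   ((2 / k) ^+ d * (2 * (2 ^+ d * k ^- 2 * G) +
     2 / sigma * inner mu (fun x => Num.sqrt (V x) * u x)
        (fun x => Num.sqrt (V x) * u x)))%:E)%E.
Proof.
move=> k0 s0 kap0 mV V0 vL mF HF.
pose W := inner mu (fun x => Num.sqrt (V x) * u x) (fun x => Num.sqrt (V x) * u x).
pose H2 (p : rV * rV) := tile_kernel k p.1 p.2 * (V p.2 * u p.2 ^+ 2).
have mVu : measurable_fun setT (fun y => V y * u y ^+ 2).
  by apply: measurable_funM => //; exact: measurable_funX.
have Vu0 y : 0 <= V y * u y ^+ 2 by rewrite mulr_ge0// sqr_ge0.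
have mH2 : measurable_fun setT (fun p => (H2 p)%:E).
  apply/measurable_EFinP; apply: measurable_funM; first exact: measurable_tile_kernel.
  exact: (measurableT_comp mVu measurable_snd).
have H20 p : (0 <= (H2 p)%:E)%E by rewrite lee_fin mulr_ge0.
have sk0 : 0 <= 2 / sigma by rewrite divr_ge0// ltW.
have mH21 := measurable_fun_fubini_tonelli_F (m2 := mu) _ mH2 H20.
have WE : (\int[mu]_y (V y * u y ^+ 2)%:E = W%:E)%E.
  rewrite /W innerE//; apply: eq_integral => y _.
  by rewrite exprMn sqr_sqrtr.
have I2 : (\int[mu]_x \int[mu]_y (H2 (x, y))%:E <= ((2 / k) ^+ d * W)%:E)%E.
  have -> := fubini_tonelli (m1 := mu) (m2 := mu) _ mH2 H20.
  rewrite EFinM -WE -ge0_integralZl; last 4 first.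
  - exact: measurableT.
  - exact/measurable_EFinP.
  - by move=> y _; rewrite lee_fin.
  - by rewrite lee_fin exprn_ge0// divr_ge0// ltW.
  apply: ge0_le_integral_nonmeasurable => y; first by apply: integral_ge0 => x _; exact: H20.
  rewrite /H2/=; under eq_integral do rewrite EFinM.
  rewrite ge0_integralZr; last 4 first.
  - exact: measurableT.
  - apply/measurable_EFinP.
    exact: (measurableT_comp (measurable_tile_kernel k) (pair2_measurable y)).
  - by move=> x _; rewrite lee_fin.
  - by rewrite lee_fin.
  by apply: lee_wpmul2r; [rewrite lee_fin|exact: integral_tile_kernel].
have I1 := tile_difference k0 uL gL ug.
rewrite -ge0_integralZl; last 4 first.
- exact: measurableT.
- apply/measurable_EFinP; apply: measurable_funM; first exact: measurable_indic.
  exact: measurable_funX.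
- by move=> x _; rewrite lee_fin mulr_ge0// sqr_ge0.
- by rewrite lee_fin.
apply: (@le_trans _ _ (\int[mu]_x (2%:E *
   (\int[mu]_y (tile_kernel k x y * (u x - u y) ^+ 2)%:E) +
   (2 / sigma)%:E * \int[mu]_y (H2 (x, y))%:E))%E); last first.
  rewrite ge0_integralD; last 5 first.
  - exact: measurableT.
  - move=> x _; rewrite mule_ge0 ?lee_fin//; apply: integral_ge0 => y _.
    exact: (diff_ge0 k (x, y)).
  - exact: emeasurable_funM.
  - by move=> x _; rewrite mule_ge0 ?lee_fin//; exact: integral_ge0.
  - exact: emeasurable_funM.
  rewrite !ge0_integralZl ?lee_fin//; last 2 first.
  - by move=> x _; apply: integral_ge0 => y _; exact: (diff_ge0 k (x, y)).
  - by move=> x _; exact: integral_ge0.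
  apply: (@le_trans _ _ (2%:E * ((2 / k) ^+ d * (2 ^+ d * k ^- 2 * G))%:E +
      (2 / sigma)%:E * ((2 / k) ^+ d * W)%:E)%E).
    by apply: leeD; apply: lee_wpmul2l; rewrite ?lee_fin.
  rewrite -!EFinM -EFinD lee_fin -/W le_eqVlt; apply/orP; left; apply/eqP; ring.
apply: ge0_le_integral_nonmeasurable => x.
  by rewrite mule_ge0 ?lee_fin// mulr_ge0// sqr_ge0.
pose A := [set y | same_tile k x y /\ sigma <= V y].
have mA : measurable A.
  have -> : A = ((fun y => tile_kernel k x y) @^-1` [set 1]) `&` (V @^-1` `[sigma, +oo[).
    apply/seteqP; split => y; rewrite /tile_kernel /A /= in_itv/= andbT.
      by move=> [-> ->].
    by case: same_tile => -[] // /eqP; rewrite eq_sym oner_eq0.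
  apply: measurableI; rewrite -[X in measurable X]setTI.
    by apply: (measurableT_comp (measurable_tile_kernel k) (pair1_measurable x)).
  exact: mV.
have mKx : measurable_fun setT (fun y => tile_kernel k x y).
  exact: (measurableT_comp (measurable_tile_kernel k) (pair1_measurable x)).
have md1 : measurable_fun setT (fun y => (tile_kernel k x y * (u x - u y) ^+ 2)%:E).
  exact: (measurableT_comp (mdiff k) (pair1_measurable x)).
have mh1 : measurable_fun setT (fun y => (H2 (x, y))%:E).
  exact: (measurableT_comp mH2 (pair1_measurable x)).
rewrite -!ge0_integralZl ?lee_fin//; last first.
- by move=> y _; exact: (diff_ge0 k (x, y)).
rewrite -ge0_integralD; last 5 first.
- exact: measurableT.
- by move=> y _; rewrite mule_ge0 ?lee_fin//; exact: (diff_ge0 k (x, y)).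
- exact: emeasurable_funM.
- by move=> y _; apply: mule_ge0; [rewrite lee_fin|exact: H20].
- exact: emeasurable_funM.
have [Fx|Fx] := pselect (F x); last first.
  rewrite indicE memNset// mul0r mule0; apply: integral_ge0 => y _.
  apply: adde_ge0; apply: mule_ge0; rewrite ?lee_fin//.
    exact: (diff_ge0 k (x, y)).
  exact: H20.
rewrite indicE mem_set// mul1r.
apply: (@le_trans _ _ (mu A * (u x ^+ 2)%:E)%E).
  by apply: lee_wpmul2r; [rewrite lee_fin sqr_ge0|exact: HF].
rewrite -[A]setIT -integral_indic// -ge0_integralZr; last 4 first.
- exact: measurableT.
- by apply/measurable_EFinP; exact: measurable_indic.
- by move=> y _; rewrite lee_fin.
- by rewrite lee_fin sqr_ge0.
apply: ge0_le_integral_nonmeasurable => y.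
  by rewrite -EFinM lee_fin mulr_ge0// sqr_ge0.
rewrite -!EFinM -EFinD lee_fin indicE /H2 /=.
have [Ay|Ay] := pselect (A y); last first.
  by rewrite memNset// mul0r addr_ge0// mulr_ge0// mulr_ge0// sqr_ge0.
rewrite mem_set// mul1r /tile_kernel; case: Ay => -> Vs; rewrite !mul1r.
have : u y ^+ 2 <= sigma^-1 * (V y * u y ^+ 2).
  by rewrite mulrA ler_peMl ?sqr_ge0// mulrC ler_pdivlMr// mul1r.
(* Nonnegativity of this square is [u(x)^2 <= 2 (u(x) - u(y))^2 + 2 u(y)^2]. *)
have := sqr_ge0 (u x - 2 * u y).
have -> : 2 / sigma * (V y * u y ^+ 2) = 2 * (sigma^-1 * (V y * u y ^+ 2)) by rewrite -mulrA.
by move: (sigma^-1 * _) => Z; nra.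
Qed.


Definition tile_set k (t : 'I_d -> int) : set rV :=
  [set x | forall i, Num.floor (k * x ord0 i) = t i].

Lemma same_tile_set k t x y : tile_set k t x -> same_tile k x y = (y \in tile_set k t).
Proof.
move=> xt; apply/forallP/idP => [xy|]; last first.
  by rewrite inE => yt i; rewrite xt yt.
by rewrite inE => i; rewrite -(eqP (xy i)) xt.
Qed.

Lemma measurable_tile_set k t : measurable (tile_set k t).
Proof.
have -> : tile_set k t = \bigcap_(i in [set: 'I_d]) ((fun x : rV => x ord0 i) @^-1`
    ((fun y : R => (Num.floor (k * y))%:~R : R) @^-1` [set (t i)%:~R])).
  apply/seteqP; split => x H i /=; first by move=> _; rewrite H.
  by apply/eqP; rewrite -(eqr_int R); apply/eqP; exact: H.
apply: fin_bigcap_measurable => // i _; apply: measurable_coord_preimage.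
rewrite -[X in measurable X]setTI.
by apply: (measurableT_comp (@measurable_floor R)); first exact: mulrl_measurable.
Qed.

(** A half-open tile is not a [box]. It contains a closed box of edge [1 / (2 k)] and lies within
    [1 / k] of each of its points; the factors lost only affect constants. *)
Lemma mes_tile_set k t : 0 < k ->
  (((2 * k)^-1 ^+ d)%:E <= mu (tile_set k t))%E /\ (mu (tile_set k t) <= ((2 / k) ^+ d)%:E)%E.
Proof.
move=> k0; have k1 : 0 < k^-1 by rewrite invr_gt0.
pose a : rV := \row_i ((t i)%:~R / k).
have k2 : (2 * k)^-1 = k^-1 / 2 by rewrite invfM mulrC.
have aB : box a (a + const_mx (2 * k)^-1) `<=` tile_set k t.
  move=> x ax i; apply/eqP; rewrite floor_eq intrD.
  have := ax i; rewrite !mxE k2 => /andP[x1 x2].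
  have H1 : (t i)%:~R <= x ord0 i * k by rewrite -ler_pdivrMr.
  have H2 : x ord0 i * k <= (t i)%:~R + 1 / 2.
    have : x ord0 i * k <= ((t i)%:~R / k + k^-1 / 2) * k by rewrite ler_pM2r.
    by rewrite mulrDl divfK ?gt_eqF// -mulrA [2^-1 * k]mulrC mulrA mulVf ?gt_eqF.
  by rewrite [k * _]mulrC; apply/andP; split; lra.
have tE x y : tile_set k t x -> tile_set k t y -> tile_kernel k x y = 1.
  by move=> tx ty; rewrite /tile_kernel (same_tile_set y tx) mem_set.
split.
  have <- : mes d (box a (a + const_mx (2 * k)^-1)) = ((2 * k)^-1 ^+ d)%:E.
    rewrite mes_box; last by move=> i; rewrite !mxE k2; lra.
    rewrite (eq_bigr (fun=> (2 * k)^-1)); last by move=> i _; rewrite !mxE; lra.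
    by rewrite prodr_const card_ord.
  by apply: le_measure => //; rewrite inE; [exact: measurable_box|exact: measurable_tile_set].
have aT : tile_set k t a by apply: aB => i; rewrite !mxE k2; lra.
apply: le_trans (integral_tile_kernel a k0).
rewrite -[X in mu X]setIT -integral_indic; [|exact: measurableT|exact: measurable_tile_set].
apply: ge0_le_integral_nonmeasurable => x; rewrite lee_fin; first by [].
rewrite indicE; case: (boolP (x \in _)) => // /set_mem xt.
by rewrite tE.
Qed.

(** Each point of [F] is in one of finitely many tiles, where [average_bound] applies; the gradient
    term comes from [tile_difference], and the averages over the tiles are the functionals to be
    retained. *)
Lemma near_estimate k (I : finType) (t : I -> 'I_d -> int) (F : set rV) :
  0 < k -> measurable F -> (forall x, F x -> exists j, tile_set k (t j) x) ->
  (\int[mu]_x (\1_F x * u x ^+ 2)%:E <=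
    (2 * 4 ^+ d * (2 ^+ d * k ^- 2 * G) +
     \sum_j (2 / k) ^+ d * (2 / ((2 * k)^-1 ^+ d) ^+ 2) * inner mu \1_(tile_set k (t j)) u ^+ 2)%:E)%E.
Proof.
move=> k0 mF HF; set c := (2 * k)^-1 ^+ d.
have c0 : 0 < c by rewrite exprn_gt0// invr_gt0 mulr_gt0.
have kd0 : 0 <= (2 / k) ^+ d by rewrite exprn_ge0// divr_ge0// ltW.
pose A j := 2 / c ^+ 2 * inner mu \1_(tile_set k (t j)) u ^+ 2.
have A0 j : 0 <= A j by rewrite mulr_ge0 ?sqr_ge0// divr_ge0// exprn_ge0// ltW.
have mT j : measurable_fun setT (fun x => (A j)%:E * (\1_(tile_set k (t j)) x : R)%:E)%E.
  apply: emeasurable_funM => //; apply/measurable_EFinP.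
  by apply: measurable_indic; exact: measurable_tile_set.
have T0 j x : (0 <= (A j)%:E * (\1_(tile_set k (t j)) x : R)%:E)%E.
  by rewrite -EFinM lee_fin mulr_ge0.
apply: (@le_trans _ _ (\int[mu]_x ((2 / c)%:E *
   (\int[mu]_y (tile_kernel k x y * (u x - u y) ^+ 2)%:E) +
   \sum_j (A j)%:E * (\1_(tile_set k (t j)) x)%:E))%E).
  apply: ge0_le_integral_nonmeasurable => x; first by rewrite lee_fin mulr_ge0// sqr_ge0.
  have c2 : 0 <= 2 / c by rewrite divr_ge0// ltW.
  have D0 : (0 <= \int[mu]_y (tile_kernel k x y * (u x - u y) ^+ 2)%:E)%E.
    by apply: integral_ge0 => y _; exact: (diff_ge0 k (x, y)).
  have [Fx|Fx] := pselect (F x); last first.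
    rewrite indicE memNset// mul0r; apply: adde_ge0; last exact: sume_ge0.
    by apply: mule_ge0; rewrite ?lee_fin.
  have [j xj] := HF x Fx; rewrite indicE mem_set// mul1r.
  have [cl cu] := mes_tile_set (t j) k0.
  have := average_bound (u x) (measurable_tile_set k (t j)) (le_lt_trans cu (ltry _)) c0 cl uL.
  rewrite -/(A j) => /le_trans; apply; apply: leeD.
    apply: lee_wpmul2l; first by rewrite lee_fin.
    rewrite le_eqVlt; apply/orP; left; apply/eqP; apply: eq_integral => y _.
    by rewrite indicE /tile_kernel (same_tile_set y xj).
  rewrite (bigD1 j)//= indicE mem_set// mule1 leeDl//.
  exact: sume_ge0.
rewrite ge0_integralD; last 5 first.
- exact: measurableT.
- move=> x _; rewrite mule_ge0 ?lee_fin//; first by rewrite divr_ge0// ltW.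
  by apply: integral_ge0 => y _; exact: (diff_ge0 k (x, y)).
- exact: emeasurable_funM.
- by move=> x _; exact: sume_ge0.
- by apply: emeasurable_sum => j; exact: mT.
rewrite ge0_integralZl; last 4 first.
- exact: measurableT.
- exact: mdiff1.
- by move=> x _; apply: integral_ge0 => y _; exact: (diff_ge0 k (x, y)).
- by rewrite lee_fin divr_ge0// ltW.
rewrite ge0_integral_sum//.
rewrite EFinD; apply: leeD.
  apply: (@le_trans _ _ ((2 / c)%:E * ((2 / k) ^+ d * (2 ^+ d * k ^- 2 * G))%:E)%E).
    apply: lee_wpmul2l; first by rewrite lee_fin divr_ge0// ltW.
    exact: (tile_difference k0 uL gL ug).
  rewrite -EFinM lee_fin le_eqVlt; apply/orP; left; apply/eqP.
  (* [c] is the lower bound for the measure of a tile and [(2 / k) ^+ d] the upper one; the powers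
     of [k] cancel. *)
  have cE : 2 / c * (2 / k) ^+ d = 2 * 4 ^+ d.
    rewrite /c -exprVn invrK -mulrA -exprMn; congr (_ * _ ^+ _); field.
    by rewrite gt_eqF.
  by rewrite [LHS]mulrA cE.
rewrite -sumEFin; apply: lee_sum => j _.
rewrite ge0_integralZl; last 4 first.
- exact: measurableT.
- by apply/measurable_EFinP; apply: measurable_indic; exact: measurable_tile_set.
- by move=> x _; rewrite lee_fin.
- by rewrite lee_fin.
rewrite integral_indic; [|exact: measurableT|exact: measurable_tile_set].
have -> : (2 / k) ^+ d * (2 / c ^+ 2) * inner mu \1_(tile_set k (t j)) u ^+ 2 =
    A j * (2 / k) ^+ d by rewrite -mulrA mulrC.
rewrite setIT [X in (_ <= X)%E]EFinM; apply: lee_wpmul2l; first by rewrite lee_fin.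
by have [] := mes_tile_set (t j) k0.
Qed.

End tile_estimates.

Section compactness_inequality.
Context {R : realType} {d : nat}.
Local Notation rV := 'rV[R]_d.
Local Notation mu := (mes d : {sigma_finite_measure set 'rV[R]_d -> \bar R}).
Implicit Types (x y h : rV) (u : rV -> R) (k : R).

(* All that is used of the hypotheses on V, the dense systems and the
   rearrangements; kappa is psi(m, n) / 2 and k^-1 is comparable to m^-n. *)
Definition large_on_far_tiles (V : rV -> R) := forall eps : R, 0 < eps ->
  exists (k kappa sigma : R) (B : nat), [/\ 0 < k, 0 < kappa, 0 < sigma,
    (2 / k) ^+ d * (2 * (2 ^+ d * k ^- 2)) <= eps * kappa /\
    (2 / k) ^+ d * (2 / sigma) <= eps * kappa &
    forall x, (exists i, B%:R < `|x ord0 i|) ->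
      (kappa%:E <= mu [set y | same_tile k x y /\ (sigma <= V y)%R])%E].

Lemma compactness_inequality (V : rV -> R) : measurable_fun setT V ->
  (forall x, 0 <= V x) -> large_on_far_tiles V -> forall eps : R, 0 < eps ->
  exists K (A : 'I_K -> rV -> R), (forall j, A j \in Lfun mu 2%:E) /\
    forall u (g : 'I_d -> rV -> R), u \in Lfun mu 2%:E -> (forall i, g i \in Lfun mu 2%:E) ->
    (forall i, weak_partial_R i u (g i)) ->
    (fun x => Num.sqrt (V x) * u x) \in Lfun mu 2%:E ->
    inner mu u u <= eps * (\sum_i inner mu (g i) (g i) +
        inner mu (fun x => Num.sqrt (V x) * u x) (fun x => Num.sqrt (V x) * u x)) +
      \sum_j inner mu (A j) u ^+ 2.
Proof.
move=> mV V0 HV eps eps0; have e20 : 0 < eps / 2 by rewrite divr_gt0.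
have [k [kappa [sigma [B [k0 kap0 s0 [H1 H2] HB]]]]] := HV _ e20.
pose N : set rV := box (const_mx (- B%:R)) (const_mx B%:R).
have mN : measurable N by exact: measurable_box.
have farN x : (~` N) x -> exists i, B%:R < `|x ord0 i|.
  move=> Nx; apply: contrapT => H; apply: Nx => i; rewrite !mxE -ler_norml leNgt.
  by apply/negP => Hi; apply: H; exists i.
pose C : R := 2 * 4 ^+ d * 2 ^+ d.
have C0 : 0 < C by rewrite !mulr_gt0// exprn_gt0.
(* The near tiles have edge [1 / n], chosen independently of [k]; [C] is the coefficient of the
   gradient term in [near_estimate] apart from [n ^- 2]. *)
have [n n0 Hn] : exists2 n : nat, (0 < n)%N & C * n%:R ^- 2 <= eps / 2.
  exists (Num.truncn (C / (eps / 2))).+1 => //.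
  set n := (Num.truncn _).+1.
  have Hn : C / (eps / 2) < n%:R by rewrite truncnS_gt.
  have n1 : 1 <= n%:R :> R by rewrite ler1n.
  rewrite ler_pdivrMr ?exprn_gt0 ?(lt_le_trans _ n1)//.
  rewrite ltr_pdivrMr// in Hn; apply: le_trans (ltW Hn) _.
  by rewrite mulrC ler_pM2l// expr2 ler_peMl// (le_trans _ n1).
have nR : 0 < n%:R :> R by rewrite ltr0n.
(* Tiles meeting [N] have all indices in [[- P, P]]; shifted by [P] these are encoded by a finite
   function type. *)
pose P := (n * B.+1)%N.
have PE : (P%:Z)%:~R = n%:R * B.+1%:R :> R by rewrite -natrM.
pose I := {ffun 'I_d -> 'I_(P + P).+1}.
pose t (f : I) (i : 'I_d) : int := (f i : nat)%:Z - P%:Z.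
have cover x : N x -> exists f, tile_set n%:R (t f) x.
  move=> Nx; exists [ffun i => inord (absz (Num.floor (n%:R * x ord0 i) + P%:Z))] => i.
  rewrite /t ffunE; have := Nx i; rewrite !mxE => /andP[x1 x2].
  have F1 : - P%:Z <= Num.floor (n%:R * x ord0 i).
    rewrite floor_ge_int rmorphN /= PE -mulrN ler_pM2l//.
    by apply: le_trans x1; rewrite lerN2 ler_nat.
  have F2 : Num.floor (n%:R * x ord0 i) <= P%:Z.
    rewrite -(ler_int R) (le_trans (floor_le _))//= PE ler_pM2l//.
    by apply: le_trans x2 _; rewrite ler_nat.
  have F3 : 0 <= Num.floor (n%:R * x ord0 i) + P%:Z by rewrite -lerBlDr sub0r.
  rewrite inordK.
    by rewrite gez0_abs// addrK.
  by rewrite ltnS -lez_nat gez0_abs// PoszD lerD2r.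
(* The weight of a squared average in [near_estimate]; its square root is put into the function
   [A j]. *)
pose w : R := (2 / n%:R) ^+ d * (2 / ((2 * n%:R)^-1 ^+ d) ^+ 2).
have w0 : 0 <= w by rewrite mulr_ge0// ?divr_ge0// ?exprn_ge0// ?exprn_ge0// ?divr_ge0// invr_ge0 mulr_ge0.
exists #|I|, (fun j x => Num.sqrt w * \1_(tile_set n%:R (t (enum_val j))) x); split.
  move=> j; apply: Lfun2Z.
  have [_ cu] := mes_tile_set (t (enum_val j)) nR.
  by have [] := indic_Lfun2 (measurable_tile_set n%:R (t (enum_val j))) (le_lt_trans cu (ltry _)).
move=> u g uL gL ug vL.
set G := \sum_i _; set W := inner mu (fun x => Num.sqrt _ * _) _.
have iL := inner_semi_inner mu.
have G0 : 0 <= G by apply: sumr_ge0 => i _; exact: (si_ge0 iL (gL i)).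
have W0 : 0 <= W by exact: (si_ge0 iL vL).
set S := \sum_j _.
have SE : S = \sum_j w * inner mu \1_(tile_set n%:R (t j)) u ^+ 2.
  rewrite /S (reindex_onto (fun j : I => enum_rank j) (fun j => enum_val j)) /=; last first.
    by move=> j _; exact: enum_valK.
  apply: eq_big => [j|j _]; first by rewrite enum_rankK eqxx.
  rewrite enum_rankK.
  have [_ cu] := mes_tile_set (t j) nR.
  have [iSL _] := indic_Lfun2 (measurable_tile_set n%:R (t j)) (le_lt_trans cu (ltry _)).
  by rewrite [X in X ^+ 2](siZl iL _ iSL uL) exprMn sqr_sqrtr.
have near := near_estimate uL gL ug nR mN cover.
have mF : measurable (~` N) by exact: measurableC.
have far := far_estimate uL gL ug k0 s0 (ltW kap0) mV V0 vL mF
  (fun x Fx => HB x (farN x Fx)).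
have mu2 : measurable_fun setT (fun x => u x ^+ 2).
  by apply: measurable_funX; exact: Lfun2_measurable uL.
have m1 (F : set rV) : measurable F ->
    measurable_fun setT (fun x => (\1_F x * u x ^+ 2)%:E).
  by move=> mF'; apply/measurable_EFinP; apply: measurable_funM; [exact: measurable_indic|].
rewrite -lee_fin innerE//.
have -> : (\int[mu]_x (u x ^+ 2)%:E =
    \int[mu]_x (\1_N x * u x ^+ 2)%:E + \int[mu]_x (\1_(~` N) x * u x ^+ 2)%:E)%E.
  rewrite -ge0_integralD; last 5 first.
  - exact: measurableT.
  - by move=> x _; rewrite lee_fin mulr_ge0// sqr_ge0.
  - exact: m1.
  - by move=> x _; rewrite lee_fin mulr_ge0// sqr_ge0.
  - exact: m1.
  apply: eq_integral => x _; rewrite -EFinD -mulrDl; congr EFin.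
  rewrite !indicE in_setC; case: (x \in N) => /=.
    by rewrite addr0 mul1r.
  by rewrite add0r mul1r.
(* Half of [eps] is spent on the near gradient term and half on the far part; one term [eps / 2 * W]
   is to spare. *)
have -> : eps * (G + W) + S = (eps / 2 * G + S) + (eps / 2 * (G + W) + eps / 2 * W) by field.
rewrite EFinD; apply: leeD.
  apply: le_trans near _; rewrite lee_fin -SE lerD2r.
  rewrite !mulrA; apply: ler_wpM2r => //.
have kapE : (0 < kappa%:E)%E by rewrite lte_fin.
rewrite -(lee_pmul2l _ kapE)//.
apply: le_trans far _; rewrite -EFinM lee_fin -/G -/W.
have H1' := ler_wpM2r G0 H1; have H2' := ler_wpM2r W0 H2.
have : 0 <= eps / 2 * kappa * W by rewrite !mulr_ge0// ltW.
rewrite mulrDr; move: H1' H2'; rewrite !mulrA; lra.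
Qed.

End compactness_inequality.

(** * Rearrangements and dense systems *)

Section outer_monotone.
Context {R : realType}.
Local Open Scope ereal_scope.

(** [mes] is an iterated integral of sections for every set, so monotonicity extends to the
    superlevel sets of the inner rearrangement, whose measurability is not at hand. *)
Lemma le_mes d (A B : set 'rV[R]_d) : A `<=` B -> mes d A <= mes d B.
Proof.
elim: d A B => [|d IH] A B AB.
  rewrite /= /dirac !indicE lee_fin; case: (boolP (_ \in A)) => // /set_mem /AB.
  by move=> H; rewrite mem_set.
apply: ge0_le_integral_nonmeasurable => x /=; first exact: measure_ge0.
by apply: IH => y; rewrite /xsection /= !inE => /AB.
Qed.

End outer_monotone.

Section rearrangements.
Context {R : realType} {d : nat}.
Local Notation rV := 'rV[R]_d.
Implicit Types (x t y : rV).

(** With [0 <= M] the value exceeding [M] cannot be the default [0], so it comes from some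
    admissible [tau > M]. *)
Lemma rearrangement_gt (W : rV -> \bar R) (u M : R) (E : set rV) : 0 <= M ->
  (M%:E < rearrangement W u E)%E ->
  (u%:E <= mes d (E `&` [set x | (M%:E < W x)%E]))%E.
Proof.
move=> M0; rewrite /rearrangement lt_max lte_fin (le_gtF M0)/=.
case/ereal_sup_gt => _ [tau [t0 ut] <-]; rewrite lte_fin => Mt.
apply: le_trans ut _; apply: le_mes => x [Ex /= tx]; split => //=.
by apply: lt_le_trans tx; rewrite lte_fin.
Qed.

Lemma coord_le_euclid_norm x i : `|x ord0 i| <= euclid_norm x.
Proof.
rewrite /euclid_norm -sqrtr_sqr ler_sqrt; last by apply: sumr_ge0 => j _; exact: sqr_ge0.
by rewrite (bigD1 i)//= lerDl; apply: sumr_ge0 => j _; exact: sqr_ge0.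
Qed.

(* If Y(x, t) is large for many x and many t then V is large on half as many x:
   either V(t) >= sigma for all these t, or V(t) < sigma for one t, and then
   V(x) >= sigma for all these x outside a small box around the singularity t. *)
Lemma large_of_repeated_rearrangement (V : rV -> R) (psi sigma : R) (Q : set rV) :
  (0 < d)%N -> measurable_fun setT V -> (forall x, 0 <= V x) -> measurable Q ->
  0 < psi -> 0 < sigma ->
  let rho := Num.min 1 (psi / 2) / 2 in
  ((sigma * rho ^- (d - 2))%:E <
    repeated_rearrangement (fun x t => (kernelY V x t)%:E) psi Q Q)%E ->
  ((psi / 2)%:E <= mes d (Q `&` [set x | (sigma <= V x)%R]))%E.
Proof.
move=> d0 mV V0 mQ psi0 s0 rho H.
have r20 : 0 < Num.min 1 (psi / 2) by rewrite lt_min ltr01 divr_gt0.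
have r0 : 0 < rho by rewrite divr_gt0.
set M := sigma * _ in H; have M0 : 0 <= M.
  by rewrite mulr_ge0 ?invr_ge0 ?exprn_ge0 ?ltW.
have mZ : measurable (Q `&` [set x | sigma <= V x]).
  apply: measurableI => //; rewrite -[X in measurable X]setTI.
  have -> : [set x | sigma <= V x] = V @^-1` `[sigma, +oo[.
    by apply/seteqP; split => x /=; rewrite in_itv/= andbT.
  exact: mV.
have HT := rearrangement_gt M0 H.
set T := Q `&` _ in HT.
have [HV|] := pselect (forall t, T t -> sigma <= V t).
  apply: (@le_trans _ _ psi%:E); first by rewrite lee_fin; lra.
  apply: le_trans HT _; apply: le_mes => t Tt; split; last exact: HV.
  by case: Tt.
move=> /existsNP[t /not_implyP[[_ /= Tt] /negP]]; rewrite -ltNge => Vt.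
have HX := rearrangement_gt M0 Tt.
pose B := box (t - const_mx rho) (t + const_mx rho).
have mB : mes d B = ((2 * rho) ^+ d)%:E.
  rewrite /B mes_box; last by move=> i; rewrite !mxE; lra.
  rewrite (eq_bigr (fun=> 2 * rho)); last by move=> i _; rewrite !mxE; lra.
  by rewrite prodr_const card_ord.
(* The definition of [rho] gives [2 rho <= 1], whence [(2 rho)^d <= 2 rho <= psi / 2]. *)
have Bsmall : (2 * rho) ^+ d <= psi / 2.
  have -> : 2 * rho = Num.min 1 (psi / 2) by rewrite /rho; lra.
  case: d d0 => // n _; rewrite exprS.
  apply: (@le_trans _ _ (Num.min 1 (psi / 2))); last by rewrite ge_min lexx orbT.
  apply: ler_piMr; first exact: ltW.
  by apply: exprn_ile1; [exact: ltW|rewrite ge_min lexx].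
have sub : Q `&` [set x | (M%:E < (kernelY V x t)%:E)%E] `<=`
    (Q `&` [set x | sigma <= V x]) `|` B.
  move=> x [Qx /=]; rewrite lte_fin => Yx.
  have [Bx|Bx] := pselect (B x); [by right|left; split => //=].
  have {Bx} : rho <= euclid_norm (x - t).
    rewrite leNgt; apply/negP => Hx; apply: Bx => i; rewrite !mxE.
    have := le_lt_trans (coord_le_euclid_norm (x - t) i) Hx.
    by rewrite !mxE ltr_norml => /andP[? ?]; apply/andP; split; lra.
  move=> rx; rewrite leNgt; apply/negP => Vx.
  (* Outside the box the singular factor is at most [rho ^- (d - 2)], which was built into [M]. Two
     values of [V] below [sigma] cannot have a geometric mean above [sigma]. *)
  have : sigma < Num.sqrt (V x) * Num.sqrt (V t).
    have e0 : 0 < rho ^- (d - 2) by rewrite invr_gt0 exprn_gt0.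
    rewrite -(ltr_pM2r e0); apply: lt_le_trans Yx _; rewrite /kernelY mulrAC.
    apply: ler_wpM2l; first by rewrite mulr_ge0// sqrtr_ge0.
    rewrite lef_pV2 ?posrE ?exprn_gt0// ?(lt_le_trans r0)//.
    by rewrite lerXn2r// ?nnegrE ?ltW// (lt_le_trans r0).
  have := sqr_sqrtr (V0 x); have := sqr_sqrtr (V0 t).
  have := sqr_ge0 (Num.sqrt (V x) - Num.sqrt (V t)).
  by move: (Num.sqrt _) (Num.sqrt _) => a b; nra.
have : (psi%:E <= mes d (Q `&` [set x | (sigma <= V x)%R]) + (psi / 2)%:E)%E.
  apply: le_trans HX _; apply: le_trans (le_mes sub) _.
  apply: le_trans (measureU2 _ _ _) _ => //; first exact: measurable_box.
  by apply: leeD2l; rewrite [X in (X <= _)%E]mB lee_fin.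
case: (mes d _) => [z||] //; rewrite ?leey// -EFinD !lee_fin; lra.
Qed.

End rearrangements.

(** * Choice of the scale and of the grid cubes *)

Section scales.
Context {R : realType}.

(** The limsup provides arbitrarily small [r] with [gamma r] above [C m^2 r^2]. For the [n] with
    [m^-(n+1) < r <= m^-n], monotonicity of [gamma] transfers this to [m^-n], and the factor [m^2]
    pays for rounding [r] up. *)
Lemma exists_scale (m : nat) (r0 : R) (gamma : R -> R) (C : R) (n0 : nat) :
  (1 < m)%N -> m%:R^-1 < r0 ->
  (forall r s : R, 0 < r -> r <= s -> s < r0 -> gamma r <= gamma s) ->
  limf_esup (fun r : R => (r ^- 2 * gamma r)%:E) 0^'+ = +oo%E -> (0 < n0)%N -> 0 <= C ->
  exists2 n : nat, (n0 <= n)%N & C * (m%:R ^- n) ^+ 2 <= gamma (m%:R ^- n).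
Proof.
move=> m1 mr0 gam lims n00 C0.
have mR1 : 1 < m%:R :> R by rewrite ltr1n.
have mR0 : 0 < m%:R :> R by exact: lt_trans mR1.
pose A : set R := [set r | 0 < r < m%:R ^- n0].
have FA : 0^'+ A.
  have e0 : 0 < m%:R ^- n0 :> R by rewrite invr_gt0 exprn_gt0.
  near=> r; rewrite /A/=; apply/andP; split => //.
have supA : ereal_sup ((fun r : R => (r ^- 2 * gamma r)%:E) @` A) = +oo%E.
  apply/eqP; rewrite -leye_eq -lims; apply: ereal_inf_lbound; exists A => //.
have [_ [r /andP[rp rA] <-]] : exists2 y, ((fun r : R => (r ^- 2 * gamma r)%:E) @` A) y &
    ((C * m%:R ^+ 2)%:E < y)%E by apply: ereal_sup_gt; rewrite supA ltry.
rewrite lte_fin => Cr.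
have ex : exists n, m%:R ^- n < r.
  exists (Num.truncn (r^-1)).+1; rewrite invf_plt ?posrE ?exprn_gt0//.
  apply: lt_trans (truncnS_gt _) _; rewrite -natrX ltr_nat; exact: ltn_expl.
case: (ex_minnP ex) => n1 n1r n1min.
have n01 : (n0 < n1)%N.
  rewrite ltnNge; apply/negP => n10.
  have : m%:R ^- n0 <= m%:R ^- n1 :> R.
    by rewrite lef_pV2 ?posrE ?exprn_gt0// ler_eXn2l.
  by move=> /le_lt_trans/(_ n1r); rewrite ltNge (ltW rA).
case: n1 n1r n1min n01 => // n nr nmin; rewrite ltnS => n0n.
have rn : r <= m%:R ^- n.
  by rewrite leNgt; apply/negP => /nmin; rewrite ltnn.
exists n => //.
have nr0 : m%:R ^- n < r0.
  apply: le_lt_trans mr0; rewrite -{2}(expr1 (m%:R : R)).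
  by rewrite lef_pV2 ?posrE ?exprn_gt0// ler_eXn2l// (leq_trans n00).
apply: le_trans (gam _ _ rp rn nr0).
have r20 : 0 < r ^+ 2 by rewrite exprn_gt0.
have : C * m%:R ^+ 2 * r ^+ 2 <= gamma r.
  by rewrite -ler_pdivlMr// [gamma r / _]mulrC ltW.
apply: le_trans; rewrite -mulrA; apply: ler_wpM2l => //.
have -> : m%:R ^- n = m%:R * m%:R ^- n.+1 :> R.
  by rewrite exprS invfM mulrA divff ?mul1r// gt_eqF.
rewrite exprMn; apply: ler_wpM2l; first by rewrite exprn_ge0// ltW.
by rewrite lerXn2r ?nnegrE ?invr_ge0 ?exprn_ge0 ?(ltW rp) ?(ltW mR0) ?(ltW nr).
Unshelve. all: by end_near.
Qed.

Lemma truncn_log_le (m : nat) (x : R) (n : nat) : (1 < m)%N -> 0 < x -> x <= m%:R ^+ n ->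
  (Num.truncn (ln x / ln m%:R) <= n)%N.
Proof.
move=> m1 x0 xm; have lm : 0 < ln (m%:R : R) by rewrite ln_gt0// ltr1n.
rewrite truncn_le_nat ltr_pdivrMr//.
have m0 : 0 < m%:R :> R by rewrite ltr0n ltnW.
have : ln x <= ln (m%:R ^+ n : R) by rewrite ler_ln ?posrE ?exprn_gt0.
rewrite lnXn// => /le_lt_trans; apply.
by rewrite -[ln _ *+ n]mulr_natl ltr_pM2r// ltr_nat.
Qed.

End scales.

Section cubes.
Context {R : realType} {d : nat}.
Implicit Types (x y : 'rV[R]_d).

Lemma cube_box (r : R) y : 0 < r -> cube r y = box y (y + const_mx r).
Proof.
move=> r0; apply/seteqP; split => x.
  move=> [z z01 <-] i; have := z01 i; rewrite !mxE => /andP[z0 z1].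
  by apply/andP; split; nra.
move=> xy; exists (r^-1 *: (x - y)); last first.
  by rewrite scalerA divff ?gt_eqF// scale1r subrK.
move=> i; have := xy i; rewrite !mxE => /andP[x0 x1].
have ri : 0 < r^-1 by rewrite invr_gt0.
apply/andP; split; first by rewrite mulr_ge0 ?subr_ge0// ltW.
by rewrite mulrC ler_pdivrMr// mul1r lerBlDl.
Qed.

Lemma mes_cube (r : R) y : 0 < r -> mes d (cube r y) = (r ^+ d)%:E.
Proof.
move=> r0; rewrite cube_box// mes_box; last by move=> i; rewrite !mxE lerDl ltW.
by under eq_bigr do rewrite !mxE addrAC subrr add0r; rewrite prodr_const card_ord.
Qed.

End cubes.

Section far_tiles.
Context {R : realType} {d : nat}.
Local Notation rV := 'rV[R]_d.
Implicit Types (x y : rV).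

(* The tile of x of edge 1 / k, k = m^(n - K), contains a grid cube Q(xi, n)
   with xi in Xi: the cube of edge theta / k given by the dense system contains
   one since theta / k >= 2 m^-n. *)
Lemma tile_contains_grid_cube (m : nat) (theta : R) (D : 'rV[int]_d -> nat -> set rV)
    (n K : nat) x : (1 < m)%N -> 0 < theta < 1 ->
  (forall l, log_dense_system m theta (int_vec l) (D l)) ->
  2 <= theta * m%:R ^+ K -> (K < n)%N -> theta * m%:R ^+ 2 < m%:R ^+ (n - K) ->
  exists l : 'rV[int]_d, (forall i, l ord0 i = Num.floor (x ord0 i)) /\
    exists j xi, [/\ (1 <= j <= n)%N, grid_corners m n (D l j) xi &
      forall y, cube (m%:R ^- n) xi y -> same_tile (m%:R ^+ (n - K)) x y].
Proof.
move=> m1 /andP[th0 th1] hD thK Kn thn.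
have mR1 : 1 < m%:R :> R by rewrite ltr1n.
have mR0 : 0 < m%:R :> R by exact: lt_trans mR1.
set k : R := m%:R ^+ (n - K).
have kE : k = (m ^ (n - K))%N%:~R by rewrite /k -natrX.
have k0 : 0 < k by rewrite exprn_gt0.
pose r := k^-1; have r0 : 0 < r by rewrite invr_gt0.
pose q : R := m%:R ^- n; have q0 : 0 < q by rewrite invr_gt0 exprn_gt0.
have qn : q * m%:R ^+ n = 1 by rewrite mulVf// gt_eqF// exprn_gt0.
have rE : r = m%:R ^+ K * q.
  rewrite /r /q /k -{2}(subnK (ltnW Kn)) exprD invfM mulrCA mulfV ?mulr1//.
  by rewrite gt_eqF// exprn_gt0.
pose l : 'rV[int]_d := \row_i Num.floor (x ord0 i).
pose tt i := Num.floor (k * x ord0 i).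
pose z : rV := \row_i ((tt i)%:~R / k).
have tr : theta * r >= 2 * q by rewrite rE mulrA ler_wpM2r// ltW.
have kr : k * r = 1 by rewrite divff// gt_eqF.
(* As [k] is a power of the integer [m], tiles of edge [1 / k] subdivide the unit cubes, so the
   closed tile of [x] with corner [z] stays in the unit cube at the integer parts of [x]. *)
have zl : cube r z `<=` cube 1 (int_vec l).
  rewrite !cube_box// => y zy i; have := zy i; rewrite !mxE => /andP[y1 y2].
  have := floor_itv (x ord0 i); set a := Num.floor (x ord0 i).
  rewrite intrD => /andP[a1 a2].
  have t1 : a * (m ^ (n - K))%N%:Z <= tt i.
    by rewrite floor_ge_int intrM -kE mulrC ler_pM2l.
  have t2 : tt i + 1 <= (a + 1) * (m ^ (n - K))%N%:Z.
    rewrite lezD1 -(ltr_int R); apply: le_lt_trans (floor_le _) _.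
    by rewrite intrM intrD -kE mulrC ltr_pM2r.
  apply/andP; split.
    apply: le_trans y1; rewrite ler_pdivlMr// kE -intrM ler_int//.
  apply: le_trans y2 _; rewrite -[r]mul1r -mulrDl ler_pdivrMr// kE.
  by rewrite -[1 in leLHS]/(1%:~R) -intrD -[1 in leRHS]/(1%:~R) -intrD -intrM ler_int.
have [_ _ hd] := hD l.
have rlt : 0 < r < Num.min 1 (1 / (theta * m%:R ^+ 2)).
  have k1 : 1 < k by rewrite /k exprn_egt1// -lt0n subn_gt0.
  rewrite r0 lt_min /r invf_lt1// k1/=.
  by rewrite mul1r ltf_pV2 ?posrE// mulr_gt0// exprn_gt0.
have [j [/andP[j1 jn] [P [_ PD [s sP]]]]] := hd r z zl rlt.
have tr0 : 0 < theta * r by rewrite mulr_gt0.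
exists l; split; first by move=> i; rewrite mxE.
(* Rounding the corner [s] up to the grid moves it by less than [q]; since [theta * r >= 2 q], a
   grid cube of edge [q] still fits. *)
pose c : 'rV[int]_d := \row_i Num.ceil (m%:R ^+ n * s ord0 i).
pose xi : rV := m%:R ^- n *: int_vec c.
have xis i : s ord0 i <= xi ord0 i < s ord0 i + q.
  rewrite !mxE; have := ceil_itv (m%:R ^+ n * s ord0 i).
  move: (Num.ceil _) => b; rewrite intrB => /andP[b1 b2].
  have -> : s ord0 i = q * (m%:R ^+ n * s ord0 i) by rewrite mulrA qn mul1r.
  rewrite ler_pM2l// b2/= -[X in _ < _ + X]mulr1 -mulrDr ltr_pM2l//.
  by move: b1; rewrite ltrBlDr.
have sub : cube q xi `<=` cube (theta * r) s.
  rewrite !cube_box// => y xy i; have := xy i; have := xis i; rewrite !mxE.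
  by move=> /andP[? ?] /andP[? ?]; apply/andP; split; lra.
exists j, xi; split.
(* The logarithm is at most [n] because [theta * r >= m ^- n]. *)
- rewrite j1/=; apply: leq_trans jn _; apply: truncn_log_le => //.
    by rewrite divr_gt0.
  rewrite mul1r -[leRHS]invrK lef_pV2 ?posrE//.
  by apply: le_trans tr; rewrite -/q mulrDl mul1r lerDl ltW.
- by split; [exists c|move=> y /sub/sP[/PD]].
move=> y yxi; apply/forallP => i; rewrite eq_sym floor_eq.
have xiy : q <= (s ord0 i + theta * r) - xi ord0 i - q + q by have := xis i; lra.
have : z ord0 i <= s ord0 i /\ s ord0 i + theta * r <= z ord0 i + r.
  have corner (w : rV) : box s (s + const_mx (theta * r)) w ->
      z ord0 i <= w ord0 i <= z ord0 i + r.
    rewrite -cube_box// => /sP[_]; rewrite cube_box// => /(_ i).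
    by rewrite !mxE.
  have c1 : box s (s + const_mx (theta * r)) s.
    by move=> i'; rewrite !mxE lexx lerDl ltW.
  have c2 : box s (s + const_mx (theta * r)) (s + const_mx (theta * r)).
    by move=> i'; rewrite !mxE lexx lerDl ltW.
  by have /andP[-> _] := corner _ c1; have /andP[_] := corner _ c2; rewrite !mxE.
have zi : z ord0 i = (tt i)%:~R / k by rewrite mxE.
rewrite zi -/q in yxi *; move: yxi.
have := xis i; rewrite cube_box// => /andP[x1 x2] /(_ i).
rewrite [(xi + _) ord0 i]mxE [(const_mx q : 'rV_d) ord0 i]mxE.
move=> /andP[y1 y2] [z1 z2].
have Y1 : (tt i)%:~R / k <= y ord0 i by apply: le_trans z1 _; apply: le_trans x1 _.
(* Strictness matters, as grid cubes are closed and tiles half-open: the ceiling gives [xi < s + q],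
   so [y <= xi + q < s + 2 q <= s + theta r <= z + r]. *)
have Y2 : y ord0 i < (tt i)%:~R / k + r by lra.
rewrite intrD; apply/andP; split.
  by rewrite [k * y ord0 i]mulrC -ler_pdivrMr.
by rewrite [k * y ord0 i]mulrC -ltr_pdivlMr// mulrDl [1%:~R / k]mul1r.
Qed.

Lemma hypotheses_large_on_far_tiles (V : rV -> R) (m : nat) (theta r0 : R)
    (D : 'rV[int]_d -> nat -> set rV) (gamma : R -> R) :
  (0 < d)%N -> measurable_fun setT V -> (forall x, 0 <= V x) ->
  (1 < m)%N -> 0 < theta < 1 ->
  (forall l, log_dense_system m theta (int_vec l) (D l)) ->
  m%:R^-1 < r0 -> (forall r : R, 0 < r < r0 -> 0 < gamma r < 1) ->
  (forall r s : R, 0 < r -> r <= s -> s < r0 -> gamma r <= gamma s) ->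
  limf_esup (fun r : R => (r ^- 2 * gamma r)%:E) 0^'+ = +oo%E ->
  (forall n : nat, (1 <= n)%N -> forall M : R, exists N : R, forall l : 'rV[int]_d,
     N < euclid_norm (int_vec l : rV) ->
     forall j xi, (1 <= j <= n)%N -> grid_corners m n (D l j) xi ->
     (M%:E < repeated_rearrangement (fun x t => (kernelY V x t)%:E) (psi d gamma m n)
        (cube (m%:R ^- n) xi) (cube (m%:R ^- n) xi))%E) ->
  large_on_far_tiles V.
Proof.
move=> d0 mV V0 m1 th hD mr0 gam01 gam lims hlim eps eps0.
have /andP[th0 _] := th.
have mR1 : 1 < m%:R :> R by rewrite ltr1n.
have mR0 : 0 < m%:R :> R by exact: lt_trans mR1.
have pow_large (y : R) : exists K : nat, y <= m%:R ^+ K.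
  exists (Num.truncn y).+1; apply: le_trans (ltW (truncnS_gt _)) _.
  by rewrite -natrX ler_nat ltnW// ltn_expl.
(* [K] leaves room for a grid cube after rounding; [K'] brings the tile edge below the radius
   [1 / (theta m^2)] allowed in a dense system. *)
have [K HK] := pow_large (2 / theta).
have thK : 2 <= theta * m%:R ^+ K by rewrite mulrC -ler_pdivrMr.
have [K' HK'] := pow_large (theta * m%:R ^+ 2).
(* With [1 / k = m^K q] and [kappa = gamma(q) q^d / 2], the first bound in [large_on_far_tiles] is
   exactly [C q^2 <= gamma(q)]. *)
pose C : R := (2 * m%:R ^+ K) ^+ d * (2 * (2 ^+ d * m%:R ^+ K ^+ 2)) * (2 / eps).
have C0 : 0 <= C.
  have P0 : 0 <= m%:R ^+ K :> R by rewrite exprn_ge0// ltW.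
  by do !(apply: mulr_ge0 || apply: exprn_ge0 || rewrite invr_ge0 ltW) => //.
have [n nK Hn] := exists_scale m1 mr0 gam lims (isT : (0 < (K + K').+1)%N) C0.
have Kn : (K < n)%N by apply: leq_trans nK; rewrite ltnS leq_addr.
set q : R := m%:R ^- n in Hn.
have q0 : 0 < q by rewrite invr_gt0 exprn_gt0.
have qr0 : q < r0.
  apply: le_lt_trans mr0; rewrite /q -{2}(expr1 (m%:R : R)).
  by rewrite lef_pV2 ?posrE ?exprn_gt0// ler_eXn2l// (leq_trans _ nK).
have /andP[g0 _] := gam01 q (introT andP (conj q0 qr0)).
have psiE : psi d gamma m n = gamma q * q ^+ d by rewrite /psi mes_cube.
have psi0 : 0 < psi d gamma m n by rewrite psiE mulr_gt0// exprn_gt0.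
set k : R := m%:R ^+ (n - K).
have k0 : 0 < k by rewrite exprn_gt0.
have kE : k^-1 = m%:R ^+ K * q.
  rewrite /q /k -{2}(subnK (ltnW Kn)) exprD invfM mulrCA mulfV ?mulr1//.
  by rewrite gt_eqF// exprn_gt0.
pose kappa := psi d gamma m n / 2.
have kap0 : 0 < kappa by rewrite divr_gt0.
(* [n] and [kappa] are fixed by now, so [sigma] is dictated by the second bound; the [1] secures
   positivity. *)
pose sigma := 1 + (2 / k) ^+ d * 2 / (eps * kappa).
have sig1 : 1 <= sigma.
  have ek : 0 < eps * kappa by exact: mulr_gt0.
  by rewrite lerDl divr_ge0 ?(ltW ek)// mulr_ge0// exprn_ge0// divr_ge0// ltW.
have sig0 : 0 < sigma by exact: lt_le_trans sig1.
pose rho : R := Num.min 1 (psi d gamma m n / 2) / 2.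
have [N HN] := hlim n (leq_ltn_trans (leq0n K) Kn) (sigma * rho ^- (d - 2)).
(* The [2] covers two losses below [1]: truncating [N], and replacing a coordinate of [x] by its
   integer part. *)
exists k, kappa, sigma, (Num.truncn N).+2; split => //.
  split.
    have -> : (2 / k) ^+ d * (2 * (2 ^+ d / k ^+ 2)) =
        eps / 2 * q ^+ d * (C * q ^+ 2).
      have k2 : k ^- 2 = (m%:R ^+ K * q) ^+ 2 by rewrite -kE exprVn.
      have key (P u c : R) : (2 * (P * u)) ^+ d * (2 * (c * (P * u) ^+ 2)) =
          eps / 2 * u ^+ d * ((2 * P) ^+ d * (2 * (c * P ^+ 2)) * (2 / eps) * u ^+ 2).
        rewrite (mulrA 2 P u) exprMn; move: ((2 * P) ^+ d) (u ^+ d) => A B; field.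
        by rewrite gt_eqF.
      by rewrite k2 kE; exact: key.
    rewrite /kappa psiE.
    have -> : eps * (gamma q * q ^+ d / 2) = eps / 2 * q ^+ d * gamma q by field.
    by rewrite ler_pM2l// mulr_gt0 ?exprn_gt0 ?divr_gt0.
  have ek : 0 < eps * kappa by exact: mulr_gt0.
  have Hs : (2 / k) ^+ d * 2 / (eps * kappa) <= sigma by rewrite /sigma; lra.
  rewrite [_ * (2 / sigma)]mulrA (ler_pdivrMr _ _ sig0) [eps * kappa * sigma]mulrC.
  by rewrite -(ler_pdivrMr _ _ ek).
move=> x [i xi].
have thn : theta * m%:R ^+ 2 < m%:R ^+ (n - K).
  apply: le_lt_trans HK' _; rewrite ltr_eXn2l//.
  by rewrite ltn_subRL.
have [l [lE [j [ksi [jn ksiD Hksi]]]]] := tile_contains_grid_cube x m1 th hD thK Kn thn.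
have Nl : N < euclid_norm (int_vec l : rV).
  apply: lt_le_trans (coord_le_euclid_norm _ i); rewrite mxE lE.
  have Hx : `|x ord0 i - (Num.floor (x ord0 i))%:~R| <= 1.
    have := floor_itv (x ord0 i); rewrite intrD => /andP[? ?].
    by rewrite ger0_norm ?subr_ge0//; lra.
  have := truncnS_gt N; have := ler_normD (x ord0 i - (Num.floor (x ord0 i))%:~R) (Num.floor (x ord0 i))%:~R.
  rewrite subrK; move: xi; rewrite -[(Num.truncn N).+2%:R]natr1 => xi H1 H2.
  lra.
have mQ : measurable (cube q ksi) by rewrite cube_box//; exact: measurable_box.
have := large_of_repeated_rearrangement d0 mV V0 mQ psi0 sig0 (HN l Nl j ksi jn ksiD).
move=> /le_trans; apply; apply: le_mes => y [yQ Vy]; split => //.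
exact: Hksi.
Qed.

End far_tiles.

(** * The form domain *)

Section semi_inner_constructions.
Context {R : realType}.

Lemma semi_inner_pullback (E F : lmodType R) (D : set E) (DF : set F) (b : F -> F -> R)
    (L : E -> F) :
  (forall u v, L (u + v) = L u + L v) -> (forall k u, L (k *: u) = k *: L u) ->
  (forall u, D u -> DF (L u)) -> semi_inner DF b ->
  semi_inner D (fun u v => b (L u) (L v)).
Proof.
move=> LD LZ DL [[bl br] bC b0]; split; last by move=> u /DL/b0.
  split=> w /DL wF.
    have [h1 h2] := bl _ wF; split=> [u v /DL uF /DL vF|k u /DL uF].
      by rewrite LD h1.
    by rewrite LZ h2.
  have [h1 h2] := br _ wF; split=> [u v /DL uF /DL vF|k u /DL uF].
    by rewrite LD h1.
  by rewrite LZ h2.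
by move=> u v /DL uF /DL vF; exact: bC.
Qed.

Lemma semi_inner_sum (E : lmodType R) (D : set E) (I : finType) (b : I -> E -> E -> R) :
  (forall i, semi_inner D (b i)) -> semi_inner D (fun u v => \sum_i b i u v).
Proof.
move=> bP; split; last by move=> u Du; apply: sumr_ge0 => i _; exact: (si_ge0 (bP i)).
  split=> w Dw; split=> [u v Du Dv|k u Du].
  - by rewrite -big_split; apply: eq_bigr => i _; exact: (siDl (bP i)).
  - by rewrite mulr_sumr; apply: eq_bigr => i _; exact: (siZl (bP i)).
  - by rewrite -big_split; apply: eq_bigr => i _; exact: (siDr (bP i)).
  - by rewrite mulr_sumr; apply: eq_bigr => i _; exact: (siZr (bP i)).
by move=> u v Du Dv; apply: eq_bigr => i _; exact: (siC (bP i)).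
Qed.

Lemma sum_option (I : finType) (F : option I -> R) :
  \sum_o F o = F None + \sum_i F (Some i).
Proof.
rewrite (bigD1 None)//=; congr (_ + _).
rewrite (reindex_omap Some id); last by case.
by apply: eq_bigl => i; rewrite eqxx.
Qed.

End semi_inner_constructions.

Section L2_limits.
Context {R : realType} {d : nat}.
Local Notation rV := 'rV[R]_d.
Local Notation mu := (mes d : {sigma_finite_measure set 'rV[R]_d -> \bar R}).
Implicit Types (f g h m v : rV -> R^o).

Lemma Lfun2_ae_eq f g : measurable_fun setT g -> f \in Lfun mu 2%:E ->
  (\forall x \ae mu, f x = g x) ->
  g \in Lfun mu 2%:E /\ inner mu g g = inner mu f f.
Proof.
move=> mg fL fg; have [mf ffin] := (Lfun2P mu f).1 fL.
have E : (\int[mu]_x (g x ^+ 2)%:E = \int[mu]_x (f x ^+ 2)%:E)%E.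
  apply: ae_eq_integral => //.
  - by apply/measurable_EFinP; exact: measurable_funX.
  - by apply/measurable_EFinP; exact: measurable_funX.
  - by apply: filterS fg => x -> _.
have gL : g \in Lfun mu 2%:E by apply/Lfun2P; split => //; rewrite E.
by split => //; apply: EFin_inj; rewrite !innerE.
Qed.

Lemma compact_support_partial (i : 'I_d) (phi : rV -> R) :
  compact (closure [set x | phi x != 0]) -> compact (closure [set x | partial i phi x != 0]).
Proof.
move=> pc; apply: (subclosed_compact _ pc); first exact: closed_closure.
rewrite [X in _ `<=` X](closure_id _).1; last exact: closed_closure.
apply: closureS => x /=; apply: contra_neqP => Hx.
have nx : \forall y \near x, phi y = 0.
  have : nbhs x (~` closure [set x | phi x != 0]).
    apply: open_nbhs_nbhs; split; last exact: Hx.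
    by apply: closed_openC; exact: closed_closure.
  apply: filterS => y Hy; apply/eqP; apply: contra_notT Hy => Hy.
  exact: subset_closure.
rewrite /partial (near_eq_derive (g := cst 0)); last exact: nx.
exact: derive_cst.
Qed.

Lemma test_function_partial_Lfun2 (i : 'I_d) (phi : rV -> R) : test_function phi ->
  phi \in Lfun mu 2%:E /\ partial i phi \in Lfun mu 2%:E.
Proof.
move=> [ps pc]; split; first exact: (test_function_Lfun2 (ps [::]).1 pc).
apply: (test_function_Lfun2 (ps [:: i]).1).
exact: (@compact_support_partial i).
Qed.

Definition cvg_L2 (u : nat -> rV -> R^o) v := forall e : R, 0 < e ->
  exists N, forall n, (N <= n)%N -> inner mu (u n - v) (u n - v) < e.

(* On the sets |h| <= M multiplication by h is bounded. *)
Lemma mul_closed h (u : nat -> rV -> R^o) v f : measurable_fun setT h ->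
  (forall n, u n \in Lfun mu 2%:E) -> (forall n, (fun x => h x * u n x) \in Lfun mu 2%:E) ->
  v \in Lfun mu 2%:E -> f \in Lfun mu 2%:E ->
  cvg_L2 u v -> cvg_L2 (fun n x => h x * u n x) f ->
  \forall x \ae mu, f x = h x * v x.
Proof.
move=> mh uL huL vL fL uv huf.
have iL := inner_semi_inner mu; have sL := Lfun2_submodule mu.
pose m (M : nat) x : R := (`|h x| <= M%:R)%R%:R.
have mm M : measurable_fun setT (m M).
  have -> : m M = \1_(h @^-1` `[- M%:R, M%:R]).
    apply/funext => x; rewrite /m indicE; congr (nat_of_bool _)%:R.
    by apply/idP/idP; rewrite ?inE /= in_itv/= -ler_norml// => /set_mem/=; rewrite in_itv/= -ler_norml.
  by apply: measurable_indic; rewrite -[X in measurable X]setTI; exact: mh.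
have m1 M x : `|m M x| <= 1 by rewrite /m normr_nat lern1 leq_b1.
have mhM M x : `|m M x * h x| <= M%:R.
  by rewrite /m; case: (boolP (`|h x| <= M%:R)) => H; rewrite ?mul1r ?mul0r ?normr0.
have ae0 M : \forall x \ae mu, m M x * h x * v x - m M x * f x = 0.
  have [mhvL _] := inner_mul_bounded (measurable_funM (mm M) mh) (mhM M) vL.
  have [mfL _] := inner_mul_bounded (mm M) (m1 M) fL.
  apply: (inner_eq0 (Lfun2B mhvL mfL)).
  apply: (@small_nonneg_eq0 _ _ (2 * M%:R ^+ 2 + 2)).
    exact: (si_ge0 iL (Lfun2B mhvL mfL)).
  move=> e e0; have [N1 HN1] := uv e e0; have [N2 HN2] := huf e e0.
  set n := maxn N1 N2.
  have := HN1 n (leq_maxl _ _); have := HN2 n (leq_maxr _ _).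
  have duL : u n - v \in Lfun mu 2%:E by exact: Lfun2B.
  have dhL : (fun x => h x * u n x) - f \in Lfun mu 2%:E by exact: (Lfun2B (huL n) fL).
  have [aL ale] := inner_mul_bounded (measurable_funM (mm M) mh) (mhM M) duL.
  have [bL ble] := inner_mul_bounded (mm M) (m1 M) dhL.
  (* Inserting the term with [h * u n] splits the difference into two bounded multiples of sequences
     that tend to [0] in [L2]. *)
  have -> : (fun x => m M x * h x * v x - m M x * f x) =
      (-1 : R) *: (fun x => m M x * h x * (u n - v) x) +
      (fun x => m M x * ((fun x => h x * u n x) - f) x).
    apply/funext => x.
    change (m M x * h x * v x - m M x * f x =
      -1 * (m M x * h x * (u n x - v x)) + m M x * (h x * u n x - f x)).
    by ring.
  have naL := Lfun2Z (-1) aL.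
  have := si_sqrD_le sL iL naL bL.
  have -> : inner mu (fun x => -1 * (m M x * h x * (u n - v) x))
      (fun x => -1 * (m M x * h x * (u n - v) x)) =
      inner mu (fun x => m M x * h x * (u n - v) x) (fun x => m M x * h x * (u n - v) x).
    by apply: eq_Rintegral => x _; rewrite mulN1r mulrNN.
  move: ale ble; rewrite expr1n mul1r => ale ble H1 h1 h2.
  apply: le_trans H1 _.
  have := ler_wpM2l (sqr_ge0 (M%:R : R)) (ltW h2).
  lra.
have := ae_foralln ae0; apply: filterS => x Hx.
have := Hx (Num.truncn `|h x|).+1.
by rewrite /m (ltW (truncnS_gt _)) !mul1r => /eqP; rewrite subr_eq0 => /eqP.
Qed.

Lemma weak_partial_closed (i : 'I_d) (u g : nat -> rV -> R^o) v f :
  (forall n, u n \in Lfun mu 2%:E) -> (forall n, g n \in Lfun mu 2%:E) ->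
  v \in Lfun mu 2%:E -> f \in Lfun mu 2%:E ->
  cvg_L2 u v -> cvg_L2 g f -> (forall n, weak_partial_R i (u n) (g n)) ->
  weak_partial_R i v f.
Proof.
move=> uL gL vL fL uv gf ug phi tphi.
have iL := inner_semi_inner mu; have sL := Lfun2_submodule mu.
have [pL dpL] := test_function_partial_Lfun2 i tphi.
apply/eqP; rewrite -subr_eq0 opprK -sqrf_eq0; apply/eqP.
set A := inner mu (partial i phi) (partial i phi); set B := inner mu phi phi.
apply: (@small_nonneg_eq0 _ _ (2 * A + 2 * B)); first exact: sqr_ge0.
move=> e e0; have [N1 HN1] := uv e e0; have [N2 HN2] := gf e e0.
set n := maxn N1 N2.
have := HN1 n (leq_maxl _ _); have := HN2 n (leq_maxr _ _).
have duL : u n - v \in Lfun mu 2%:E by exact: Lfun2B.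
have dgL : g n - f \in Lfun mu 2%:E by exact: Lfun2B.
have := cauchy_schwarz sL iL duL dpL; have := cauchy_schwarz sL iL dgL pL.
have := ug n phi tphi.
have -> : inner mu (u n - v) (partial i phi) = inner mu (u n) (partial i phi) - inner mu v (partial i phi).
  exact: innerBl.
have -> : inner mu (g n - f) phi = inner mu (g n) phi - inner mu f phi by exact: innerBl.
have A0 : 0 <= A := si_ge0 iL dpL; have B0 : 0 <= B := si_ge0 iL pL.
rewrite -/A -/B; move: (inner mu (u n) _) (inner mu (g n) _) (inner mu v _) (inner mu f _).
move=> a b x y -> HB HA /ltW Hg /ltW Hu.
have H1 := ler_wpM2r A0 Hu; have H2 := ler_wpM2r B0 Hg.
have := sqr_ge0 ((- b - x) - (b - y)); nra.
Qed.

End L2_limits.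

Section form_domain_space.
Context {R : realType} {d : nat}.
Local Notation rV := 'rV[R]_d.
Local Notation mu := (mes d : {sigma_finite_measure set 'rV[R]_d -> \bar R}).
Variable V : rV -> R.
Hypotheses (mV : measurable_fun setT V) (V0 : forall x, 0 <= V x).

(* w b None is the real (b = false) or imaginary (b = true) part of a function,
   w b (Some i) that of its i-th weak derivative. *)
Definition graph_space := bool -> option 'I_d -> rV -> R^o.
HB.instance Definition _ := GRing.Lmodule.copy graph_space (bool -> option 'I_d -> rV -> R^o).
Implicit Types (w v : graph_space).

(** The extra component [sqrt V * u] makes the form of [H + 1] a plain sum of [L2] inner products,
    so completeness can be studied component by component. *)
Definition graph_component (j : bool * option (option 'I_d)) w : rV -> R^o :=
  if j.2 is Some o then w j.1 o else fun x => Num.sqrt (V x) * w j.1 None x.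

(** The weak derivatives are part of the vector: the form is then a function of the vector alone,
    although a gradient is determined only almost everywhere. *)
Definition graph_domain : set graph_space := [set w |
  (forall j, graph_component j w \in Lfun mu 2%:E) /\
  forall b i, weak_partial_R i (w b None) (w b (Some i))].

Definition graph_form w v : R :=
  \sum_j inner mu (graph_component j w) (graph_component j v).

Definition graph_inner w v : R := \sum_b inner mu (w b None) (v b None).

Lemma graph_componentD j w v :
  graph_component j (w + v) = graph_component j w + graph_component j v.
Proof.
case: j => b [i|]; [by []|]; apply/funext => x.
by rewrite /graph_component /=; exact: mulrDr.
Qed.

Lemma graph_componentB j w v :
  graph_component j (w - v) = graph_component j w - graph_component j v.
Proof.
case: j => b [i|]; [by []|]; apply/funext => x.
by rewrite /graph_component /=; exact: mulrBr.
Qed.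

Lemma graph_componentZ j (k : R) w :
  graph_component j (k *: w) = k *: graph_component j w.
Proof.
case: j => b [i|]; [by []|]; apply/funext => x.
by rewrite /graph_component /=; exact: mulrCA.
Qed.

Lemma graph_domainL b o w : graph_domain w -> w b o \in Lfun mu 2%:E.
Proof. by move=> [wL _]; exact: (wL (b, Some o)). Qed.

Lemma graph_domain_submodule : submodule graph_domain.
Proof.
have sL := Lfun2_submodule mu; have iL := inner_semi_inner mu.
have [L0 LD LZ] := sL; split.
- split=> [j|b i phi tphi].
    have -> : graph_component j 0 = 0.
      by case: j => b [i|]; [by []|]; apply/funext => x; rewrite /graph_component /=; exact: mulr0.
    exact: L0.
  have z (f : rV -> R) : inner mu (0 : rV -> R^o) f = 0.
    by rewrite /inner /Rintegral integral0_eq// => x _; congr EFin; exact: mul0r.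
  by rewrite [LHS]z [X in - X]z oppr0.
- move=> w v wD vD; split=> [j|b i phi tphi].
    by rewrite graph_componentD; apply: LD; [exact: wD.1|exact: vD.1].
  have [pL dpL] := test_function_partial_Lfun2 i tphi.
  have H (o : option 'I_d) f : f \in Lfun mu 2%:E ->
      inner mu ((w + v) b o) f = inner mu (w b o) f + inner mu (v b o) f.
    by move=> fL; apply: (siDl iL) fL; exact: graph_domainL.
  by rewrite [LHS]H// [X in - X]H// (wD.2 b i phi tphi) (vD.2 b i phi tphi) opprD.
- move=> k w wD; split=> [j|b i phi tphi].
    by rewrite graph_componentZ; apply: LZ; exact: wD.1.
  have [pL dpL] := test_function_partial_Lfun2 i tphi.
  have H (o : option 'I_d) f : f \in Lfun mu 2%:E ->
      inner mu ((k *: w) b o) f = k * inner mu (w b o) f.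
    by move=> fL; apply: (siZl iL) fL; exact: graph_domainL.
  by rewrite [LHS]H// [X in - X]H// (wD.2 b i phi tphi) mulrN.
Qed.

Lemma graph_form_semi_inner : semi_inner graph_domain graph_form.
Proof.
apply: semi_inner_sum => j.
apply: (semi_inner_pullback (L := graph_component j) _ _ _ (inner_semi_inner mu)).
- exact: graph_componentD.
- exact: graph_componentZ.
- by move=> w wD; exact: wD.1.
Qed.

Lemma graph_inner_semi_inner : semi_inner graph_domain graph_inner.
Proof.
apply: semi_inner_sum => b.
apply: (semi_inner_pullback (L := fun w : graph_space => w b None) _ _ _ (inner_semi_inner mu)) => //.
by move=> w; exact: graph_domainL.
Qed.

Lemma graph_form_component w j : graph_domain w ->
  inner mu (graph_component j w) (graph_component j w) <= graph_form w w.
Proof.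
move=> wD; rewrite /graph_form (bigD1 j)//= lerDl; apply: sumr_ge0 => k _.
exact: (si_ge0 (inner_semi_inner mu) (wD.1 k)).
Qed.

Lemma graph_formE w v : graph_form w v =
  \sum_b (inner mu (w b None) (v b None) + (\sum_i inner mu (w b (Some i)) (v b (Some i)) +
    inner mu (fun x => Num.sqrt (V x) * w b None x) (fun x => Num.sqrt (V x) * v b None x))).
Proof.
have -> : graph_form w v =
    \sum_b \sum_o inner mu (graph_component (b, o) w) (graph_component (b, o) v).
  by rewrite pair_big /=; apply: eq_bigr => -[b o].
by apply: eq_bigr => b _; rewrite !sum_option /graph_component /= addrC addrA.
Qed.

Lemma graph_inner_le_form w : graph_domain w -> graph_inner w w <= graph_form w w.
Proof.
move=> wD; have iL := inner_semi_inner mu; rewrite graph_formE; apply: ler_sum => b _.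
rewrite lerDl addr_ge0//; last exact: (si_ge0 iL (wD.1 (b, None))).
by apply: sumr_ge0 => i _; exact: (si_ge0 iL (graph_domainL b (Some i) wD)).
Qed.

(** Riesz-Fischer yields a limit for every component; the point is that these limits are the
    components of one graph, by closedness of weak differentiation and of multiplication by
    [sqrt V]. *)
Lemma graph_form_complete : form_complete graph_domain graph_form.
Proof.
move=> u uD uC; have iL := inner_semi_inner mu; have sD := graph_domain_submodule.
have cB := graph_componentB.
have lim j : exists f, f \in Lfun mu 2%:E /\ cvg_L2 (fun n => graph_component j (u n)) f.
  have RF : form_complete [set f : rV -> R^o | f \in Lfun mu 2%:E] (inner mu).
    exact: riesz_fischer.
  have [||f fL Hf] := RF (fun n => graph_component j (u n)).
  - by move=> n; exact: (uD n).1.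
  - move=> e e0; have [N HN] := uC e e0; exists N => n k Nn Nk.
    rewrite -cB; apply: le_lt_trans (HN n k Nn Nk).
    by apply: graph_form_component; exact: submoduleB.
  by exists f.
have [f fP] := choice lim.
pose v : graph_space := fun b o => f (b, Some o).
have vL b o : v b o \in Lfun mu 2%:E by exact: (fP (b, Some o)).1.
have sV : measurable_fun setT (fun x => Num.sqrt (V x)).
  apply: (measurableT_comp (f := @Num.sqrt R) _ mV).
  by apply: nondecreasing_measurable => // x y xy; exact: ler_wsqrtr.
(* The limit of the [sqrt V] components is identified only almost everywhere, hence the later
   appeals to [Lfun2_ae_eq]. *)
have fV b : \forall x \ae mu, f (b, None) x = Num.sqrt (V x) * v b None x.
  apply: (mul_closed sV (u := fun n => u n b None)).
  - by move=> n; exact: graph_domainL (uD n).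
  - by move=> n; exact: ((uD n).1 (b, None)).
  - exact: vL.
  - exact: (fP _).1.
  - exact: (fP (b, Some None)).2.
  - exact: (fP (b, None)).2.
have mVv b : measurable_fun setT (fun x => Num.sqrt (V x) * v b None x).
  by apply: measurable_funM => //; exact: Lfun2_measurable (vL b None).
have vD : graph_domain v.
  split=> [[b [i|]]|b i]; first exact: vL.
    exact: (Lfun2_ae_eq (mVv b) (fP (b, None)).1 (fV b)).1.
  apply: (weak_partial_closed (u := fun n => u n b None) (g := fun n => u n b (Some i))).
  - by move=> n; exact: graph_domainL (uD n).
  - by move=> n; exact: graph_domainL (uD n).
  - exact: vL.
  - exact: vL.
  - exact: (fP (b, Some None)).2.
  - exact: (fP (b, Some (Some i))).2.
  - by move=> n; exact: (uD n).2.
exists v => // e e0.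
pose J := (bool * option (option 'I_d))%type.
pose e' := e / (#|{: J}|%:R + 1).
have J0 : 0 < #|{: J}|%:R + 1 :> R by rewrite ltr_wpDl.
have e'0 : 0 < e' by rewrite divr_gt0.
have vlim j : exists N, forall n, (N <= n)%N ->
    inner mu (graph_component j (u n - v)) (graph_component j (u n - v)) < e'.
  have [N HN] := (fP j).2 e' e'0; exists N => n /HN; rewrite cB.
  case: j {HN} => b [i|] //.
  have dL : graph_component (b, None) (u n) - f (b, None) \in Lfun mu 2%:E.
    exact: Lfun2B ((uD n).1 _) (fP _).1.
  have md : measurable_fun setT (graph_component (b, None) (u n) - graph_component (b, None) v).
    exact: Lfun2_measurable (Lfun2B ((uD n).1 _) (vD.1 _)).
  have [|_ ->] := Lfun2_ae_eq md dL; last by [].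
  apply: filterS (fV b) => x Hx.
  change (graph_component (b, None) (u n) x - f (b, None) x =
    graph_component (b, None) (u n) x - Num.sqrt (V x) * v b None x).
  by rewrite Hx.
have [N HN] := choice vlim.
exists (\max_j N j) => n Nn.
apply: (@le_lt_trans _ _ (\sum_(j : J) e')).
  by apply: ler_sum => j _; apply/ltW/HN/(leq_trans _ Nn); exact: leq_bigmax.
rewrite sumr_const -mulr_natr /e' -mulrA [_^-1 * _]mulrC mulrA ltr_pdivrMr//.
by rewrite ltr_pM2l// ltrDl.
Qed.

(** [compactness_inequality] is applied to the real and the imaginary part separately, which doubles
    the number of functionals. *)
Lemma graph_form_compact : large_on_far_tiles V -> forall eps : R, 0 < eps ->
  exists K (l : 'I_K -> graph_space -> R) (L : R), [/\ 0 <= L,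
    forall k, linear_on graph_domain (l k),
    forall k w, graph_domain w -> l k w ^+ 2 <= L * graph_form w w &
    forall w, graph_domain w ->
      graph_inner w w <= eps * graph_form w w + \sum_k l k w ^+ 2].
Proof.
move=> HV eps eps0; have [K [A [AL HA]]] := compactness_inequality mV V0 HV eps0.
have iL := inner_semi_inner mu; have sL := Lfun2_submodule mu.
pose I : finType := (bool * 'I_K)%type.
pose l (k : 'I_#|I|) (w : graph_space) := inner mu (A (enum_val k).2) (w (enum_val k).1 None).
pose L := \sum_j inner mu (A j) (A j).
have A0 j : 0 <= inner mu (A j) (A j) := si_ge0 iL (AL j).
exists #|I|, l, L; split.
- by apply: sumr_ge0 => j _; exact: A0.
- move=> k; split=> [w v wD vD|c w wD]; rewrite /l.
    by apply: (siDr iL); [exact: graph_domainL|exact: graph_domainL|exact: AL].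
  by apply: (siZr iL); [exact: graph_domainL|exact: AL].
- move=> k w wD; rewrite /l; set b := (enum_val k).1; set j := (enum_val k).2.
  apply: le_trans (cauchy_schwarz sL iL (AL j) (graph_domainL b None wD)) _.
  apply: ler_pM.
  + exact: A0.
  + exact: (si_ge0 iL (graph_domainL b None wD)).
  + by rewrite /L (bigD1 j)//= lerDl; apply: sumr_ge0 => i _; exact: A0.
  + exact: (graph_form_component (b, Some None) wD).
move=> w wD.
have -> : \sum_k l k w ^+ 2 = \sum_b \sum_j inner mu (A j) (w b None) ^+ 2.
  rewrite pair_big /= (reindex_onto (fun i : 'I_#|I| => enum_val i) (fun i => enum_rank i)) /=.
    by apply: eq_big => [k|k _] //; rewrite enum_valK eqxx.
  by move=> i _; exact: enum_rankK.
rewrite graph_formE /graph_inner.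
rewrite mulr_sumr -big_split; apply: ler_sum => b _ /=.
apply: le_trans (HA (w b None) (fun i => w b (Some i)) _ _ _ _) _.
- exact: graph_domainL.
- by move=> i; exact: graph_domainL.
- exact: wD.2.
- exact: (wD.1 (b, None)).
rewrite lerD2r; apply: ler_wpM2l; first exact: ltW.
by rewrite lerDr; exact: (si_ge0 iL (graph_domainL b None wD)).
Qed.

End form_domain_space.

(** * Complex functions and the spectrum *)

Section complex_parts.
Context {R : realType} {d : nat}.
Local Notation rV := 'rV[R]_d.
Local Notation mu := (mes d : {sigma_finite_measure set 'rV[R]_d -> \bar R}).
Implicit Types (u f g : rV -> R[i]) (z : R[i]).

Definition reim (b : bool) z : R := if b then complex.Im z else complex.Re z.

Definition reim_fun b u : rV -> R^o := fun x => reim b (u x).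

Lemma reimD b z w : reim b (z + w) = reim b z + reim b w.
Proof. by case: b; case: z; case: w. Qed.

Lemma reimZ b (r : R) z : reim b (r%:C%C * z) = r * reim b z.
Proof. by case: b; case: z => x y /=; rewrite mul0r ?addr0 ?subr0. Qed.

Lemma reim_inj z w : (forall b, reim b z = reim b w) -> z = w.
Proof. by case: z w => a b [c e] H; have /= -> := H true; have /= -> := H false. Qed.

Lemma reim_sum b (I : finType) (F : I -> R[i]) :
  reim b (\sum_i F i) = \sum_i reim b (F i).
Proof. by apply: (big_morph (reim b)); [exact: reimD|case: b]. Qed.

Lemma Re_mul_conj z w : complex.Re (z * w^*) = \sum_b reim b z * reim b w.
Proof. by rewrite big_bool /=; case: z w => a b [c e] /=; rewrite mulrN opprK addrC. Qed.

Lemma L2P u : L2 u <-> forall b, reim_fun b u \in Lfun mu 2%:E.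
Proof.
split=> [[h0 h1] []|H] //; split; [exact: (H false)|exact: (H true)].
Qed.

Lemma normc_sqr z : Normc.normc z ^+ 2 = \sum_b reim b z ^+ 2.
Proof. by case: z => a b; rewrite big_bool /= sqr_sqrtr ?addr_ge0 ?sqr_ge0// addrC. Qed.

Lemma inner_sum (I : finType) (f g : I -> rV -> R^o) :
  (forall i, f i \in Lfun mu 2%:E) -> (forall i, g i \in Lfun mu 2%:E) ->
  \int[mu]_x (\sum_i f i x * g i x) = \sum_i inner mu (f i) (g i).
Proof.
move=> fL gL; have I1 i := Lfun2_mul_integrable (fL i) (gL i).
apply: EFin_inj; rewrite /Rintegral.
have E : (\int[mu]_x (\sum_i f i x * g i x)%:E = \sum_i \int[mu]_x (f i x * g i x)%:E)%E.
  by rewrite -integral_sum//; apply: eq_integral => x _; rewrite -sumEFin.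
rewrite E -sumEFin fineK; last first.
  by rewrite sum_fin_num; apply/allP => y /mapP[i _ ->]; exact: integrable_fin_num.
by apply: eq_bigr => i _; rewrite /inner /Rintegral fineK//; exact: integrable_fin_num.
Qed.

Lemma L2norm_sqr u : L2 u ->
  L2norm u ^+ 2 = \sum_b inner mu (reim_fun b u) (reim_fun b u).
Proof.
move=> /L2P uL; rewrite /L2norm sqr_sqrtr; last first.
  by apply: Rintegral_ge0 => x _; exact: sqr_ge0.
rewrite -inner_sum//; apply: eq_Rintegral => x _; rewrite normc_sqr.
by apply: eq_bigr => b _; rewrite expr2.
Qed.

Lemma L2_eq0 u : L2 u -> (\forall x \ae mu, u x = 0) <->
  \sum_b inner mu (reim_fun b u) (reim_fun b u) = 0.
Proof.
move=> /L2P uL; have iL := inner_semi_inner mu; split=> [u0|].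
  rewrite big1// => b _; apply: (ae_eq0_inner _ (uL b) (uL b)).
  by apply: filterS u0 => x; rewrite /reim_fun => ->; case: b.
rewrite big_bool => /eqP; rewrite paddr_eq0; try exact: (si_ge0 iL (uL _)).
move=> /andP[/eqP /(inner_eq0 (uL _)) h1 /eqP /(inner_eq0 (uL _)) h0].
by apply: filterS2 h0 h1 => x h0 h1; apply: reim_inj => -[].
Qed.

Lemma weak_partialE i u g :
  weak_partial i u g <-> forall b, weak_partial_R i (reim_fun b u) (reim_fun b g).
Proof.
have E v (r : rV -> R) b : \int[mu]_x reim b (v x * (r x)%:C%C) = inner mu (reim_fun b v) r.
  by apply: eq_Rintegral => x _; rewrite mulrC reimZ mulrC.
have N v : - cintegral v = Complex (- \int[mu]_x reim false (v x)) (- \int[mu]_x reim true (v x)).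
  by [].
split=> [H b phi tphi|H phi tphi].
  have := H phi tphi; rewrite N /cintegral => -[h0 h1].
  by rewrite -!E; case: b; [exact: h1|exact: h0].
rewrite N /cintegral; congr Complex.
  by have := H false phi tphi; rewrite -!E.
by have := H true phi tphi; rewrite -!E.
Qed.

End complex_parts.

Section real_form.
Context {R : realType} {d : nat}.
Local Notation rV := 'rV[R]_d.
Local Notation mu := (mes d : {sigma_finite_measure set 'rV[R]_d -> \bar R}).
Variable V : rV -> R.
Hypotheses (mV : measurable_fun setT V) (V0 : forall x, 0 <= V x).
Implicit Types (u v f : rV -> R[i]) (gu gv : 'I_d -> rV -> R[i]).
Implicit Types (w : @graph_space R d).

Definition graph_of u gu : @graph_space R d := fun b j =>
  reim_fun b (if j is Some i then gu i else u).

Lemma graph_of_surj w : exists u gu, w = graph_of u gu.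
Proof.
exists (fun x => Complex (w false None x) (w true None x)).
exists (fun i x => Complex (w false (Some i) x) (w true (Some i) x)).
by apply/funext => -[]; apply/funext => -[i|].
Qed.

Lemma graph_domainP u gu :
  graph_domain V (graph_of u gu) <-> form_domain V u /\ weak_gradient u gu.
Proof.
have VE b : reim_fun b (fun x => (Num.sqrt (V x))%:C%C * u x) =
    (fun x => Num.sqrt (V x) * reim_fun b u x).
  by apply/funext => x; rewrite /reim_fun reimZ.
split=> [[gL gW]|[[/L2P uL _ /L2P vL] gg]].
  have wg : weak_gradient u gu.
    move=> i; split; first by apply/L2P => b; exact: (gL (b, Some (Some i))).
    by apply/weak_partialE => b; exact: (gW b i).
  split=> //; split; [|by exists gu|].
    by apply/L2P => b; exact: (gL (b, Some None)).
  by apply/L2P => b; rewrite VE; exact: (gL (b, None)).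
split=> [[b [[i|]|]]|b i].
- by have /L2P := (gg i).1; exact.
- exact: uL.
- by rewrite /graph_component /= -VE; exact: vL.
by have /weak_partialE := (gg i).2; exact.
Qed.

(** [graph_form] belongs to [H + 1]; subtracting [graph_inner] gives back the form of [H]. *)
Lemma Re_form u gu v gv : graph_domain V (graph_of u gu) -> graph_domain V (graph_of v gv) ->
  complex.Re (Defs.form V u gu v gv) =
  graph_form V (graph_of u gu) (graph_of v gv) - graph_inner (graph_of u gu) (graph_of v gv).
Proof.
set U := graph_of u gu; set W := graph_of v gv => UD WD.
have -> : complex.Re (Defs.form V u gu v gv) =
    \int[mu]_x (\sum_(p : bool * option 'I_d)
      graph_component V (p.1, omap Some p.2) U x * graph_component V (p.1, omap Some p.2) W x).
  apply: eq_Rintegral => x _.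
  rewrite -[complex.Re _]/(reim false _) reimD reim_sum.
  rewrite -(pair_bigA _ (fun b j => graph_component V (b, omap Some j) U x *
    graph_component V (b, omap Some j) W x)) /=.
  transitivity (\sum_b (graph_component V (b, None) U x * graph_component V (b, None) W x +
    \sum_i U b (Some i) x * W b (Some i) x)); last first.
    by apply: eq_bigr => b _; rewrite sum_option.
  rewrite big_split exchange_big /= [RHS]addrC; congr (_ + _).
    by apply: eq_bigr => i _; exact: Re_mul_conj.
  rewrite -[complex.Re _]/(reim false _) -mulrA reimZ [reim false _]Re_mul_conj mulr_sumr; apply: eq_bigr => b _.
  rewrite /graph_component /= -[V x in LHS](sqr_sqrtr (V0 x)) /U /W /graph_of /reim_fun.
  by rewrite expr2; ring.
rewrite (inner_sum (f := fun p => graph_component V (p.1, omap Some p.2) U)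
  (g := fun p => graph_component V (p.1, omap Some p.2) W)); last 2 first.
- by move=> p; exact: UD.1.
- by move=> p; exact: WD.1.
rewrite -(pair_bigA _ (fun b j => inner mu (graph_component V (b, omap Some j) U)
    (graph_component V (b, omap Some j) W))) /=.
rewrite graph_formE /graph_inner -sumrB; apply: eq_bigr => b _.
by rewrite sum_option /= addrAC subrr add0r addrC.
Qed.

Lemma Re_inner f v : L2 f -> L2 v ->
  complex.Re (L2inner f v) = \sum_b inner mu (reim_fun b f) (reim_fun b v).
Proof.
move=> /L2P fL /L2P vL; rewrite -inner_sum//.
by apply: eq_Rintegral => x _; exact: Re_mul_conj.
Qed.

Definition imul u : rV -> R[i] := fun x => Complex (- complex.Im (u x)) (complex.Re (u x)).

(** Multiplication by [i], acting on a function and its derivatives at once; see [graph_of_imul]. *)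
Definition graph_rot w : @graph_space R d := fun b j x =>
  if b then w false j x else - w true j x.

Lemma graph_of_imul v gv : graph_of (imul v) (fun i => imul (gv i)) = graph_rot (graph_of v gv).
Proof. by apply/funext => -[]; apply/funext => -[i|]. Qed.

Lemma Im_mul_conj (z w : R[i]) : complex.Im (z * w^*) =
  complex.Re (z * (Complex (- complex.Im w) (complex.Re w))^*).
Proof. by case: z w => a b [c e] /=; ring. Qed.

Lemma Im_form u gu v gv :
  complex.Im (Defs.form V u gu v gv) = complex.Re (Defs.form V u gu (imul v) (fun i => imul (gv i))).
Proof.
apply: eq_Rintegral => x _.
rewrite -[LHS]/(reim true _) -[RHS]/(reim false _) !reimD !reim_sum; congr (_ + _).
  by apply: eq_bigr => i _; exact: Im_mul_conj.
exact: Im_mul_conj.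
Qed.

Lemma Im_inner f v : complex.Im (L2inner f v) = complex.Re (L2inner f (imul v)).
Proof. by apply: eq_Rintegral => x _; exact: Im_mul_conj. Qed.

Let oppE (f : rV -> R^o) : (fun x => - f x) = (-1 : R) *: f.
Proof. by apply/funext => x; rewrite -[RHS]/(-1 * f x) mulN1r. Qed.

Lemma Lfun2N (f : rV -> R^o) : f \in Lfun mu 2%:E -> (fun x => - f x) \in Lfun mu 2%:E.
Proof. by rewrite oppE; exact: Lfun2Z. Qed.

Lemma innerNl (f g : rV -> R^o) : f \in Lfun mu 2%:E -> g \in Lfun mu 2%:E ->
  inner mu (fun x => - f x) g = - inner mu f g.
Proof.
move=> fL gL; rewrite oppE [LHS](siZl (inner_semi_inner mu) (-1) fL gL).
by rewrite mulN1r.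
Qed.

Lemma graph_rot_domain w : graph_domain V w -> graph_domain V (graph_rot w).
Proof.
move=> wD; split=> [[[] j]|[] i phi tphi].
- by have := wD.1 (false, j); case: j.
- have -> : graph_component V (false, j) (graph_rot w) =
      (fun x => - graph_component V (true, j) w x).
    case: j => [j|]; first by [].
    by apply/funext => x; rewrite /graph_component /= mulrN.
  exact: Lfun2N (wD.1 (true, j)).
- exact: (wD.2 false i phi tphi).
- have [pL dpL] := test_function_partial_Lfun2 i tphi.
  rewrite [LHS](innerNl (graph_domainL true None wD) dpL).
  rewrite [X in _ = - X](innerNl (graph_domainL true (Some i) wD) pL); congr (- _).
  exact: (wD.2 true i phi tphi).
Qed.

(** Testing real parts is enough: the imaginary part against [v] is the real part against [i v], and
    the domain is stable under multiplication by [i]. *)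
Lemma schrodingerP u f : L2 f ->
  schrodinger V u f <-> exists2 gu, graph_domain V (graph_of u gu) &
    forall w, graph_domain V w -> graph_form V (graph_of u gu) w =
      graph_inner (graph_of u gu) w + \sum_b inner mu (reim_fun b f) (w b None).
Proof.
move=> fL; split=> [[uD _ [gu gug Hu]]|[gu UD Hu]].
  have UD : graph_domain V (graph_of u gu) by apply/graph_domainP.
  exists gu => // w; have [v [gv ->]] := graph_of_surj w => WD.
  have [vD gvv] := (graph_domainP v gv).1 WD.
  have := congr1 (@complex.Re R) (Hu v gv vD gvv).
  have [vL _ _] := vD.
  by rewrite Re_form// Re_inner// => /eqP; rewrite subr_eq addrC => /eqP.
have [uD gug] := (graph_domainP u gu).1 UD.
split => //; exists gu => // v gv vD gvv.
have WD : graph_domain V (graph_of v gv) by apply/graph_domainP.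
have re v' gv' : graph_domain V (graph_of v' gv') ->
    complex.Re (Defs.form V u gu v' gv') = complex.Re (L2inner f v').
  move=> WD'; have [[v'L _ _] _] := (graph_domainP v' gv').1 WD'.
  by rewrite Re_form// Re_inner// (Hu _ WD') addrAC subrr add0r.
apply: reim_inj => -[]; last exact: re.
change (complex.Im (Defs.form V u gu v gv) = complex.Im (L2inner f v)).
rewrite Im_form Im_inner; apply: re.
by rewrite graph_of_imul; exact: graph_rot_domain.
Qed.

End real_form.

Section spectral_theorem.
Context {R : realType} {d : nat}.
Local Notation rV := 'rV[R]_d.
Local Notation mu := (mes d : {sigma_finite_measure set 'rV[R]_d -> \bar R}).
Variable V : rV -> R.
Hypotheses (mV : measurable_fun setT V) (V0 : forall x, 0 <= V x).
Implicit Types (u v f : rV -> R[i]) (gu gv : 'I_d -> rV -> R[i]) (z : R[i]).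
Implicit Types (w : @graph_space R d).
Local Notation DV := (graph_domain V).
Local Notation aV := (graph_form V).

(* graph_form is the form of H + 1, hence the shift by 1. *)
Definition graph_shift z w w' : R :=
  (1 + complex.Re z) * graph_inner w w' + complex.Im z * graph_inner (graph_rot w) w'.

Definition graph_rhs f w : R := \sum_b inner mu (reim_fun b f) (w b None).

Lemma reim_fun_affine b z u f : reim_fun b (fun x => z * u x + f x) =
  ((complex.Re z *: reim_fun b u + complex.Im z *: reim_fun b (imul u)) + reim_fun b f)%R.
Proof.
apply/funext => x; case: z => p q; rewrite -[LHS]/(reim b _) reimD; congr (_ + _).
change (reim b ((p +i* q)%C * u x) = p * reim b (u x) + q * reim b (imul u x)).
by case: b; rewrite /imul; case: (u x) => a c /=; ring.
Qed.

Lemma L2_imul u : L2 u -> L2 (imul u).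
Proof.
move=> /L2P uL; apply/L2P => -[]; first exact: (uL false).
exact: (Lfun2N (uL true)).
Qed.

Lemma L2_affine z u f : L2 u -> L2 f -> L2 (fun x => z * u x + f x).
Proof.
move=> uL fL; have iuL := (L2P _).1 (L2_imul uL); apply/L2P => b; rewrite reim_fun_affine.
have /L2P uL' := uL; have /L2P fL' := fL.
exact: Lfun2D (Lfun2D (Lfun2Z _ (uL' b)) (Lfun2Z _ (iuL b))) (fL' b).
Qed.

Lemma schrodinger_affineP z u f : L2 f -> schrodinger V u (fun x => z * u x + f x) <->
  exists2 gu, DV (graph_of u gu) & forall w, DV w ->
    aV (graph_of u gu) w = graph_shift z (graph_of u gu) w + graph_rhs f w.
Proof.
move=> fL; have iL := inner_semi_inner mu; have [_ LD LZ] := Lfun2_submodule mu.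
have key gu w : DV (graph_of u gu) -> DV w ->
    graph_inner (graph_of u gu) w +
      \sum_b inner mu (reim_fun b (fun x => z * u x + f x)) (w b None) =
    graph_shift z (graph_of u gu) w + graph_rhs f w.
  move=> UD wD; have [[uL _ _] _] := (graph_domainP V u gu).1 UD.
  have iuL := (L2P _).1 (L2_imul uL); have /L2P uL' := uL; have /L2P fL' := fL.
  rewrite /graph_shift mulrDl mul1r -!addrA; congr (_ + _).
  rewrite /graph_inner /graph_rhs !mulr_sumr -!big_split; apply: eq_bigr => b _ /=.
  have wL := graph_domainL b None wD.
  rewrite reim_fun_affine.
  have pL : complex.Re z *: reim_fun b u \in Lfun mu 2%:E by exact: (LZ _ _ (uL' b)).
  have qL : complex.Im z *: reim_fun b (imul u) \in Lfun mu 2%:E by exact: (LZ _ _ (iuL b)).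
  rewrite (siDl iL (LD _ _ pL qL) (fL' b) wL) (siDl iL pL qL wL).
  rewrite (siZl iL _ (uL' b) wL) (siZl iL _ (iuL b) wL) addrA.
  by have -> : graph_rot (graph_of u gu) b None = reim_fun b (imul u) by case: (b).
split=> [Hs|[gu UD Hu]].
  have uL : L2 u by case: Hs => -[].
  have [gu UD Hu] := (schrodingerP V0 u (L2_affine z uL fL)).1 Hs.
  by exists gu => // w wD; rewrite Hu// key.
have [[uL _ _] _] := (graph_domainP V u gu).1 UD.
apply/(schrodingerP V0 u (L2_affine z uL fL)); exists gu => // w wD.
by rewrite Hu// key.
Qed.

(** In each component the real part of the product of [w] with the conjugate of [i w] integrates to
    [0]; the weight [sqrt V] is real and does not disturb this. *)
Lemma graph_rot_rhs w : DV w -> graph_inner w (graph_rot w) = 0 /\ aV w (graph_rot w) = 0.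
Proof.
move=> wD; have iL := inner_semi_inner mu.
have key (j : option (option 'I_d)) : \sum_b inner mu (graph_component V (b, j) w)
    (graph_component V (b, j) (graph_rot w)) = 0.
  rewrite big_bool /=.
  have -> : graph_component V (false, j) (graph_rot w) =
      (fun x => - graph_component V (true, j) w x).
    case: j => [j|]; first by [].
    by apply/funext => x; rewrite /graph_component /= mulrN.
  have -> : graph_component V (true, j) (graph_rot w) = graph_component V (false, j) w.
    by case: j.
  rewrite (siC iL (wD.1 (false, j)) (Lfun2N (wD.1 (true, j)))).
  by rewrite (innerNl (wD.1 (true, j)) (wD.1 (false, j))) subrr.
split; first exact: (key (Some None)).
have -> : aV w (graph_rot w) = \sum_j \sum_b inner mu (graph_component V (b, j) w)
    (graph_component V (b, j) (graph_rot w)).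
  by rewrite exchange_big pair_big /=; apply: eq_bigr => -[b j].
by rewrite big1.
Qed.

Lemma graph_rot_inner w w' : DV w -> DV w' ->
  graph_inner (graph_rot w) (graph_rot w') = graph_inner w w'.
Proof.
move=> wD w'D; rewrite /graph_inner !big_bool /= addrC; congr (_ + _).
by apply: eq_Rintegral => x _; rewrite /graph_rot mulrNN.
Qed.

Lemma graph_shift_bilinear z : bilinear_on DV (graph_shift z).
Proof.
have cP := graph_inner_semi_inner V; have [D0 DD DZ] := graph_domain_submodule V.
have rD := @graph_rot_domain R d V.
have rotD w w' : graph_rot (w + w') = graph_rot w + graph_rot w'.
  apply/funext => b; apply/funext => j; apply/funext => x; case: b => //=.
  exact: opprD.
have rotZ (k : R) w : graph_rot (k *: w) = k *: graph_rot w.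
  apply/funext => b; apply/funext => j; apply/funext => x; case: b => //=.
  by rewrite /graph_rot -[RHS]/(k * - w true j x) mulrN.
split=> w wD; split=> [u v uD vD|k u uD]; rewrite /graph_shift.
- rewrite rotD (siDl cP uD vD wD) (siDl cP (rD _ uD) (rD _ vD) wD); ring.
- rewrite rotZ (siZl cP k uD wD) (siZl cP k (rD _ uD) wD); ring.
- rewrite (siDr cP uD vD wD) (siDr cP uD vD (rD _ wD)); ring.
- rewrite (siZr cP k uD wD) (siZr cP k uD (rD _ wD)); ring.
Qed.

Lemma graph_shift_bound z w w' : DV w -> DV w' -> graph_shift z w w' ^+ 2 <=
  (2 * (1 + complex.Re z) ^+ 2 + 2 * complex.Im z ^+ 2) * (graph_inner w w * graph_inner w' w').
Proof.
move=> wD w'D; have cP := graph_inner_semi_inner V; have sD := graph_domain_submodule V.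
have H1 := cauchy_schwarz sD cP wD w'D.
have := cauchy_schwarz sD cP (graph_rot_domain wD) w'D.
rewrite graph_rot_inner// => H2; rewrite /graph_shift.
move: H1 H2; move: (graph_inner w w') (graph_inner (graph_rot w) w').
move: (graph_inner w w * _) (1 + complex.Re z) (complex.Im z) => M p q A B H1 H2.
have := sqr_ge0 (p * A - q * B).
have := ler_wpM2l (sqr_ge0 p) H1; have := ler_wpM2l (sqr_ge0 q) H2; nra.
Qed.

Lemma graph_rhs_linear f : L2 f -> linear_on DV (graph_rhs f).
Proof.
move=> /L2P fL; have iL := inner_semi_inner mu.
split=> [w w' wD w'D|k w wD]; rewrite /graph_rhs.
  rewrite -big_split; apply: eq_bigr => b _ /=.
  exact: (siDr iL (graph_domainL b None wD) (graph_domainL b None w'D) (fL b)).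
rewrite mulr_sumr; apply: eq_bigr => b _.
exact: (siZr iL k (graph_domainL b None wD) (fL b)).
Qed.

Lemma graph_rhs_bound f w : L2 f -> DV w -> graph_rhs f w ^+ 2 <= 2 * L2norm f ^+ 2 * aV w w.
Proof.
move=> fL wD; have iL := inner_semi_inner mu; have sL := Lfun2_submodule mu.
have /L2P fL' := fL.
apply: (@le_trans _ _ (2 * L2norm f ^+ 2 * graph_inner w w)); last first.
  apply: ler_wpM2l; last exact: graph_inner_le_form.
  by rewrite mulr_ge0// sqr_ge0.
rewrite L2norm_sqr// /graph_rhs /graph_inner !big_bool /=.
have H b := cauchy_schwarz sL iL (fL' b) (graph_domainL b None wD).
have p b := si_ge0 iL (fL' b); have q b := si_ge0 iL (graph_domainL b None wD).
have := mulr_ge0 (p true) (q false); have := mulr_ge0 (p false) (q true).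
have := H true; have := H false.
move: (inner mu _ _) (inner mu _ _) (inner mu _ _) (inner mu _ _) (inner mu _ _) (inner mu _ _).
move=> X1 X0 F1 F0 W1 W0; have := sqr_ge0 (X1 - X0); nra.
Qed.


Lemma L2_0 : L2 ((fun=> 0) : rV -> R[i]) /\ L2norm ((fun=> 0) : rV -> R[i]) ^+ 2 = 0.
Proof.
have L0 : L2 ((fun=> 0) : rV -> R[i]).
  apply/L2P => b; have [L0 _ _] := Lfun2_submodule mu.
  by have -> : reim_fun b ((fun=> 0) : rV -> R[i]) = 0 by apply/funext => x; case: b.
split=> //; rewrite L2norm_sqr//; apply/(L2_eq0 L0).
exact: nearW.
Qed.

Lemma graph_rhs0 w : graph_rhs (fun=> 0) w = 0.
Proof.
rewrite /graph_rhs big1// => b _; rewrite /inner /Rintegral integral0_eq// => x _.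
by rewrite /reim_fun; case: b; rewrite mul0r.
Qed.

Lemma eigenvectorP z u : eigenvector (schrodinger V) z u <->
  exists2 gu, DV (graph_of u gu) & forall w, DV w ->
    aV (graph_of u gu) w = graph_shift z (graph_of u gu) w.
Proof.
have -> : eigenvector (schrodinger V) z u = schrodinger V u (fun x => z * u x + 0).
  by rewrite /eigenvector; congr schrodinger; apply/funext => x; rewrite addr0.
have E := schrodinger_affineP z u L2_0.1.
split=> [/E[gu UD Hu]|[gu UD Hu]].
  by exists gu => // w wD; rewrite Hu// graph_rhs0 addr0.
by apply/E; exists gu => // w wD; rewrite Hu// graph_rhs0 addr0.
Qed.

Lemma graph_of_inner u gu : DV (graph_of u gu) ->
  graph_inner (graph_of u gu) (graph_of u gu) = L2norm u ^+ 2.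
Proof. by move=> /graph_domainP[[uL _ _] _]; rewrite L2norm_sqr. Qed.

(** The Fredholm alternative with [a] the form of [H + 1], [c] the [L2] inner product and [s] the
    shift by [1 + z]. *)
Lemma resolvent_or_eigenvalue z : large_on_far_tiles V ->
  resolvent_set (schrodinger V) z \/
  exists w, [/\ DV w, graph_inner w w != 0 & forall w', DV w' -> aV w w' = graph_shift z w w'].
Proof.
move=> HV; pose Z2 := 2 * (1 + complex.Re z) ^+ 2 + 2 * complex.Im z ^+ 2.
have Z20 : 0 <= Z2 by rewrite addr_ge0// mulr_ge0// sqr_ge0.
have Z0 := sqrtr_ge0 Z2; set Z := Num.sqrt Z2 in Z0.
(* Chosen so that [Z * eps <= 1 / 2]; the denominator has [Z + 1] because [Z] may vanish. *)
pose eps := 1 / (2 * (Z + 1)).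
have Z10 : 0 < Z + 1 by rewrite ltr_wpDl.
have eps0 : 0 < eps by rewrite divr_gt0// mulr_gt0.
have [K [l [L [L0 ll lL lc]]]] := graph_form_compact mV V0 HV eps0.
have Ze : Z * eps <= 1 / 2.
  rewrite /eps mul1r invfM mulrCA -[leRHS]mulr1 mul1r ler_pM2l ?invr_gt0//.
  by rewrite ler_pdivrMr// mul1r lerDl.
have sb w w' : DV w -> DV w' ->
    graph_shift z w w' ^+ 2 <= Z ^+ 2 * (graph_inner w w * graph_inner w' w').
  by move=> wD w'D; rewrite sqr_sqrtr//; exact: graph_shift_bound.
have aP := graph_form_semi_inner V; have cP := graph_inner_semi_inner V.
have [[w wD [w0 Hw]]|[C C0 HC]] := fredholm_alternative (graph_domain_submodule V)
    aP (graph_form_complete mV) cP (@graph_inner_le_form _ _ V) (graph_shift_bilinear z)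
    Z0 sb ll L0 lL lc Ze.
  by right; exists w.
left.
(* This estimate serves twice: for [f = 0] it gives uniqueness, in general the bound on the
   inverse. *)
have bound u f : L2 f -> schrodinger V u (fun x => z * u x + f x) ->
    L2norm u ^+ 2 <= C * (2 * L2norm f ^+ 2).
  move=> fL /(schrodinger_affineP z u fL)[gu UD Hu]; rewrite -(graph_of_inner UD).
  apply: le_trans (graph_inner_le_form UD) _.
  have F0 : 0 <= 2 * L2norm f ^+ 2 by rewrite mulr_ge0// sqr_ge0.
  by have [_] := HC _ _ (graph_rhs_linear fL) F0 (fun w wD => graph_rhs_bound fL wD); apply.
split.
- move=> f fL.
  have F0 : 0 <= 2 * L2norm f ^+ 2 by rewrite mulr_ge0// sqr_ge0.
  have [[w wD Hw] _] := HC _ _ (graph_rhs_linear fL) F0 (fun w wD => graph_rhs_bound fL wD).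
  have [u [gu wE]] := graph_of_surj w; rewrite wE in wD Hw.
  by exists u; apply/(schrodinger_affineP z u fL); exists gu.
- move=> u Hu; have uL : L2 u by case: Hu => -[].
  have [L0' N0] := L2_0.
  apply/(L2_eq0 uL); rewrite -L2norm_sqr//; apply/eqP; rewrite eq_le sqr_ge0 andbT.
  have := bound u _ L0'; rewrite N0 !mulr0; apply.
  by move: Hu; congr schrodinger; apply/funext => x; rewrite addr0.
- exists (Num.sqrt (2 * C)) => u f fL Hu.
  have C20 : 0 <= 2 * C by rewrite mulr_ge0.
  have n0 (v : rV -> R[i]) : 0 <= L2norm v by exact: sqrtr_ge0.
  rewrite -ler_sqr ?nnegrE ?mulr_ge0 ?sqrtr_ge0//.
  by rewrite exprMn (sqr_sqrtr C20) [2 * C]mulrC -mulrA; exact: bound.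
Qed.

Lemma Re_le_normc z : `|complex.Re z| <= Normc.normc z.
Proof.
by case: z => p q /=; rewrite -sqrtr_sqr ler_sqrt ?addr_ge0 ?sqr_ge0// lerDl sqr_ge0.
Qed.

Lemma ReB z z' : complex.Re (z - z') = complex.Re z - complex.Re z'.
Proof. by case: z z' => p q []. Qed.

(** Testing the eigenvalue equation of [w] against [i w] annihilates every term except [Im z] times
    [graph_inner w w]. *)
Lemma eigenvalue_real z w : DV w -> graph_inner w w != 0 ->
  (forall w', DV w' -> aV w w' = graph_shift z w w') -> complex.Im z = 0.
Proof.
move=> wD w0 Hw; have := Hw _ (graph_rot_domain wD); rewrite /graph_shift.
have [-> ->] := graph_rot_rhs wD; rewrite graph_rot_inner// mulr0 add0r => /esym/eqP.
by rewrite mulf_eq0 (negbTE w0) orbF => /eqP.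
Qed.

Theorem large_on_far_tiles_discrete :
  large_on_far_tiles V -> discrete_spectrum (schrodinger V).
Proof.
move=> HV; have aP := graph_form_semi_inner V; have cP := graph_inner_semi_inner V.
have sD := graph_domain_submodule V.
have spec z : spectrum (schrodinger V) z -> [/\ complex.Im z = 0,
    form_eigenvalue DV aV (@graph_inner R d) (1 + complex.Re z) &
    exists w, [/\ DV w, graph_inner w w != 0 &
      forall w', DV w' -> aV w w' = graph_shift z w w']].
  move=> Sz; have [//|[w [wD w0 Hw]]] := resolvent_or_eigenvalue z HV.
  have y0 := eigenvalue_real wD w0 Hw; split=> //; last by exists w.
  exists w => //; split=> // w' w'D.
  by rewrite Hw// /graph_shift y0 mul0r addr0.
have comp eps : 0 < eps -> exists K (l : 'I_K -> @graph_space R d -> R),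
    (forall k, linear_on DV (l k)) /\
    (forall w, DV w -> graph_inner w w <= eps * aV w w + \sum_k l k w ^+ 2).
  move=> eps0; have [K [l [L [_ ll _ lc]]]] := graph_form_compact mV V0 HV eps0.
  by exists K, l.
move=> z Sz; have [y0 _ [w [wD w0 Hw]]] := spec z Sz; split.
- split=> //.
  have [e e0 He] := form_eigenvalue_isolated (1 + complex.Re z) sD aP cP comp.
  exists e => // z' Sz' zz'; have [y'0 ev _] := spec z' Sz'.
  have Ezz : (1 + complex.Re z') - (1 + complex.Re z) = complex.Re z' - complex.Re z by ring.
  have Ez : 1 + complex.Re z' = 1 + complex.Re z.
    apply: He ev _; rewrite Ezz; apply: le_lt_trans zz'.
    by rewrite -ReB; exact: Re_le_normc.
  by apply: reim_inj => -[]; [rewrite /= y0 y'0|rewrite /=; lra].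
- have [u [gu wE]] := graph_of_surj w; rewrite wE in wD w0 Hw.
  exists u; first by apply/eigenvectorP; exists gu.
  have [[uL _ _] _] := (graph_domainP V u gu).1 wD.
  by move=> /(L2_eq0 uL) u0; move: w0; rewrite graph_of_inner// L2norm_sqr// u0 eqxx.
(* The eigenspace is treated as a real vector space at the shifted eigenvalue; a finite family
   spanning it with real coefficients also spans it over the complex numbers. *)
pose x := 1 + complex.Re z.
pose N : set (@graph_space R d) := [set w | DV w /\ forall w', DV w' -> aV w w' = x * graph_inner w w'].
have sN : submodule N.
  have [D0 DD DZ] := sD; split.
  - split=> // w' w'D; have := siZl aP 0 D0 w'D; have := siZl cP 0 D0 w'D.
    by rewrite !scale0r !mul0r => -> ->; rewrite mulr0.
  - move=> u v [uD Hu] [vD Hv]; split; first exact: DD.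
    by move=> w' w'D; rewrite (siDl aP uD vD w'D) (siDl cP uD vD w'D) Hu// Hv// mulrDr.
  - move=> k u [uD Hu]; split; first exact: DZ.
    by move=> w' w'D; rewrite (siZl aP k uD w'D) (siZl cP k uD w'D) Hu// mulrCA.
have ND : N `<=` DV by move=> v [].
(* On the eigenspace [eps * a v v = eps * x * c v v], which is absorbed into the left side once
   [x * eps <= 1 / 2]. *)
pose eps := 1 / (2 * (`|x| + 1)).
have x10 : 0 < `|x| + 1 by rewrite ltr_wpDl.
have eps0 : 0 < eps by rewrite divr_gt0// mulr_gt0.
have xe : x * eps <= 1 / 2.
  rewrite /eps mul1r invfM mulrCA -[leRHS]mulr1 mul1r ler_pM2l ?invr_gt0//.
  by rewrite ler_pdivrMr// mul1r (le_trans (ler_norm x))// lerDl.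
have [K [l [ll lc]]] := comp eps eps0.
have Nbound (v : @graph_space R d) : N v -> graph_inner v v <= 2 * \sum_k l k v ^+ 2.
  move=> [vD Hv]; have := lc v vD; rewrite (Hv v vD).
  have := si_ge0 cP vD; move: (graph_inner v v) (\sum_k _) => c s c0.
  have := ler_wpM2r c0 xe; nra.
have [n [ws [wsN Hspan]]] := finite_span sD cP sN ND ll Nbound.
pose cw k (y : rV) : R[i] := Complex (ws k false None y) (ws k true None y).
have graph_eq (v : @graph_space R d) : exists gv,
    v = graph_of (fun y => Complex (v false None y) (v true None y)) gv.
  exists (fun i y => Complex (v false (Some i) y) (v true (Some i) y)).
  by apply/funext => -[]; apply/funext => -[i|].
exists n, cw; split=> [k|u /eigenvectorP[gu UD Hu]].
  have [gv E] := graph_eq (ws k); have [wsD Hws] := wsN k; apply/eigenvectorP.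
  exists gv; rewrite -E// => w' w'D.
  by rewrite Hws// /graph_shift y0 mul0r addr0.
have UN : N (graph_of u gu).
  by split=> // w' w'D; rewrite Hu// /graph_shift y0 mul0r addr0.
have [e He] := Hspan _ UN; exists (fun k => (e k)%:C%C).
set v := graph_of u gu - _ in He.
have vD : DV v by apply: (submoduleB sD UD); apply: (submodule_sum _ _ sD) => k; exact: (ND _ (wsN k)).
have iL := inner_semi_inner mu.
have v0 b : \forall y \ae mu, v b None y = 0.
  have vL := graph_domainL b None vD; apply: (inner_eq0 vL).
  move: He; rewrite /graph_inner big_bool => /eqP.
  rewrite paddr_eq0; try exact: (si_ge0 iL (graph_domainL _ None vD)).
  by move=> /andP[/eqP ? /eqP ?]; case: (b).
have vE b y : v b None y = reim b (u y) - \sum_k e k * ws k b None y.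
  rewrite /v -[LHS]/(reim b (u y) - (\sum_k e k *: ws k) b None y); congr (_ - _).
  apply: (big_morph (fun s : @graph_space R d => s b None y)) => //.
apply: filterS2 (v0 false) (v0 true) => y h0 h1; apply: reim_inj => b.
rewrite reim_sum; have /eqP : v b None y = 0 by case: b.
rewrite vE subr_eq0 => /eqP ->; apply: eq_bigr => k _.
by rewrite reimZ; case: b.
Qed.

End spectral_theorem.

Theorem theorem4p9 (R : realType) (d : nat) (hd : (3 <= d)%N)
  (V : 'rV[R]_d -> R) (hV0 : forall x, 0 <= V x)
  (p : R) (hp : d%:R / 2 < p) (hV : Lp_loc p V)
  (m : nat) (hm : (1 < m)%N) (theta : R) (htheta : 0 < theta < 1)
  (D : 'rV[int]_d -> nat -> set 'rV[R]_d)
  (hD : forall l, log_dense_system m theta (int_vec l) (D l))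
  (hXi : forall (l : 'rV[int]_d) (n j : nat), (1 <= j <= n)%N ->
     grid_corners m n (D l j) !=set0)
  (r0 : R) (hr0 : m%:R^-1 < r0) (gamma : R -> R)
  (hgamma01 : forall r : R, 0 < r < r0 -> 0 < gamma r < 1)
  (hgamma : forall r s : R, 0 < r -> r <= s -> s < r0 -> gamma r <= gamma s)
  (hlimsup : limf_esup (fun r : R => (r ^- 2 * gamma r)%:E) 0^'+ = +oo%E)
  (hlim : forall n : nat, (1 <= n)%N ->
     forall M : R, exists N : R, forall l : 'rV[int]_d,
       N < euclid_norm (int_vec l : 'rV[R]_d) ->
       let Xi : set 'rV[R]_d :=
         \bigcup_(j in [set j | (1 <= j <= n)%N]) grid_corners m n (D l j) in
       let values : set (\bar R) := [set z | exists xi eta : 'rV[R]_d,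
         [/\ Xi xi, Xi eta,
             euclid_norm (xi - eta) <=
               Num.sqrt d%:R / theta * m%:R ^ (- (n%:Z - 2)) &
             z = repeated_rearrangement
                   (fun x t => (kernelY V x t)%:E) (psi d gamma m n)
                   (cube (m%:R ^- n) xi) (cube (m%:R ^- n) eta)]] in
       (M%:E < ereal_inf values)%E) :
  discrete_spectrum (schrodinger V).
Proof.
have d0 : (0 < d)%N by exact: leq_trans hd.
apply: (large_on_far_tiles_discrete hV.1 hV0).
apply: (hypotheses_large_on_far_tiles d0 hV.1 hV0 hm htheta hD hr0 hgamma01 hgamma hlimsup).
move=> n n1 M; have [N HN] := hlim n n1 M; exists N => l /HN H j xi jn xiD.
(* A diagonal pair has distance [0], so its value is among those over which the infimum is taken. *)
apply: (lt_le_trans H); apply: ereal_inf_lbound; exists xi, xi.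
have Xi : (\bigcup_(j in [set j | (1 <= j <= n)%N]) grid_corners m n (D l j)) xi by exists j.
split => //; rewrite subrr /euclid_norm big1; last by move=> i _; rewrite mxE expr0n.
rewrite sqrtr0; have /andP[th0 _] := htheta.
by rewrite mulr_ge0 ?divr_ge0 ?sqrtr_ge0 ?exprz_ge0 ?ler0n// ltW.
Qed.
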